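(* If $D$ is a standard divisor on $E^g$ of type $(n_1,\ldots,n_g)$ with $n_i\ge2$ for all $i$, then $$\dim_{\mathbb C}H^0(E^g,\mathcal O(D))=d(n_1,\ldots,n_g).$$ In particular, if $n>k\ge1$ are relatively prime integers with $\frac nk=[n_1,\ldots,n_g]$, all $n_i\ge2$, then $\dim_{\mathbb C}H^0(E^g,\mathcal L_{n/k})=n$.
   Context: $E=\mathbb C/\Lambda$ is a complex elliptic curve with identity $0$, $g\ge1$. For divisors $\mathfrak d_1,\ldots,\mathfrak d_g$ on $E$ and points $z_1,\ldots,z_{g-1}\in E$, put $$D_{\mathfrak d_i,z_j}=\sum_{i=1}^g\mathrm{pr}_i^*(\mathfrak d_i)+\sum_{j=1}^{g-1}\Delta^{z_j}_{j,j+1},\qquad \Delta^z_{j,j+1}=\{(x_1,\ldots,x_g)\in E^g\mid x_{j+1}=x_j+z\},$$ where $\mathrm{pr}_i:E^g\to E$ is the $i$-th projection. If all $\mathfrak d_i$ are effective, $D_{\mathfrak d_i,z_j}$ is called a standard divisor; its type is $(n_1,\ldots,n_g)$ where $n_i=\deg\mathfrak d_i+2-\delta_{i,1}-\delta_{i,g}$. $d(n_1,\ldots,n_g)$ is the determinant of the $g\times g$ tridiagonal matrix with diagonal entries $n_1,\ldots,n_g$ and all entries immediately above and below the diagonal equal to $-1$. $[n_1,\ldots,n_g]=n_1-\cfrac{1}{n_2-\cfrac{1}{\ddots-\cfrac1{n_g}}}$; each $\frac nk$ with $n>k\ge1$ coprime has a unique such expansion with $g\ge1$ and all $n_i\ge2$.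 $\mathcal L_{n/k}=\mathcal O_{E^g}(D_{n/k})$, where $D_{n/k}$ is the standard divisor with $\mathfrak d_i=(n_i-2+\delta_{i,1}+\delta_{i,g})(0)$ and all $z_j=0$. *)

(* Defs.v *)
From HB Require Import structures.
From mathcomp Require Import all_boot all_order all_algebra.
From mathcomp Require Import complex.
From mathcomp.multinomials Require Import freeg.
From mathcomp Require Import boolp classical_sets functions reals topology.
From mathcomp Require Import normedtype derive.

Set Implicit Arguments.
Unset Strict Implicit.
Unset Printing Implicit Defensive.

Import Order.TTheory GRing.Theory Num.Theory.
Import numFieldNormedType.Exports.

Local Open Scope classical_set_scope.
Local Open Scope quotient_scope.
Local Open Scope complex_scope.
Local Open Scope ring_scope.

(* [S] is a linear subspace of [V] of dimension [n]: some linearly independent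
   family of [n] vectors has span [S].  (The ambient [V] will be a function
   space, so the finite-dimensional library [vector] does not apply.) *)
Definition has_dimension (K : fieldType) (V : lmodType K) (S : set V)
    (n : nat) : Prop :=
  exists b : 'I_n -> V,
    (forall c : 'I_n -> K,
       \sum_(i < n) c i *: b i = 0 -> forall i, c i = 0) /\
    S = [set v | exists c : 'I_n -> K, v = \sum_(i < n) c i *: b i].

(* The field of complex numbers, at a structure type that makes the library
   infer its standard topology and norm. *)
Definition Cx (R : realType) : numClosedFieldType := R[i].

Section HolomorphicGerms.
Variables (R : realType) (n : nat).
Local Notation C := (Cx R).

(* Differentiability over the scalar field [C] is complex differentiability. *)
Definition holomorphic_near (f : 'rV[C]_n -> C) (a : 'rV[C]_n) : Prop :=
  \forall x \near a, differentiable f x.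

(* [h] is a (reduced) local equation at [a] of the hypersurface [H] of C^n:
   near [a], [H] is the zero locus of [h], and the germ of [h] generates the
   ideal of the germs of holomorphic functions vanishing on [H].  When [a] is
   off the closed set [H], this says that [h] is a unit. *)
Definition local_equation (H : set 'rV[C]_n) (a : 'rV[C]_n)
    (h : 'rV[C]_n -> C) : Prop :=
  [/\ holomorphic_near h a,
      \forall x \near a, H x <-> h x = 0
    & forall phi : 'rV[C]_n -> C, holomorphic_near phi a ->
        (\forall x \near a, H x -> phi x = 0) ->
        exists2 psi : 'rV[C]_n -> C, holomorphic_near psi a &
          \forall x \near a, phi x = psi x * h x].

End HolomorphicGerms.

Definition is_lattice (R : realType) (L : zmodClosed (Cx R)) : Prop :=
  exists w1 w2 : Cx R,
    (forall s t : R, s%:C * w1 + t%:C * w2 = 0 -> s = 0 /\ t = 0) /\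
    (forall z : Cx R, z \in L <-> exists p q : int, z = w1 *~ p + w2 *~ q).

Section EllipticPower.
Variables (R : realType) (L : zmodClosed (Cx R)).
Local Notation C := (Cx R).

Definition ellcurve : zmodType := Quotient.quot L.

(* E^n, with universal covering C^n -> E^n. *)
Definition ellpow (n : nat) : Type := 'rV[ellcurve]_n.

Definition covering (n : nat) (x : 'rV[C]_n) : ellpow n :=
  map_mx (\pi_(Quotient.quot L)) x.

Definition divisor_curve : Type := {freeg ellcurve / int}.

(* Formal integral combinations of subsets of E^n; the subsets are meant to be
   reduced hypersurfaces, which the type does not enforce. *)
Definition divisor (n : nat) : zmodType :=
  {freeg (set (ellpow n)) / int}%type.

Definition support (n : nat) (D : divisor n) : set (ellpow n) :=
  [set x | exists2 H : set (ellpow n), H \in dom D & H x].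

(* Global sections of O(D): the meromorphic functions [f] on E^n such that,
   if the components H of D have local equations h_H at a point, then
   f * \prod_H h_H ^ D(H) is holomorphic at that point.  Such an [f] is
   holomorphic off the support of D and determined by its values there; it is
   represented by the total function extended by 0 on the support. *)
Definition H0 (n : nat) (D : divisor n) : set (ellpow n -> C) :=
  [set f | (forall x, support D x -> f x = 0) /\
    forall a : 'rV[C]_n,
      exists h : set (ellpow n) -> 'rV[C]_n -> C,
        (forall H, H \in dom D ->
           local_equation (@covering n @^-1` H) a (h H)) /\
        exists2 u : 'rV[C]_n -> C, holomorphic_near u a &
          \forall x \near a, ~ support D (covering x) ->
            f (covering x) * \prod_(H <- dom D) h H x ^ coeff H D = u x].

End EllipticPower.

(* From here on g = m.+1 >= 1, and indices are shifted to start from 0. *)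
Section StandardDivisors.
Variables (R : realType) (L : zmodClosed (Cx R)) (m : nat).
Local Notation E := (ellcurve L).

Definition pr_pullback (i : 'I_m.+1) (d : divisor_curve L) : divisor L m.+1 :=
  \sum_(p <- dom d) << coeff p d *g [set x : ellpow L m.+1 | x 0 i = p] >>.

Definition Delta (j : 'I_m) (z : E) : set (ellpow L m.+1) :=
  [set x : ellpow L m.+1 |
     x 0 (fintype.lift ord0 j) = x 0 (widen_ord (leqnSn m) j) + z].

Definition Ddz (d : 'I_m.+1 -> divisor_curve L) (z : 'I_m -> E)
  : divisor L m.+1 :=
  \sum_(i < m.+1) pr_pullback i (d i) + \sum_(j < m) << Delta j (z j) >>.

Definition effective (d : divisor_curve L) : Prop := forall p, 0 <= coeff p d.

Definition ends (i : 'I_m.+1) : int := (i == ord0)%:Z + (i == ord_max)%:Z.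

Definition is_standard_of_type (D : divisor L m.+1) (ns : 'I_m.+1 -> int)
  : Prop :=
  exists (d : 'I_m.+1 -> divisor_curve L) (z : 'I_m -> E),
    [/\ forall i, effective (d i), D = Ddz d z
      & forall i, ns i = deg (d i) + 2 - ends i].

(* The divisor D_{n/k}, as a function of the expansion n/k = [n_1,...,n_g]. *)
Definition Dfrac (ns : 'I_m.+1 -> int) : divisor L m.+1 :=
  Ddz (fun i => << (ns i - 2 + ends i) *g (0 : E) >>) (fun=> 0).

End StandardDivisors.

Definition tridiag_det (m : nat) (ns : 'I_m.+1 -> int) : int :=
  \det (\matrix_(i < m.+1, j < m.+1)
    if i == j then ns i
    else if (i.+1 == j :> nat) || (j.+1 == i :> nat) then -1 else 0).

Fixpoint cfrac (s : seq int) : rat :=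
  match s with
  | [::] => 0
  | [:: a] => a%:Q
  | a :: s' => a%:Q - 1 / cfrac s'
  end.

(* Main.v *)
Require Import Defs.
From HB Require Import structures.
From mathcomp Require Import all_boot all_order all_algebra.
From mathcomp Require Import complex.
From mathcomp.multinomials Require Import freeg.
From mathcomp Require Import boolp classical_sets functions reals topology.
From mathcomp Require Import normedtype derive.
From mathcomp Require Import landau sequences exp trigo.
From mathcomp Require Import ring lra zify.

(** Write C^g -> E^g for the universal covering and
    normalise the lattice to Z + tau Z with tau in the upper half plane.  A
    standard divisor D is a sum of hypersurfaces, each of them the locus where an
    integral linear form takes a given value on E; so a product Theta of
    functions theta (linear form - constant) is a global equation of D on C^g,
    where theta is the theta function with simple zeros at the lattice points
    ([theta_eq0], [theta_simple]).  Multiplication by Theta identifies the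
    sections of O(D) with the entire functions F on C^g with the multipliers of
    Theta ([H0_terms], [sec_H0], [H0_sec]): F is periodic with respect to Z^g, and
    F (x + tau e_i) = c_i exp (- 2 pi i (M x)_i) F (x), where M is the sum of the
    squares of the linear forms, with multiplicities ([bigtheta_theta_fun]).  For
    a standard divisor M is the tridiagonal matrix of the statement
    ([std_form_mx]).

    The dimension of the space of these theta functions is d = det M.  The
    multipliers turn into a recursion for the Fourier coefficients of F: the
    coefficients of index k and k + l M determine each other ([coef_act]), so F
    is determined by one coefficient for each class of Z^g modulo Z^g M.  All
    classes are multiples of the class of the last basis vector ([tri_gen]), and
    d annihilates the latter, so F is determined by d coefficients
    ([coef_mode_eq0]).  Conversely, the columns of d M^-1 are integral, and two
    translations act on the theta functions: the one by the first column of M^-1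
    multiplies the d coefficients by different characters, so that averages over
    its powers isolate a single coefficient ([theta_project]); the one by tau
    times the last column of M^-1, followed by multiplication by a character,
    permutes them cyclically, up to nonzero factors ([theta_raise]).  As Theta
    itself is a nonzero theta function, every choice of the d coefficients
    occurs ([theta_basis]).

    The arithmetic of M consists in recursions for continuants: the continuant
    of (n_1, ..., n_g) is det M ([tridiag_det_cont]), those of the proper tails
    form the first column of d M^-1 ([tri_cont]), and consecutive ones are coprime, so that the continued fraction n / k in lowest terms has numerator
    det M ([cfrac_numerator]).

    The complex analysis behind this is developed from complex
    differentiability, with limits of Riemann averages over 2^n equidistant
    nodes in the place of integrals.  Goursat's theorem ([goursat]), and its
    extension to bounded isolated singularities ([goursat_pole]), give Cauchy's
    formula for periodic functions on a strip ([cauchy_strip]); the exponential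
    carries it to discs ([cauchy_disc]).  Cauchy's formula yields quadratic Taylor
    estimates with uniform constants ([hol_taylor]), hence the holomorphy of
    bounded limits ([hol_limit]), and from it the holomorphy of the infinite
    product for theta, the division of a holomorphic function by a linear form
    on whose zeros it vanishes ([hol_divide]), which shows that theta functions
    generate the ideals of the components, and the holomorphy of integrals.  The
    expansion of the kernel in geometric series shows that a periodic entire
    function with vanishing Fourier coefficients is zero ([fourier_unique],
    [coef_unique]). *)

Set Implicit Arguments.
Unset Strict Implicit.
Unset Printing Implicit Defensive.

Import Order.TTheory GRing.Theory Num.Theory.
Import numFieldNormedType.Exports.
Import ComplexField.

Local Open Scope classical_set_scope.
Local Open Scope ring_scope.

(** * The modulus of complex numbers *)

Section Modulus.
Variable R : realType.
Local Notation C := (Cx R).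

Definition modc (z : C) : R := Normc.normc (z : R[i]).

Lemma modcE z : `|z| = (modc z)%:C%C.
Proof. by []. Qed.
Lemma modc0 : modc 0 = 0. Proof. exact: Normc.normc0. Qed.
Lemma modc1 : modc 1 = 1. Proof. exact: Normc.normc1. Qed.
Lemma modcM x y : modc (x * y) = modc x * modc y. Proof. exact: Normc.normcM. Qed.
Lemma modcV x : modc x^-1 = (modc x)^-1. Proof. exact: Normc.normcV. Qed.
Lemma modcN x : modc (- x) = modc x. Proof. exact: normcN. Qed.
Lemma modcD x y : modc (x + y) <= modc x + modc y. Proof. exact: le_normcD. Qed.
Lemma modcB x y : modc (x - y) <= modc x + modc y.
Proof. by rewrite -(modcN y) modcD. Qed.
Lemma modc_ge0 z : 0 <= modc z.
Proof. by rewrite -lecR -modcE normr_ge0. Qed.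
Lemma modc_eq0 z : (modc z == 0) = (z == 0).
Proof. by apply/eqP/eqP => [/Normc.eq0_normc|->]; rewrite ?modc0. Qed.
Lemma modc_gt0 z : (0 < modc z) = (z != 0).
Proof. by rewrite lt_neqAle eq_sym modc_eq0 modc_ge0 andbT. Qed.
Lemma modc_real (x : R) : modc x%:C%C = `|x|.
Proof. by rewrite /modc /= expr0n addr0 sqrtr_sqr. Qed.
Lemma modc_half : modc 2^-1 = 2^-1.
Proof. by rewrite modcV -[2](rmorph_nat (real_complex R)) modc_real ger0_norm. Qed.
Lemma modcX x n : modc (x ^+ n) = modc x ^+ n.
Proof. by elim: n => [|n IH]; rewrite ?expr0 ?modc1 // !exprS modcM IH. Qed.
Lemma modc_Re z : `|complex.Re z| <= modc z.
Proof. by rewrite -lecR -modcE; exact: normc_ge_Re. Qed.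
Lemma modc_Im z : `|complex.Im z| <= modc z.
Proof.
case: z => a b; rewrite /modc /= -sqrtr_sqr ler_sqrt ?lerDr ?sqr_ge0 //.
by rewrite addr_ge0 ?sqr_ge0.
Qed.
Lemma modc_le z : modc z <= `|complex.Re z| + `|complex.Im z|.
Proof.
rewrite [z in modc z](complexE z) (le_trans (modcD _ _)) // modcM !modc_real lerD //.
by rewrite -[X in _ <= X]mul1r ler_wpM2r ?normr_ge0 // /modc /= expr0n expr1n add0r sqrtr1.
Qed.
End Modulus.

(** * Limits and complex differentiability *)

Section Limits.
Variable R : realType.
Local Notation C := (Cx R).

Definition tends (u : nat -> C) (l : C) :=
  forall e : R, 0 < e -> \forall n \near \oo, modc (u n - l) < e.

Lemma tends_cst l : tends (fun=> l) l.
Proof. by move=> e e0; near=> n; rewrite subrr modc0. Unshelve. all: by end_near. Qed.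

Lemma tends_near u v l : (\forall n \near \oo, u n = v n) -> tends u l -> tends v l.
Proof.
move=> uv ul e e0; near=> n.
have <- : u n = v n by near: n.
by near: n; exact: ul.
Unshelve. all: by end_near. Qed.

Lemma tendsD u v k l : tends u k -> tends v l -> tends (fun n => u n + v n) (k + l).
Proof.
move=> uk vl e e0; have e2 : 0 < e / 2 by lra.
near=> n.
have h1 : modc (u n - k) < e / 2 by near: n; exact: uk.
have h2 : modc (v n - l) < e / 2 by near: n; exact: vl.
have -> : u n + v n - (k + l) = (u n - k) + (v n - l) by ring.
by have := modcD (u n - k) (v n - l); lra.
Unshelve. all: by end_near. Qed.

Lemma tendsZ c u k : tends u k -> tends (fun n => c * u n) (c * k).
Proof.
move=> uk e e0.
have c1 : 0 < modc c + 1 by have := modc_ge0 c; lra.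
have e2 : 0 < e / (modc c + 1) by rewrite divr_gt0.
near=> n.
have h1 : modc (u n - k) < e / (modc c + 1) by near: n; exact: uk.
rewrite -mulrBr modcM.
apply: le_lt_trans (_ : (modc c + 1) * modc (u n - k) < _).
  by rewrite ler_wpM2r ?modc_ge0 //; lra.
by rewrite mulrC -ltr_pdivlMr.
Unshelve. all: by end_near. Qed.

Lemma tendsN u k : tends u k -> tends (fun n => - u n) (- k).
Proof.
move=> uk; have := tendsZ (-1) uk; rewrite mulN1r.
by apply: tends_near; near=> n; rewrite mulN1r.
Unshelve. all: by end_near. Qed.

Lemma tendsB u v k l : tends u k -> tends v l -> tends (fun n => u n - v n) (k - l).
Proof. by move=> uk vl; exact: tendsD uk (tendsN vl). Qed.

Lemma tends_sum (I : Type) (s : seq I) (u : I -> nat -> C) (l : I -> C) :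
  (forall i, tends (u i) (l i)) ->
  tends (fun n => \sum_(i <- s) u i n) (\sum_(i <- s) l i).
Proof.
move=> ul; elim: s => [|i s IH].
  rewrite big_nil; apply: tends_near (tends_cst 0).
  by near=> n; rewrite big_nil.
rewrite big_cons; apply: tends_near (tendsD (ul i) IH).
by near=> n; rewrite big_cons.
Unshelve. all: by end_near. Qed.

Lemma tends_S u l : tends (fun n => u n.+1) l -> tends u l.
Proof.
move=> ul e e0; have [N _ HN] := ul e e0.
exists N.+1 => // -[|n] //= Nn; exact: HN.
Qed.

Lemma tends_le (B : R) u l : (\forall n \near \oo, modc (u n) <= B) ->
  tends u l -> modc l <= B.
Proof.
move=> uB ul; apply/ler_addgt0Pr => e e0.
near \oo => n.
have h1 : modc (u n - l) < e by near: n; exact: ul.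
have h2 : modc (u n) <= B by near: n; exact: uB.
have := modcB (u n) (u n - l).
have -> : u n - (u n - l) = l by ring.
lra.
Unshelve. all: by end_near. Qed.

Lemma tends_uniq u k l : tends u k -> tends u l -> k = l.
Proof.
move=> uk ul; apply/eqP; rewrite -subr_eq0 -modc_eq0 eq_le modc_ge0 andbT.
have := tendsB uk ul; apply: tends_le; near=> n; by rewrite subrr modc0.
Unshelve. all: by end_near. Qed.


Lemma tends0_dom (r : nat -> R) u : r @ \oo --> (0 : R) ->
  (\forall n \near \oo, modc (u n) <= r n) -> tends u 0.
Proof.
move=> /cvgrPdist_lt r0 ur e e0; near=> n; rewrite subr0.
have h1 : modc (u n) <= r n by near: n.
have : `|0 - r n| < e by near: n; exact: r0.
rewrite sub0r normrN; have := ler_norm (r n); lra.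
Unshelve. all: by end_near. Qed.

Lemma tends_geom (q : C) : modc q < 1 -> tends (fun n => q ^+ n) 0.
Proof.
move=> q1; apply: tends0_dom (cvg_expr (_ : `|modc q| < 1)) _.
  by rewrite ger0_norm ?modc_ge0.
by near=> n; rewrite modcX.
Unshelve. all: by end_near. Qed.

(** Completeness in a form that asks for no estimate between two terms of the
    sequence, only for approximate limits. *)
Lemma tends_complete (u : nat -> C) :
  (forall e : R, 0 < e -> exists l, \forall n \near \oo, modc (u n - l) <= e) ->
  exists l, tends u l.
Proof.
move=> H.
have cvgR (p : {additive C -> R}) : (forall z, `|p z| <= modc z) -> cvgn (p \o u).
  move=> hp; apply/cauchy_cvgP/cauchy_exP => e e0.
  have e2 : 0 < e / 2 by lra.
  have [l hl] := H _ e2; exists (p l).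
  apply: filterS hl => n /= hn; rewrite -ball_normE /ball_ /= distrC -raddfB.
  by apply: le_lt_trans (hp _) _; lra.
have h1 := cvgR (@complex.Re R) (@modc_Re R).
have h2 := cvgR (@complex.Im R) (@modc_Im R).
exists (Complex (lim ((complex.Re (R := R) \o u) @ \oo)) (lim ((complex.Im (R := R) \o u) @ \oo))).
move=> e e0; have e2 : 0 < e / 2 by lra.
move/cvgrPdist_lt : h1 => /(_ _ e2) h1; move/cvgrPdist_lt : h2 => /(_ _ e2) h2.
near=> n; apply: le_lt_trans (modc_le _) _.
have k1 : `|lim ((complex.Re (R := R) \o u) @ \oo) - complex.Re (u n)| < e / 2 by near: n.
have k2 : `|lim ((complex.Im (R := R) \o u) @ \oo) - complex.Im (u n)| < e / 2 by near: n.
rewrite !raddfB /= distrC [X in _ + X]distrC; lra.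
Unshelve. all: by end_near. Qed.

Lemma tends_geometric (K r : R) (u : nat -> C) : 0 <= r < 1 ->
  (forall n, modc (u n.+1 - u n) <= K * r ^+ n) -> exists l, tends u l.
Proof.
move=> /andP[r0 r1] hu; apply: tends_complete => e e0.
have r1' : 0 < 1 - r by lra.
have step n m : modc (u (n + m)%N - u n) <= K * r ^+ n / (1 - r) * (1 - r ^+ m).
  elim: m => [|m IH]; first by rewrite addn0 subrr modc0 expr0 subrr mulr0.
  rewrite addnS (_ : u (n + m).+1 - u n = (u (n + m).+1 - u (n + m)%N) + (u (n + m)%N - u n)); last by ring.
  apply: le_trans (modcD _ _) _.
  apply: le_trans (lerD (hu (n + m)%N) IH) _.
  rewrite le_eqVlt; apply/orP; left; apply/eqP; rewrite exprD exprS; field.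
  by rewrite gt_eqF.
have K0 : 0 <= K by have := hu 0%N; rewrite expr0 mulr1; apply: le_trans; exact: modc_ge0.
have h1 : `|r| < 1 by rewrite ger0_norm.
have e3 : 0 < e * (1 - r) / (K + 1) by rewrite divr_gt0 ?mulr_gt0 //; lra.
have /cvgrPdist_lt/(_ _ e3)[N _ /(_ N (leqnn N))] := cvg_expr h1.
rewrite sub0r normrN => hN.
exists (u N), N => // n /= Nn; rewrite -(subnKC Nn); apply: le_trans (step _ _) _.
have rN : r ^+ N < e * (1 - r) / (K + 1) by apply: le_lt_trans hN; exact: ler_norm.
have rm : 0 <= 1 - r ^+ (n - N) <= 1.
  by rewrite subr_ge0 exprn_ile1 ?(ltW r1) // lerBlDr lerDl exprn_ge0.
have rN0 : 0 <= r ^+ N by exact: exprn_ge0.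
have kk : K * r ^+ N / (1 - r) <= e.
  rewrite ler_pdivrMr //; apply: le_trans (_ : (K + 1) * r ^+ N <= _).
    by rewrite ler_wpM2r //; lra.
  by rewrite mulrC -ler_pdivlMr ?(ltW rN) //; lra.
have kk0 : 0 <= K * r ^+ N / (1 - r) by rewrite divr_ge0 ?mulr_ge0 // ltW.
nra.
Qed.
End Limits.

Section Differentiability.
Variable R : realType.
Local Notation C := (Cx R).

Definition nrm (V : normedModType C) (v : V) : R := complex.Re `|v|.

Lemma nrmE (V : normedModType C) (v : V) : `|v| = (nrm v)%:C%C.
Proof. by rewrite /nrm RRe_real // ger0_real. Qed.
Lemma nrmC (z : C) : nrm z = modc z. Proof. by []. Qed.
Lemma nrm_ge0 (V : normedModType C) (v : V) : 0 <= nrm v.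
Proof. by rewrite -lecR -nrmE normr_ge0. Qed.
Lemma nrm0 (V : normedModType C) : nrm (0 : V) = 0.
Proof. by rewrite /nrm normr0. Qed.
Lemma nrmD (V : normedModType C) (u v : V) : nrm (u + v) <= nrm u + nrm v.
Proof. by rewrite -lecR raddfD /= -!nrmE ler_normD. Qed.
Lemma nrmZ (V : normedModType C) a (v : V) : nrm (a *: v) = modc a * nrm v.
Proof.
by have := normrZ a v; rewrite !nrmE nrmC -(rmorphM (real_complex R)) => /complexI.
Qed.
Lemma nrmN (V : normedModType C) (v : V) : nrm (- v) = nrm v.
Proof. by rewrite /nrm normrN. Qed.
Lemma nrm_eq0 (V : normedModType C) (v : V) : (nrm v == 0) = (v == 0).
Proof. by rewrite -(normr_eq0 v) nrmE -(inj_eq (@complexI R)). Qed.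

Lemma nrm_gt0 (V : normedModType C) (v : V) : (0 < nrm v) = (v != 0).
Proof. by rewrite lt_neqAle eq_sym nrm_eq0 nrm_ge0 andbT. Qed.

Lemma nearE_nrm (V : normedModType C) (a : V) (P : V -> Prop) :
  (\forall x \near a, P x) <-> exists2 d : R, 0 < d & forall x, nrm (x - a) < d -> P x.
Proof.
split.
  move=> /nbhs_ballP[e /= e0 He].
  have ee : (complex.Re e)%:C%C = e by rewrite RRe_real // gtr0_real.
  exists (complex.Re e); first by rewrite -ltcR ee.
  move=> x xa; apply: He; rewrite -ball_normE /ball_ /= distrC nrmE -ee.
  by rewrite ltcR.
move=> [d d0 Hd]; apply/nbhs_ballP; exists d%:C%C; first by rewrite /= ltcR.
move=> x; rewrite -ball_normE /ball_ /= distrC nrmE ltcR; exact: Hd.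
Qed.

Lemma diff_epsP (V : normedModType C) (f : V -> C) (x : V) : differentiable f x ->
  forall e : R, 0 < e -> exists2 d : R, 0 < d &
    forall h, nrm h < d -> modc (f (x + h) - f x - 'd f x h) <= e * nrm h.
Proof.
move=> /diff_locallyP[_ fx] e e0.
have := littleo_eqo ('o_ (0 : V) id : V -> C).
have /eqaddoP /(_ e%:C%C) := fx; rewrite ltcR => /(_ e0) /nearE_nrm[d d0 hd] _.
exists d => // h hh; have := hd h; rewrite subr0 => /(_ hh).
rewrite !fctE /= /shift /= [h + x]addrC => le; rewrite -lecR -modcE.
apply: le_trans (le_trans le _); last first.
  by rewrite [X in _ * X]nrmE -(rmorphM (real_complex R)).
by rewrite opprD addrA.
Qed.

(** The remainder is quadratic because the functional equation of the exponential
    and limits of Taylor estimates provide such remainders. *)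
Lemma diff_quad (V : normedModType C) (f : V -> C) (x : V) (L : {linear V -> C}) (K d : R) :
  continuous L -> 0 < d ->
  (forall h, nrm h < d -> modc (f (x + h) - f x - L h) <= K * nrm h ^+ 2) ->
  differentiable f x.
Proof.
move=> Lc d0 H.
have E : f \o shift x = cst (f x) + L +o_ 0 id.
  apply/eqaddoP => e e0.
  have ee : (complex.Re e)%:C%C = e by rewrite RRe_real // gtr0_real.
  have e1 : 0 < complex.Re e by rewrite -ltcR ee.
  have K1 : 0 < `|K| + 1 by have := normr_ge0 K; lra.
  apply/nearE_nrm; exists (Num.min d (complex.Re e / (`|K| + 1))).
    by rewrite lt_min d0 divr_gt0.
  move=> h; rewrite subr0 lt_min => /andP[h1 h2].
  rewrite [X in _ * X]nrmE -[e in e * _]ee -(rmorphM (real_complex R)).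
  have -> : (f \o shift x - (cst (f x) + L)) h = f (x + h) - f x - L h :> C.
    by rewrite !fctE /= /shift /= [h + x]addrC opprD addrA.
  rewrite -[X in X <= _]/((modc (f (x + h) - f x - L h))%:C%C) lecR.
  apply: le_trans (H h h1) _.
  rewrite expr2 mulrA ler_wpM2r ?nrm_ge0 //.
  apply: le_trans (_ : (`|K| + 1) * nrm h <= _).
    rewrite ler_wpM2r ?nrm_ge0 //; have := ler_norm K; lra.
  by rewrite mulrC -ler_pdivlMr // ltW.
apply/diff_locallyP; rewrite (diff_unique Lc E); split=> //.
Qed.

Lemma diff_cont (V : normedModType C) (f : V -> C) (x : V) : differentiable f x ->
  forall e : R, 0 < e -> exists2 d : R, 0 < d &
    forall h, nrm h < d -> modc (f (x + h) - f x) < e.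
Proof.
move=> /differentiable_continuous /cvgrPdist_lt fc e e0.
have /nearE_nrm [d d0 hd] : \forall t \near x, `|f x - f t| < e%:C%C.
  by apply: fc; rewrite ltcR.
exists d => // h hh; have := hd (x + h).
rewrite [X in nrm X](_ : _ = h); last by rewrite addrAC subrr add0r.
by move=> /(_ hh); rewrite distrC -[X in X < _]/((modc (f (x + h) - f x))%:C%C) ltcR.
Qed.

Lemma diff_neq0 (V : normedModType C) (f : V -> C) (x : V) :
  differentiable f x -> f x != 0 -> \forall y \near x, f y != 0.
Proof.
move=> df; rewrite -modc_gt0 => f0; have [d d0 Hd] := diff_cont df f0.
apply/nearE_nrm; exists d => // y /Hd; rewrite [x + _]addrC subrK.
by apply: contraTneq => ->; rewrite sub0r modcN ltxx.
Qed.

Definition has_cder (f : C -> C) (x D : C) := forall e : R, 0 < e ->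
  exists2 d : R, 0 < d & forall h : C, modc h < d ->
    modc (f (x + h) - f x - D * h) <= e * modc h.

Lemma cder_eps (f : C -> C) (x : C) : differentiable f x -> exists D, has_cder f x D.
Proof.
move=> df; exists ('d f x (1 : C)) => e e0; have [d d0 H] := diff_epsP df e0.
exists d => // h hh; have E : 'd f x h = 'd f x (1 : C) * h.
  by rewrite -[h in LHS]mulr1 -[h * 1]/(h *: (1 : C)) linearZ /= mulrC.
by rewrite -E; exact: H.
Qed.

Lemma diff_ext (V : normedModType C) (f g : V -> C) (x : V) :
  (\forall y \near x, f y = g y) -> differentiable f x -> differentiable g x.
Proof.
move=> fg /diff_locallyP[dc fx].
have E : g \o shift x = cst (g x) + 'd f x +o_ 0 id.
  apply/eqaddoP => e e0; have /eqaddoP/(_ e e0) := fx.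
  move: fg => /[dup] /nbhs_singleton E0.
  move=> /nearE_nrm[d d0 fg] /nearE_nrm[d' d0' H].
  apply/nearE_nrm; exists (Num.min d d'); first by rewrite lt_min d0.
  move=> h; rewrite lt_min subr0 => /andP[h1 h2].
  have := H h; rewrite subr0 => /(_ h2); rewrite !fctE /= /shift /= E0.
  by rewrite fg // addrK.
by apply/diff_locallyP; rewrite (diff_unique dc E).
Qed.
End Differentiability.

(** * Contour sums and Goursat's theorem *)

Section Contours.
Variable R : realType.
Local Notation C := (Cx R).
Implicit Types (f g : C -> C) (z h k : C).

(** The left Riemann average of [f] over the segment from [z] to [z + h], with
    [2 ^ n] nodes.  Limits of such averages take the place of integrals; the
    definition by halving makes the subdivision of a contour an exact identity
    between averages. *)
Fixpoint ravg n f z h : C :=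
  if n is n'.+1 then (ravg n' f z (h / 2) + ravg n' f (z + h / 2) (h / 2)) / 2
  else f z.

Lemma ravgD n f g z h : ravg n (fun x => f x + g x) z h = ravg n f z h + ravg n g z h.
Proof. by elim: n z h => [|n IH] z h //=; rewrite !IH; ring. Qed.

Lemma ravgZ n c f z h : ravg n (fun x => c * f x) z h = c * ravg n f z h.
Proof. by elim: n z h => [|n IH] z h //=; rewrite !IH; ring. Qed.

Lemma ravgB n f g z h : ravg n (fun x => f x - g x) z h = ravg n f z h - ravg n g z h.
Proof. by elim: n z h => [|n IH] z h //=; rewrite !IH; ring. Qed.

Lemma ravg_cst n c z h : ravg n (fun=> c) z h = c.
Proof. by elim: n z h => [|n IH] z h //=; rewrite !IH; field. Qed.

Lemma ravg_sum n (I : Type) (s : seq I) (F : I -> C -> C) z h :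
  ravg n (fun x => \sum_(i <- s) F i x) z h = \sum_(i <- s) ravg n (F i) z h.
Proof.
elim: s => [|i s IH].
  by rewrite big_nil -[RHS](ravg_cst n 0 z h); congr (ravg n _ z h); apply/funext => x; rewrite big_nil.
rewrite big_cons -IH -ravgD; congr (ravg n _ z h); apply/funext => x.
by rewrite big_cons.
Qed.

Lemma ravg_shift n f c z h : ravg n (fun x => f (x + c)) z h = ravg n f (z + c) h.
Proof.
by elim: n z h => [|n IH] z h //=; rewrite !IH; congr ((_ + ravg n f _ _) / 2); ring.
Qed.

Lemma ravg_scale n f c z h : ravg n (fun x => f (c * x)) z h = ravg n f (c * z) (c * h).
Proof.
by elim: n z h => [|n IH] z h //=; rewrite !IH mulrDr !mulrA.
Qed.

Lemma ravg_bound n f z h (B : R) :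
  (forall s : R, 0 <= s <= 1 -> modc (f (z + s%:C%C * h)) <= B) ->
  modc (ravg n f z h) <= B.
Proof.
elim: n z h => [|n IH] z h H /=.
  by have := H 0; rewrite lexx ler01 mul0r addr0; apply.
have h1 : modc (ravg n f z (h / 2)) <= B.
  apply: IH => s s01; have := H (s / 2); have -> : z + (s / 2)%:C%C * h = z + s%:C%C * (h / 2).
    by field.
  by apply; lra.
have h2 : modc (ravg n f (z + h / 2) (h / 2)) <= B.
  apply: IH => s s01; have := H (s / 2 + 1 / 2).
  have -> : z + (s / 2 + 1 / 2)%:C%C * h = z + h / 2 + s%:C%C * (h / 2) by field.
  by apply; lra.
rewrite modcM modc_half; have := modcD (ravg n f z (h / 2)) (ravg n f (z + h / 2) (h / 2)); lra.
Qed.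

Lemma ravg_ext n f g z h :
  (forall s : R, 0 <= s <= 1 -> f (z + s%:C%C * h) = g (z + s%:C%C * h)) ->
  ravg n f z h = ravg n g z h.
Proof.
move=> fg; apply/eqP; rewrite -subr_eq0 -ravgB -modc_eq0 eq_le modc_ge0 andbT.
by apply: ravg_bound => s s01; rewrite fg // subrr modc0.
Qed.

(** The Riemann sum for the integral of [f] along the boundary of the
    parallelogram with corner [z] and sides [h] and [k]. *)
Definition csum n f z h k : C :=
  h * (ravg n f z h - ravg n f (z + k) h) + k * (ravg n f (z + h) k - ravg n f z k).

(** The inner sides of the subdivision cancel. *)
Lemma csum_split n f z h k :
  csum n.+1 f z h k =
    csum n f z (h / 2) (k / 2) + csum n f (z + h / 2) (h / 2) (k / 2) +
    csum n f (z + k / 2) (h / 2) (k / 2) + csum n f (z + h / 2 + k / 2) (h / 2) (k / 2).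
Proof.
rewrite /csum /=.
have -> : z + h / 2 + k / 2 + k / 2 = z + k + h / 2 by field.
have -> : z + k / 2 + k / 2 = z + k by field.
have -> : z + h / 2 + h / 2 = z + h by field.
have -> : z + h / 2 + k / 2 + h / 2 = z + h + k / 2 by field.
have -> : z + k / 2 + h / 2 = z + h / 2 + k / 2 by field.
by field.
Qed.

Lemma csumD n f g z h k :
  csum n (fun x => f x + g x) z h k = csum n f z h k + csum n g z h k.
Proof. by rewrite /csum !ravgD; ring. Qed.

Lemma csum_affine n a b z h k : csum n (fun x => a * x + b) z h k = 0.
Proof.
elim: n z h k => [|n IH] z h k; first by rewrite /csum /=; ring.
by rewrite csum_split !IH !addr0.
Qed.

Lemma csum_bound n f z h k (B : R) :
  (forall s t : R, 0 <= s <= 1 -> 0 <= t <= 1 ->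
     modc (f (z + s%:C%C * h + t%:C%C * k)) <= B) ->
  modc (csum n f z h k) <= 2 * (modc h + modc k) * B.
Proof.
move=> H; have i0 : 0 <= (0 : R) <= 1 by rewrite lexx ler01.
have i1 : 0 <= (1 : R) <= 1 by rewrite lexx ler01.
have h1 : modc (ravg n f z h) <= B.
  by apply: ravg_bound => s s01; have := H s 0 s01 i0; rewrite mul0r addr0.
have h2 : modc (ravg n f (z + k) h) <= B.
  by apply: ravg_bound => s s01; have := H s 1 s01 i1; rewrite mul1r addrAC.
have h3 : modc (ravg n f (z + h) k) <= B.
  by apply: ravg_bound => s s01; have := H 1 s i1 s01; rewrite mul1r.
have h4 : modc (ravg n f z k) <= B.
  by apply: ravg_bound => s s01; have := H 0 s i0 s01; rewrite mul0r addr0.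
rewrite /csum; apply: le_trans (modcD _ _) _; rewrite !modcM.
have := modcB (ravg n f z h) (ravg n f (z + k) h).
have := modcB (ravg n f (z + h) k) (ravg n f z k).
have := modc_ge0 h; have := modc_ge0 k; nra.
Qed.

Definition half j : R := (2^-1) ^+ j.
Lemma halfS j : half j.+1 = half j / 2. Proof. by rewrite /half exprS mulrC. Qed.
Lemma half_gt0 j : 0 < half j. Proof. by rewrite exprn_gt0 // invr_gt0. Qed.
Lemma half_small (e : R) : 0 < e -> exists j, half j < e.
Proof.
move=> e0; have h1 : `|2^-1 : R| < 1 by rewrite ger0_norm ?invr_ge0 //; lra.
have /cvgrPdist_lt/(_ e e0)[N _ /(_ N (leqnn N))] := cvg_expr h1.
by rewrite sub0r normrN => h; exists N; apply: le_lt_trans h; exact: ler_norm.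
Qed.

Lemma nearS (P : nat -> Prop) :
  (\forall n \near \oo, P n.+1) -> \forall n \near \oo, P n.
Proof. by move=> [N _ HN]; exists N.+1 => // -[|n] //= Nn; exact: HN. Qed.

(** In each coordinate the corners of the nested squares increase and are
    bounded; their suprema are the coordinates of the common point.  Working in
    the unit square avoids any case distinction for degenerate
    parallelograms. *)
Lemma bisection (bad : nat -> R -> R -> Prop) :
  bad 0%N 0 0 ->
  (forall j s t, bad j s t -> exists a b : bool,
     bad j.+1 (s + a%:R * half j.+1) (t + b%:R * half j.+1)) ->
  exists s0 t0 : R, forall j, exists s t : R,
    [/\ bad j s t, s <= s0 <= s + half j & t <= t0 <= t + half j].
Proof.
move=> bad0 step.
pose nxt (p : nat * (R * R)) (q : bool * bool) := bad p.1 p.2.1 p.2.2 ->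
    bad p.1.+1 (p.2.1 + q.1%:R * half p.1.+1) (p.2.2 + q.2%:R * half p.1.+1).
have [|g Hg] := @choice _ _ nxt.
  move=> [j [s t]] /=; have [/step[a [b ab]]|nb] := pselect (bad j s t).
    by exists (a, b).
  by exists (false, false).
pose x := fix x j : R * R := if j is j'.+1 then
  ((x j').1 + (g (j', x j')).1%:R * half j'.+1, (x j').2 + (g (j', x j')).2%:R * half j'.+1)
  else (0, 0).
have xbad j : bad j (x j).1 (x j).2 by elim: j => [//|j IH]; exact: (Hg (j, x j)).
have H (y : nat -> R) (a : nat -> bool) :
    (forall j, y j.+1 = y j + (a j)%:R * half j.+1) ->
    exists y0, forall j, y j <= y0 <= y j + half j.
  move=> Hy.
  have mono i j : y j <= y (j + i)%N /\ y (j + i)%N + half (j + i) <= y j + half j.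
    elim: i => [|i [h1 h2]]; first by rewrite addn0.
    rewrite addnS Hy halfS; have := half_gt0 (j + i).
    by case: (a _) => /=; rewrite ?mul1r ?mul0r; split; lra.
  have ub i j : y i <= y j + half j.
    have [ij|/ltnW ij] := leqP i j.
      have := (mono (j - i)%N i).1; rewrite subnKC // => ?; have := half_gt0 j; lra.
    have := (mono (i - j)%N j).2; rewrite subnKC // => ?; have := half_gt0 i; lra.
  exists (sup (range y)) => j; apply/andP; split.
    apply: ub_le_sup; last by exists j.
    by exists (y 0%N + half 0) => _ [i _ <-]; exact: ub.
  by apply: ge_sup; [exists (y 0%N), 0%N|move=> _ [i _ <-]; exact: ub].
have [s0 hs] := H (fun j => (x j).1) (fun j => (g (j, x j)).1) (fun=> erefl).
have [t0 ht] := H (fun j => (x j).2) (fun j => (g (j, x j)).2) (fun=> erefl).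
by exists s0, t0 => j; exists (x j).1, (x j).2.
Qed.

(** Goursat's argument: if the sums did not tend to 0, nested quarters with too
    large sums would close in on a point; around it, [f] is affine up to an
    error that is small compared with the side, and contour sums of affine
    functions vanish. *)
Lemma goursat f z h k :
  (forall s t : R, 0 <= s <= 1 -> 0 <= t <= 1 ->
     differentiable f (z + s%:C%C * h + t%:C%C * k)) ->
  tends (fun n => csum n f z h k) 0.
Proof.
move=> df; apply: contrapT => /existsNP[e /not_implyP[e0 He]].
pose q j s t := fun n => csum n f (z + s%:C%C * h + t%:C%C * k) ((half j)%:C%C * h) ((half j)%:C%C * k).
pose bad j (s t : R) := [/\ 0 <= s, s + half j <= 1, 0 <= t, t + half j <= 1 &
  ~ \forall n \near \oo, modc (q j s t n) < e * half j ^+ 2].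
have bad0 : bad 0%N 0 0.
  rewrite /bad /half expr0 add0r lexx; split=> //.
  apply: contra_not He; apply: filterS => n; rewrite /q /half expr0 !mul1r !mul0r !addr0 subr0.
  by rewrite expr1n mulr1.
have step j s t : bad j s t -> exists a b : bool,
     bad j.+1 (s + a%:R * half j.+1) (t + b%:R * half j.+1).
  move=> [s0 s1 t0 t1 nb]; apply: contrapT => Hn; apply: nb.
  have H (a b : bool) : \forall n \near \oo,
      modc (q j.+1 (s + a%:R * half j.+1) (t + b%:R * half j.+1) n) < e * half j.+1 ^+ 2.
    apply: contrapT => nn; apply: Hn; exists a, b.
    have := half_gt0 j; rewrite /bad halfS; move: nn; rewrite halfS => nn g0.
    by case: a b nn => [] [] nn /=; rewrite ?mul1r ?mul0r ?addr0 in nn *; split=> //; lra.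
  move: (H false false) (H true false) (H false true) (H true true) => H1 H2 H3 H4.
  apply: nearS.
  refine (filterS _ (filterI (filterI H1 H2) (filterI H3 H4))) => n [[h1 h2] [h3 h4]].
  have E (a b : bool) : q j.+1 (s + a%:R * half j.+1) (t + b%:R * half j.+1) n =
      csum n f (z + s%:C%C * h + t%:C%C * k + a%:R * ((half j)%:C%C * h / 2)
                + b%:R * ((half j)%:C%C * k / 2))
             ((half j)%:C%C * h / 2) ((half j)%:C%C * k / 2).
    rewrite /q; congr (csum n f _ _ _); rewrite halfS; last by field.
      by case: a; case: b => /=; field.
    by field.
  rewrite !E /= !mul0r !mul1r !addr0 !halfS in h1 h2 h3 h4.
  rewrite /q csum_split.
  set a1 := csum _ _ _ _ _ in h1 *; set a2 := csum _ _ _ _ _ in h2 *.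
  set a3 := csum _ _ _ _ _ in h3 *; set a4 := csum _ _ _ _ _ in h4 *.
  have := modcD (a1 + a2 + a3) a4; have := modcD (a1 + a2) a3; have := modcD a1 a2.
  have -> : e * half j ^+ 2 = 4 * (e * (half j / 2) ^+ 2) by field.
  lra.
have [s0 [t0 Hst]] := bisection bad0 step.
have [s01 t01] : 0 <= s0 <= 1 /\ 0 <= t0 <= 1.
  have h0 : half 0 = 1 by rewrite /half expr0.
  have [s [t [[a1 a2 a3 a4 _] a5 a6]]] := Hst 0%N; rewrite h0 in a2 a4 a5 a6; split; lra.
have dp := df s0 t0 s01 t01; set p := z + _ + _ in dp.
pose M := modc h + modc k + 1.
have M0 : 0 < M by rewrite /M; have := modc_ge0 h; have := modc_ge0 k; lra.
(* With this slope of the error, [csum_bound] gives half of the tolerance. *)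
have e' : 0 < e / (4 * M ^+ 2) by rewrite divr_gt0 // mulr_gt0 // exprn_gt0.
have [a Ha] := cder_eps dp; have [d d0 Hd] := Ha _ e'.
have [j Hj] := half_small (divr_gt0 d0 M0).
have [s [t [[s1 s2 t1 t2 nb] ss tt]]] := Hst j.
apply: nb; near=> n.
pose b := f p - a * p.
have -> : q j s t n = csum n (fun x => (f x - (a * x + b)) + (a * x + b))
    (z + s%:C%C * h + t%:C%C * k) ((half j)%:C%C * h) ((half j)%:C%C * k).
  by rewrite /q; congr (csum n _ _ _ _); apply/funext => x; rewrite subrK.
rewrite csumD csum_affine addr0.
have hj := half_gt0 j; have hhM : half j * (modc h + modc k) <= half j * M by rewrite ler_pM2l // /M; lra.
apply: le_lt_trans (csum_bound _ (B := e / (4 * M ^+ 2) * (half j * M)) _) _; last first.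
  rewrite !modcM modc_real (ger0_norm (ltW hj)).
  have -> : e * half j ^+ 2 = 4 * M * M * half j ^+ 2 * (e / (4 * M ^+ 2)).
    by field; rewrite gt_eqF.
  rewrite -mulrDr; set c := e / _ in e' *.
  apply: le_lt_trans (_ : 2 * (half j * M) * (c * (half j * M)) < _).
    rewrite ler_pM2r; first by lra.
    by rewrite (mulr_gt0 e') // mulr_gt0.
  have : 0 < half j ^+ 2 * M ^+ 2 * c by apply: mulr_gt0 => //; apply: mulr_gt0; rewrite exprn_gt0.
  nra.
move=> u v /andP[u0 u1] /andP[v0 v1].
set w := ((s + u * half j - s0)%:C%C * h + (t + v * half j - t0)%:C%C * k).
have -> : z + s%:C%C * h + t%:C%C * k + u%:C%C * ((half j)%:C%C * h)
    + v%:C%C * ((half j)%:C%C * k) = p + w by rewrite /p /w; ring.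
have -> : f (p + w) - (a * (p + w) + b) = f (p + w) - f p - a * w.
  by rewrite /b; ring.
have ww : modc w <= half j * M.
  apply: le_trans hhM; apply: le_trans (modcD _ _) _; rewrite !modcM !modc_real mulrDr.
  move/andP: ss => [? ?]; move/andP: tt => [? ?].
  by apply: lerD; rewrite ler_wpM2r ?modc_ge0 // ler_norml; apply/andP; split; nra.
apply: le_trans (Hd w _) _; last by rewrite ler_wpM2l ?(ltW e').
by apply: le_lt_trans ww _; rewrite -ltr_pdivlMr.
Unshelve. all: by end_near. Qed.
End Contours.

(** * The complex exponential *)

Section RealBounds.
Variable R : realType.

Lemma expR_quad (u : R) : `|u| <= 1 / 2 -> `|expR u - 1 - u| <= 2 * u ^+ 2.
Proof.
rewrite ler_norml => /andP[u1 u2].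
have h1 := expR_ge1Dx u; have h2 := expR_ge1Dx (- u).
rewrite expRN in h2; have e0 := expR_gt0 u.
have : (1 - u) * expR u <= 1 by rewrite -ler_pdivlMr // mul1r.
rewrite ler_norml => h3; apply/andP; split; nra.
Qed.

Lemma expR_le2 (u : R) : `|u| <= 1 / 2 -> expR u <= 2.
Proof.
move=> hu; have := expR_quad hu; move: hu; rewrite !ler_norml => /andP[u1 u2] /andP[h1 h2].
nra.
Qed.

Lemma sin_lip (v : R) : `|sin v| <= `|v|.
Proof.
wlog v0 : v / 0 <= v.
  by move=> H; have [/H//|/ltW v0] := leP 0 v; rewrite -normrN -sinN -(normrN v) H // oppr_ge0.
have [c _] : exists2 c, c \in `[0, v] & sin v - sin 0 = cos c * (v - 0).
  apply: (@MVT_segment R sin cos) => //.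
  by apply: continuous_subspaceT; exact: continuous_sin.
rewrite sin0 !subr0 => ->; rewrite normrM -[X in _ <= X]mul1r ler_wpM2r //.
exact: cos_max.
Qed.

Lemma cos_quad (v : R) : `|cos v - 1| <= v ^+ 2 / 2.
Proof.
have -> : cos v - 1 = - (2 * sin (v / 2) ^+ 2).
  have -> : cos v = cos ((v / 2) *+ 2) by congr cos; field.
  rewrite cos_mulr2n cos2sin2; ring.
rewrite normrN normrM normrX (ger0_norm (ler0n R 2)).
have := sin_lip (v / 2); have := normr_ge0 (sin (v / 2)).
rewrite normrM normfV (ger0_norm (ler0n R 2)) => h0 h1.
have : `|sin (v / 2)| ^+ 2 <= (`|v| / 2) ^+ 2 by rewrite !expr2; apply: ler_pM.
rewrite -[v ^+ 2](real_normK (num_real v)); lra.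
Qed.

Lemma sin_quad (v : R) : `|v| <= 1 -> `|sin v - v| <= v ^+ 2 / 2.
Proof.
wlog v0 : v / 0 <= v.
  move=> H; have [/H//|/ltW v0] := leP 0 v; rewrite -(normrN v) => /H.
  have -> : sin (- v) - - v = - (sin v - v) by rewrite sinN; ring.
  by rewrite oppr_ge0 sqrrN normrN; apply.
move=> v1; have [c] : exists2 c, c \in `[0, v] & (sin v - v) - (sin 0 - 0) = (cos c - 1) * (v - 0).
  apply: (@MVT_segment R (fun x => sin x - x) (fun x => cos x - 1)) => //.
  apply: continuous_subspaceT => x; by apply/differentiable_continuous/derivable1_diffP.
rewrite in_itv /= => /andP[c0 cv]; rewrite sin0 !subr0 => ->; rewrite normrM.
have := cos_quad c; rewrite (ger0_norm v0) in v1 *; have := normr_ge0 (cos c - 1); nra.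
Qed.
End RealBounds.

Section ComplexExponential.
Variable R : realType.
Local Notation C := (Cx R).
Local Notation Re := complex.Re.
Local Notation Im := complex.Im.

(** [cexp z] is [exp (2 * pi * i * z)]. *)
Definition cexp (z : C) : C :=
  Complex (expR (- (2 * pi * Im z)) * cos (2 * pi * Re z))
          (expR (- (2 * pi * Im z)) * sin (2 * pi * Re z)).

Lemma cexpD x y : cexp (x + y) = cexp x * cexp y.
Proof.
case: x => a b; case: y => c d; rewrite /cexp /= !mulrDr opprD expRD cosD sinD.
by apply/eqP; rewrite eq_complex /=; apply/andP; split; apply/eqP; ring.
Qed.

Lemma cexp0 : cexp 0 = 1.
Proof. by rewrite /cexp /= !mulr0 oppr0 expR0 cos0 sin0 mulr0 mul1r. Qed.

Lemma modc_cexp z : modc (cexp z) = expR (- (2 * pi * Im z)).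
Proof.
rewrite /modc /cexp /= !exprMn -mulrDr cos2Dsin2 mulr1 sqrtr_sqr ger0_norm //.
exact: expR_ge0.
Qed.

Lemma cexp_neq0 z : cexp z != 0.
Proof. by rewrite -modc_eq0 modc_cexp gt_eqF // expR_gt0. Qed.

Lemma cexpN z : cexp (- z) = (cexp z)^-1.
Proof.
by apply: (mulIf (cexp_neq0 z)); rewrite -cexpD addNr cexp0 mulVf ?cexp_neq0.
Qed.

Lemma cexpB x y : cexp (x - y) = cexp x / cexp y.
Proof. by rewrite cexpD cexpN. Qed.

Lemma cexp1 : cexp 1 = 1.
Proof.
rewrite /cexp /= mulr0 mulr1 oppr0 expR0 !mul1r mulr_natl cos2pi sin2pi //.
Qed.

Lemma cexp_nat z n : cexp (z *+ n) = cexp z ^+ n.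
Proof. by elim: n => [|n IH]; rewrite ?mulr0n ?cexp0 // mulrS exprS cexpD IH. Qed.

Lemma cexp_int z (k : int) : cexp (z *~ k) = cexp z ^ k.
Proof.
case: k => n; first by rewrite -pmulrn cexp_nat.
by rewrite NegzE mulrNz cexpN -pmulrn cexp_nat -exprnN.
Qed.

Lemma cexp_Z (k : int) : cexp k%:~R = 1.
Proof. by rewrite -[k%:~R]/(1 *~ k) cexp_int cexp1 exp1rz. Qed.

Lemma cexp_half : cexp (2^-1) = -1.
Proof.
have -> : (2^-1 : C) = (2^-1 : R)%:C%C by rewrite fmorphV /= rmorph_nat.
rewrite /cexp /= mulr0 oppr0 expR0 !mul1r.
have -> : 2 * pi / 2 = pi :> R by field.
by rewrite cospi sinpi; apply/eqP; rewrite eq_complex /= oppr0 !eqxx.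
Qed.

Lemma cexp_eq1 z : cexp z = 1 -> exists k : int, z = k%:~R.
Proof.
case: z => a b E; have : modc (cexp (Complex a b)) = 1 by rewrite E modc1.
rewrite modc_cexp /= -{2}expR0 => /expR_inj /eqP; rewrite oppr_eq0 !mulf_eq0.
rewrite (negPf (lt0r_neq0 (pi_gt0 R))) pnatr_eq0 /= => /eqP b0; subst b.
exists (Num.floor a); have fl := floor_itv a.
have : cexp (a - (Num.floor a)%:~R)%:C%C = 1.
  rewrite rmorphB rmorph_int cexpB cexp_Z divr1; exact: E.
set f := a - _; have f01 : 0 <= f < 1 by rewrite /f; move: fl; rewrite intrD; lra.
rewrite /cexp /= mulr0 oppr0 expR0 !mul1r => /eqP; rewrite eq_complex /= => /andP[/eqP c1 _].
suff f0 : f = 0.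
  by apply/eqP; rewrite eq_complex /= -(rmorph_int (real_complex R)) /= eqxx andbT -subr_eq0 -/f f0.
move: c1; have -> : 2 * pi * f = (pi * f) *+ 2 by ring.
rewrite cos_mulr2n cos2sin2 => c1.
have [//|fn] := eqVneq f 0.
have f1 : 0 < f < 1 by rewrite lt_neqAle eq_sym fn /=; lra.
have p0 := pi_gt0 R.
have : 0 < sin (pi * f) by apply: sin_gt0_pi; nra.
by nra.
Qed.

Lemma cexp_surj (s : C) : s != 0 -> exists z, cexp z = s.
Proof.
rewrite -modc_eq0 => s0; have m0 : 0 < modc s by rewrite modc_gt0 -modc_eq0.
have [y ey] := expR_total m0.
case: s s0 m0 ey => a b s0 m0 ey; set m := modc _ in s0 m0 ey.
have mm : m ^+ 2 = a ^+ 2 + b ^+ 2 by rewrite /m /modc /= sqr_sqrtr // addr_ge0 ?sqr_ge0.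
have p0 := pi_gt0 R.
have am : -1 <= a / m <= 1 by rewrite -ler_norml normrM normfV (gtr0_norm m0) ler_pdivrMr // mul1r; exact: modc_Re (Complex a b).
have key t : cos t = a / m -> sin t = b / m -> exists z, cexp z = Complex a b.
  have pn : 2 * pi != 0 :> R by rewrite mulf_neq0 ?pnatr_eq0 // gt_eqF.
  move=> ct st; exists (Complex (t / (2 * pi)) (- (y / (2 * pi)))).
  rewrite /cexp /=.
  have -> : - (2 * pi * (- (y / (2 * pi)))) = y by rewrite mulrN opprK mulrCA divff ?mulr1.
  have -> : 2 * pi * (t / (2 * pi)) = t by rewrite mulrCA divff ?mulr1.
  by rewrite ey ct st; congr Complex; field; rewrite gt_eqF.
have ss : sin (acos (a / m)) = `|b / m|.
  rewrite sin_acos // -sqrtr_sqr; congr Num.sqrt.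
  by rewrite !expr_div_n mm; field; rewrite -mm expf_neq0.
have [b0|b0] := leP 0 b.
  apply: (key (acos (a / m))); first by rewrite acosK.
  by rewrite ss ger0_norm // divr_ge0 // ltW.
apply: (key (- acos (a / m))); first by rewrite cosN acosK.
by rewrite sinN ss ltr0_norm ?opprK // pmulr_llt0 // invr_gt0.
Qed.

(** This is [2 * pi * i], the derivative of [cexp] at 0. *)
Definition tpi : C := Complex 0 (2 * pi).

(** Only the quadratic shape of the remainder matters. *)
Lemma cexp_quad (h : C) : modc h < (4 * pi)^-1 ->
  modc (cexp h - 1 - tpi * h) <= 40 * pi ^+ 2 * modc h ^+ 2.
Proof.
case: h => a b hh; have p0 := pi_gt0 R.
have ha : `|2 * pi * a| <= 1 / 2.
  rewrite normrM gtr0_norm; last by lra.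
  have := modc_Re (Complex a b) => /= hr.
  have : `|a| < (4 * pi)^-1 by apply: le_lt_trans hh.
  by rewrite -[_^-1]mul1r ltr_pdivlMr; lra.
have hb : `|- (2 * pi * b)| <= 1 / 2.
  rewrite normrN normrM gtr0_norm; last by lra.
  have := modc_Im (Complex a b) => /= hr.
  have : `|b| < (4 * pi)^-1 by apply: le_lt_trans hh.
  by rewrite -[_^-1]mul1r ltr_pdivlMr; lra.
have -> : 40 * pi ^+ 2 * modc (Complex a b) ^+ 2 = 10 * ((2 * pi * a) ^+ 2 + (- (2 * pi * b)) ^+ 2).
  by rewrite /modc /= sqr_sqrtr ?addr_ge0 ?sqr_ge0 //; ring.
move: ha hb; set V := 2 * pi * a; set U := - (2 * pi * b) => ha hb.
have -> : cexp (Complex a b) - 1 - tpi * Complex a b =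
    Complex (expR U * (cos V - 1) + (expR U - 1 - U)) (expR U * (sin V - V) + V * (expR U - 1)).
  rewrite /tpi /cexp /= -/U -/V; apply/eqP; rewrite eq_complex /=.
  by apply/andP; split; apply/eqP; rewrite /U /V; ring.
apply: le_trans (modc_le _) _ => /=.
have e2 := expR_le2 hb; have e0 := expR_gt0 U; have eq := expR_quad hb.
have c2 := cos_quad V; have s2 : `|sin V - V| <= V ^+ 2 / 2 by apply: sin_quad; lra.
have e1 : `|expR U - 1| <= 2 * `|U|.
  have -> : expR U - 1 = (expR U - 1 - U) + U by ring.
  apply: le_trans (ler_normD _ _) _; rewrite -(real_normK (num_real U)) in eq.
  have := normr_ge0 U; nra.
have t1 : `|expR U * (cos V - 1)| <= V ^+ 2.
  rewrite normrM (gtr0_norm e0); have := normr_ge0 (cos V - 1); nra.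
have t2 : `|expR U * (sin V - V)| <= V ^+ 2.
  rewrite normrM (gtr0_norm e0); have := normr_ge0 (sin V - V); nra.
have t3 : `|V * (expR U - 1)| <= V ^+ 2 + U ^+ 2.
  rewrite normrM -(real_normK (num_real U)) -(real_normK (num_real V)).
  have := ler_wpM2l (normr_ge0 V) e1; have := sqr_ge0 (`|V| - `|U|); nra.
have := ler_normD (expR U * (cos V - 1)) (expR U - 1 - U).
have := ler_normD (expR U * (sin V - V)) (V * (expR U - 1)).
have := sqr_ge0 U; have := sqr_ge0 V; lra.
Qed.

Lemma cexp_sub1_ge (h : C) : modc h < (40 * pi ^+ 2)^-1 -> modc h <= modc (1 - cexp h).
Proof.
have p0 := pi_gt0 R; have p2 := pi_ge2 R => hh.
have pp : 0 < 40 * pi ^+ 2 :> R by rewrite mulr_gt0 // exprn_gt0.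
have h1 : modc h < (4 * pi)^-1.
  apply: lt_trans hh _; rewrite ltf_pV2 ?posrE ?mulr_gt0 //; nra.
have h2 : 40 * pi ^+ 2 * modc h <= 1 by rewrite mulrC -ler_pdivlMr // mul1r ltW.
have := cexp_quad h1; set E := _ - tpi * h => hE.
have t2 : modc (tpi * h) = 2 * pi * modc h.
  rewrite modcM; congr (_ * _); rewrite /modc /= expr0n /= add0r sqrtr_sqr ger0_norm //.
  by rewrite mulr_ge0 // ltW.
have := modcB (- (1 - cexp h)) E.
have -> : - (1 - cexp h) - E = tpi * h by rewrite /E; ring.
rewrite modcN t2; have := modc_ge0 h; nra.
Qed.

Lemma cexp_diff (z : C) : differentiable cexp z.
Proof.
have p0 := pi_gt0 R.
apply: (@diff_quad R C cexp z ( *:%R (cexp z * tpi)) (modc (cexp z) * (40 * pi ^+ 2)) (4 * pi)^-1).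
- exact: scaler_continuous.
- by rewrite invr_gt0 mulr_gt0.
move=> h hh; rewrite cexpD.
change (modc (cexp z * cexp h - cexp z - cexp z * tpi * h) <= modc (cexp z) * (40 * pi ^+ 2) * modc h ^+ 2).
have -> : cexp z * cexp h - cexp z - cexp z * tpi * h = cexp z * (cexp h - 1 - tpi * h) by ring.
by rewrite modcM -mulrA ler_wpM2l ?modc_ge0 //; exact: cexp_quad.
Qed.

Lemma cexp_comp_diff (V : normedModType C) (f : V -> C) (x : V) :
  differentiable f x -> differentiable (fun y => cexp (f y)) x.
Proof.
move=> df; change (differentiable (cexp \o f) x).
by apply: differentiable_comp => //; exact: cexp_diff.
Qed.
End ComplexExponential.

(** * Bounded isolated singularities *)

Section Cauchy.
Variable R : realType.
Local Notation C := (Cx R).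
Local Notation Re := complex.Re.
Local Notation Im := complex.Im.
Local Notation cexp := (@cexp R).

Lemma tends_shift (u : nat -> C) l m : tends u l -> tends (fun n => u (n + m)%N) l.
Proof.
move=> ul e e0; have [N _ HN] := ul e e0.
by exists N => // n /= Nn; apply: HN => /=; exact: leq_trans Nn (leq_addr _ _).
Qed.

Lemma tends_unshift (u : nat -> C) l m : tends (fun n => u (n + m)%N) l -> tends u l.
Proof.
move=> ul e e0; have [N _ HN] := ul e e0.
exists (N + m)%N => // n /= Nn; have mn : (m <= n)%N := leq_trans (leq_addl _ _) Nn.
by have := HN (n - m)%N; rewrite /= subnK // => ->//; rewrite leq_subRL // addnC.
Qed.

(** The comparison sequence may depend on the tolerance, and be close to [u]
    only up to it: this is how contours are moved far away and series are
    truncated. *)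
Lemma tends_eps (u : nat -> C) l :
  (forall e : R, 0 < e -> exists v k, [/\ tends v k, modc (k - l) <= e &
     \forall n \near \oo, modc (u n - v n) <= e]) -> tends u l.
Proof.
move=> H e e0; have e4 : 0 < e / 4 by lra.
have [v [k [vk kl uv]]] := H _ e4; near=> n.
have h1 : modc (v n - k) < e / 4 by near: n; exact: vk.
have h2 : modc (u n - v n) <= e / 4 by near: n.
have -> : u n - l = (u n - v n) + (v n - k) + (k - l) by ring.
have := modcD (u n - v n + (v n - k)) (k - l); have := modcD (u n - v n) (v n - k); lra.
Unshelve. all: by end_near. Qed.

(** An isolated singularity near which [f] is bounded does not contribute.  It
    has relative coordinates (1/3, 1/3) in the parallelogram; two halvings lead
    to a smaller one in which it has the same relative coordinates, so it is
    never on a dividing line, and the nested parallelograms around it have small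
    contour sums because [f] is bounded. *)
Lemma goursat_pole (f : C -> C) (p h k : C) (d B : R) :
  (forall s t : R, 0 <= s <= 1 -> 0 <= t <= 1 -> s != 1 / 3 \/ t != 1 / 3 ->
     differentiable f (p + (s - 1 / 3)%:C%C * h + (t - 1 / 3)%:C%C * k)) ->
  0 < d -> (forall x, modc (x - p) < d -> modc (f x) <= B) ->
  tends (fun n => csum n f (p - (1 / 3)%:C%C * h - (1 / 3)%:C%C * k) h k) 0.
Proof.
move=> df d0 fB.
pose G s t m n := csum n f (p + (s - 1 / 3)%:C%C * h + (t - 1 / 3)%:C%C * k) (m%:C%C * h) (m%:C%C * k).
have Gsplit s t m n : G s t m n.+1 = G s t (m / 2) n + G (s + m / 2) t (m / 2) n
    + G s (t + m / 2) (m / 2) n + G (s + m / 2) (t + m / 2) (m / 2) n.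
  rewrite /G csum_split.
  have e1 w : m%:C%C * w / 2 = (m / 2)%:C%C * w by field.
  by rewrite !e1; congr (_ + _ + _ + _); congr (csum _ _ _ _ _); ring.
have good s t m : 0 <= s -> 0 <= t -> 0 <= m -> s + m <= 1 -> t + m <= 1 ->
    [\/ 1 / 3 < s, s + m < 1 / 3, 1 / 3 < t | t + m < 1 / 3] -> tends (G s t m) 0.
  move=> s0 t0 m0 s1 t1 off; apply: goursat => a b a01 b01.
  have -> : p + (s - 1 / 3)%:C%C * h + (t - 1 / 3)%:C%C * k + a%:C%C * (m%:C%C * h) + b%:C%C * (m%:C%C * k)
      = p + (s + a * m - 1 / 3)%:C%C * h + (t + b * m - 1 / 3)%:C%C * k by ring.
  apply: df; [nra|nra|].
  have am : 0 <= a * m <= m by nra.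
  have bm : 0 <= b * m <= m by nra.
  case: off => off; [left|left|right|right]; apply/eqP; nra.
(* The part of relative side [l] in which the singular point again has relative
   coordinates (1/3, 1/3). *)
pose T (l : R) n := G ((1 - l) / 3) ((1 - l) / 3) l n.
(* Of the seven parts that two halvings leave, the six others avoid the singular
   point. *)
have step l : 0 < l <= 1 -> tends (fun n => T l (n + 2)%N - T (l / 4) n) 0.
  move=> l01; set s := (1 - l) / 3.
  have g1 : tends (G (s + l / 2) s (l / 2)) 0.
    by apply: good; rewrite /s; try lra; apply: Or41; lra.
  have g2 : tends (G s (s + l / 2) (l / 2)) 0.
    by apply: good; rewrite /s; try lra; apply: Or43; lra.
  have g3 : tends (G (s + l / 2) (s + l / 2) (l / 2)) 0.
    by apply: good; rewrite /s; try lra; apply: Or41; lra.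
  have g4 : tends (G s s (l / 2 / 2)) 0.
    by apply: good; rewrite /s; try lra; apply: Or42; lra.
  have g5 : tends (G (s + l / 2 / 2) s (l / 2 / 2)) 0.
    by apply: good; rewrite /s; try lra; apply: Or44; lra.
  have g6 : tends (G s (s + l / 2 / 2) (l / 2 / 2)) 0.
    by apply: good; rewrite /s; try lra; apply: Or42; lra.
  have := tendsD (tendsD (tendsD (tends_shift 1 g1) (tends_shift 1 g2)) (tends_shift 1 g3))
    (tendsD (tendsD g4 g5) g6).
  rewrite !addr0; apply: tends_near; near=> n.
  rewrite /T -/s addn2 (Gsplit s s l n.+1) (Gsplit s s _ n) !addn1.
  have -> : (1 - l / 4) / 3 = s + l / 2 / 2 by rewrite /s; field.
  have -> : l / 2 / 2 = l / 4 by field.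
  by ring.
have many m : tends (fun n => T 1 (n + m.*2)%N - T (half R m ^+ 2) n) 0.
  elim: m => [|m IH].
    apply: tends_near (tends_cst 0); near=> n.
    by rewrite /half expr0 expr1n addn0 subrr.
  have l01 : 0 < half R m ^+ 2 <= 1.
    rewrite exprn_gt0 ?half_gt0 //= /half -exprM exprVn invf_le1 ?exprn_gt0 //.
    by rewrite exprn_ege1 // ler1n.
  have := tendsD (tends_shift 2 IH) (step _ l01); rewrite addr0.
  apply: tends_near; near=> n; rewrite halfS doubleS.
  have -> : (half R m / 2) ^+ 2 = half R m ^+ 2 / 4 by field.
  have -> : (n + m.*2.+2)%N = (n + 2 + m.*2)%N by lia.
  by ring.
have -> : (fun n => csum n f (p - (1 / 3)%:C%C * h - (1 / 3)%:C%C * k) h k) = T 1.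
  by apply/funext => n; rewrite /T /G; congr (csum n f _ _ _); ring.
have m0 : 0 <= modc h + modc k by have := modc_ge0 h; have := modc_ge0 k; lra.
have B0 : 0 <= B by apply: le_trans (modc_ge0 (f p)) (fB p _); rewrite subrr modc0.
apply: tends_eps => e e0.
pose M := (modc h + modc k) * (1 + 2 * B) + 1.
have M0 : 0 < M by rewrite /M; nra.
have [|m hm] := half_small (_ : 0 < Num.min e (Num.min d 1) / M).
  by rewrite divr_gt0 // !lt_min e0 d0 ltr01.
have := half_gt0 R m; set l := half R m in hm * => l0.
move: hm; rewrite ltr_pdivlMr // !lt_min => /andP[l1 /andP[l2 l3]].
have l4 : l <= 1.
  have : 0 <= l * ((modc h + modc k) * (1 + 2 * B)) by rewrite !mulr_ge0 //; lra.
  by rewrite /M in l3; lra.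
have ll : 0 <= l ^+ 2 <= l by nra.
exists (fun n => T 1 n - T (l ^+ 2) (n - m.*2)%N), 0; split.
- apply: (@tends_unshift _ _ m.*2); apply: tends_near (many m); near=> n; by rewrite addnK.
- by rewrite subrr modc0 ltW.
near=> n; rewrite opprB addrCA subrr addr0.
apply: le_trans (csum_bound _ (B := B) _) _.
  move=> s t s01 t01; apply: fB.
  have -> : p + ((1 - l ^+ 2) / 3 - 1 / 3)%:C%C * h + ((1 - l ^+ 2) / 3 - 1 / 3)%:C%C * k +
      s%:C%C * ((l ^+ 2)%:C%C * h) + t%:C%C * ((l ^+ 2)%:C%C * k) - p =
      (l ^+ 2 * (s - 1 / 3))%:C%C * h + (l ^+ 2 * (t - 1 / 3))%:C%C * k by field.
  apply: le_lt_trans (modcD _ _) _; rewrite !modcM !modc_real.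
  have nE y : `|l ^+ 2 * y| = l ^+ 2 * `|y|.
    by rewrite normrM (ger0_norm (proj1 (andP ll))).
  rewrite !nE.
  have a1 : `|s - 1 / 3| <= 1 by rewrite ler_norml; lra.
  have a2 : `|t - 1 / 3| <= 1 by rewrite ler_norml; lra.
  have b1 : l ^+ 2 * `|s - 1 / 3| * modc h <= l * modc h.
    by rewrite ler_wpM2r ?modc_ge0 //; have := normr_ge0 (s - 1 / 3); nra.
  have b2 : l ^+ 2 * `|t - 1 / 3| * modc k <= l * modc k.
    by rewrite ler_wpM2r ?modc_ge0 //; have := normr_ge0 (t - 1 / 3); nra.
  have : 0 <= l * ((modc h + modc k) * (2 * B)) by rewrite !mulr_ge0 // ltW.
  rewrite /M in l2; nra.
rewrite !modcM !modc_real (ger0_norm (proj1 (andP ll))) -mulrDr.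
have : l ^+ 2 * ((modc h + modc k) * B) <= l * ((modc h + modc k) * B).
  by rewrite ler_wpM2r ?mulr_ge0 //; lra.
have : 0 <= l * (modc h + modc k) by rewrite mulr_ge0 // ltW.
rewrite /M in l1; lra.
Unshelve. all: by end_near. Qed.
End Cauchy.

(** * Cauchy's formula on a period strip *)

Section PeriodicCauchy.
Variable R : realType.
Local Notation C := (Cx R).
Local Notation Re := complex.Re.
Local Notation Im := complex.Im.
Local Notation cexp := (@cexp R).

Lemma imD (x y : C) : Im (x + y) = Im x + Im y. Proof. by rewrite raddfD. Qed.
Lemma imB (x y : C) : Im (x - y) = Im x - Im y. Proof. by rewrite raddfB. Qed.
Lemma im_real (s : R) : Im s%:C%C = 0. Proof. by []. Qed.
Lemma im_realM (s : R) (z : C) : Im (s%:C%C * z) = s * Im z.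
Proof. by case: z => a b /=; rewrite mul0r addr0. Qed.

(** In the contour sum of the parallelogram between two periods, the two other
    sides cancel by periodicity, so Goursat's theorem compares the averages over
    the two periods. *)
Lemma ravg_move (f : C -> C) (a b : C) : (forall x, f (x + 1) = f x) ->
  (forall s t : R, 0 <= s <= 1 -> 0 <= t <= 1 ->
     differentiable f (a + s%:C%C + t%:C%C * (b - a))) ->
  tends (fun n => ravg n f a 1 - ravg n f b 1) 0.
Proof.
move=> per df; have := @goursat _ f a 1 (b - a) _.
have H : forall s t : R, 0 <= s <= 1 -> 0 <= t <= 1 ->
     differentiable f (a + s%:C%C * 1 + t%:C%C * (b - a)).
  by move=> s t s01 t01; rewrite mulr1; exact: df.
move=> /(_ H); apply: tends_near; near=> n; rewrite /csum.
have -> : ravg n f (a + 1) (b - a) = ravg n f a (b - a).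
  by rewrite -ravg_shift; congr (ravg n _ _ _); apply/funext => x; rewrite per.
by rewrite subrr mulr0 addr0 mul1r [a + (b - a)]addrC subrK.
Unshelve. all: by end_near. Qed.

(** The averages of a geometric kernel are known exactly, because
    [1 / (1 - v) + 1 / (1 + v) = 2 / (1 - v ^+ 2)]: each halving of the step
    squares the parameter. *)
Lemma ravg_kernel (n : nat) (c a : C) : modc (c * cexp (- a)) != 1 ->
  ravg n (fun x => (1 - c * cexp (- x))^-1) a 1 = (1 - (c * cexp (- a)) ^+ (2 ^ n))^-1.
Proof.
elim: n c a => [|n IH] c a H; first by rewrite /= expn0 expr1.
rewrite [LHS]/= -[ravg n _ (a + 1 / 2) _]ravg_shift -ravgD.
have n1 (v : C) : modc v != 1 -> 1 - v != 0.
  by apply: contraNneq => /eqP; rewrite subr_eq0 => /eqP <-; rewrite modc1.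
have -> : ravg n (fun x => (1 - c * cexp (- x))^-1 + (1 - c * cexp (- (x + 1 / 2)))^-1) a (1 / 2)
   = ravg n (fun x => 2 * (1 - c ^+ 2 * cexp (- (2 * x)))^-1) a (1 / 2).
  apply: ravg_ext => s _; set x := a + _.
  have mx : modc (c * cexp (- x)) != 1.
    rewrite /x opprD cexpD mulrA modcM.
    have -> : - (s%:C%C * (1 / 2)) = (- (s / 2))%:C%C :> C by field.
    by rewrite [modc (cexp _%:C%C)]modc_cexp im_real mulr0 oppr0 expR0 mulr1.
  have -> : cexp (- (x + 1 / 2)) = - cexp (- x).
    by rewrite opprD cexpD mul1r [cexp (- 2^-1)]cexpN cexp_half invrN1 mulrN1.
  have -> : cexp (- (2 * x)) = cexp (- x) ^+ 2 by rewrite -mulrN mulr_natl cexp_nat.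
  rewrite -exprMn mulrN opprK; move: mx; set v := c * _ => mx.
  have v1 := n1 _ mx; have v2 : 1 + v != 0 by have := n1 (- v); rewrite opprK modcN; apply.
  have v3 : 1 - v ^+ 2 != 0 by rewrite (_ : 1 - v ^+ 2 = (1 - v) * (1 + v)) ?mulf_neq0 //; ring.
  by field; rewrite v1 v2 v3.
rewrite ravgZ (ravg_scale n (fun x => (1 - c ^+ 2 * cexp (- x))^-1) 2 a (1 / 2)).
have -> : 2 * (1 / 2) = 1 :> C by field.
have sq : c ^+ 2 * cexp (- (2 * a)) = (c * cexp (- a)) ^+ 2.
  by rewrite -mulrN mulr_natl cexp_nat exprMn.
rewrite IH sq; last by rewrite modcX sqrp_eq1 ?modc_ge0.
by rewrite -exprM -expnS mulrC mulKf // pnatr_eq0.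
Qed.

Lemma tends_pow2 (q : C) : modc q < 1 -> tends (fun n => q ^+ (2 ^ n)) 0.
Proof.
move=> q1 e e0; have [N _ HN] := tends_geom q1 e0; exists N => // n /= Nn.
by apply: (HN (2 ^ n)%N); apply: (leq_trans Nn); rewrite ltnW // ltn_expl.
Qed.

Lemma tends_inv1 (u : nat -> C) : tends u 0 -> tends (fun n => (1 - u n)^-1) 1.
Proof.
move=> u0 e e0; pose d := Num.min (1 / 2) (e / 4).
have d0 : 0 < d by rewrite lt_min; apply/andP; split; lra.
near=> n.
have : modc (u n - 0) < d by near: n; exact: u0.
rewrite subr0 lt_min => /andP[h1 h2].
have h3 : 1 / 2 <= modc (1 - u n).
  by have := modcB 1 (- u n); have := modcD (1 - u n) (u n); rewrite subrK modc1; lra.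
have h4 : 1 - u n != 0 by rewrite -modc_eq0; apply/eqP; lra.
have -> : (1 - u n)^-1 - 1 = u n * (1 - u n)^-1 by field.
rewrite modcM modcV.
have : (modc (1 - u n))^-1 <= 2 by rewrite -[X in X <= _]mul1r ler_pdivrMr; lra.
have := modc_ge0 (u n); have : 0 <= (modc (1 - u n))^-1 by rewrite invr_ge0 modc_ge0.
nra.
Unshelve. all: by end_near. Qed.

(** The periodic Cauchy kernel, with simple poles at the integral translates of
    [z]. *)
Definition ker (z x : C) : C := (1 - cexp (z - x))^-1.

Lemma kerE z : ker z = fun x => (1 - cexp z * cexp (- x))^-1.
Proof. by apply/funext => x; rewrite /ker cexpD. Qed.

Lemma modc_cexpB_lt1 (z a : C) : (modc (cexp (z - a)) < 1) = (Im a < Im z).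
Proof.
rewrite modc_cexp expR_lt1 oppr_lt0 pmulr_rgt0 ?mulr_gt0 ?pi_gt0 // imB subr_gt0 //.
Qed.

Lemma ravg_ker_below (z a : C) : Im a < Im z -> tends (fun n => ravg n (ker z) a 1) 1.
Proof.
rewrite -modc_cexpB_lt1 cexpD => az.
have := tends_inv1 (tends_pow2 az); apply: tends_near; near=> n.
by rewrite kerE ravg_kernel // lt_eqF.
Unshelve. all: by end_near. Qed.

Lemma ravg_ker_above (z a : C) : Im z < Im a -> tends (fun n => ravg n (ker z) a 1) 0.
Proof.
move=> az; have : Im z < Im a by [].
rewrite -modc_cexpB_lt1 => v1; set v := cexp (a - z) in v1.
have vE : cexp z * cexp (- a) = v^-1 by rewrite -cexpD /v -cexpN opprB.
have v0 : v != 0 by exact: cexp_neq0.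
have mv : 0 < modc v by rewrite modc_gt0.
have t1 := tends_pow2 v1.
have t2 : tends (fun n => 1 - (1 - v ^+ (2 ^ n))^-1) 0.
  by have := tendsB (tends_cst 1) (tends_inv1 t1); rewrite subrr.
apply: tends_near t2; near=> n.
rewrite kerE ravg_kernel ?vE; last by rewrite modcV gt_eqF // invf_gt1.
have p0 : v ^+ (2 ^ n) != 0 by rewrite expf_neq0.
have p1 : 1 - v ^+ (2 ^ n) != 0.
  apply: contraTneq v1 => /eqP; rewrite subr_eq0 eq_sym => /eqP E.
  have : modc v ^+ (2 ^ n) = 1 by rewrite -modcX E modc1.
  move/eqP; rewrite pexpr_eq1 ?expn_gt0 ?modc_ge0 // => /eqP ->.
  by rewrite ltxx.
rewrite exprVn; field.
rewrite p0 p1 andbT /=.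
have -> : v ^+ (2 ^ n) - 1 = - (1 - v ^+ (2 ^ n)) by ring.
by rewrite oppr_eq0.
Unshelve. all: by end_near. Qed.

Lemma ker_periodic z x : ker z (x + 1) = ker z x.
Proof. by rewrite /ker opprD addrA cexpB cexp1 divr1. Qed.

Lemma ker_diff z x : (forall k : int, x != z + k%:~R) -> differentiable (ker z) x.
Proof.
move=> H; apply: differentiableV; last first.
  apply/negP => /eqP /= /eqP; rewrite subr_eq0 eq_sym => /eqP /cexp_eq1[k hk].
  by have := H (- k); rewrite rmorphN /= -hk opprB addrC subrK eqxx.
apply: differentiableB; first exact: differentiable_cst.
apply: (@differentiable_comp _ _ _ _ (fun x => z - x) cexp); last exact: cexp_diff.
by apply: differentiableB; [exact: differentiable_cst|].
Qed.

(** Cauchy's formula on a period strip.  The product of the kernel with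
    [f x - f z] is bounded near [z], so its averages below and above [z] agree in
    the limit; those of the kernel itself tend to 1 below and to 0 above. *)
Lemma cauchy_strip (f : C -> C) (y0 : R) (z a b : C) :
  (forall x, f (x + 1) = f x) -> (forall x : C, y0 < Im x -> differentiable f x) ->
  y0 < Im a -> Im a < Im z -> Im z < Im b ->
  tends (fun n => ravg n (fun x => f x * ker z x) a 1 - ravg n (fun x => f x * ker z x) b 1) (f z).
Proof.
move=> per df ya az zb.
pose g x := (f x - f z) * ker z x.
have gper x : g (x + 1) = g x by rewrite /g per ker_periodic.
have gdiff (x : C) : y0 < Im x -> (forall k : int, x != z + k%:~R) -> differentiable g x.
  move=> yx hx; apply: differentiableM; last exact: ker_diff.
  by apply: differentiableB; [exact: df|exact: differentiable_cst].
have im_int (k : int) : Im (k%:~R : C) = 0 by rewrite -(rmorph_int (real_complex R)).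
have imne (x : C) : Im x != Im z -> forall k : int, x != z + k%:~R.
  move=> hx k; apply: contraNneq hx => ->; by rewrite imD im_int addr0.
pose y := Im z - Im a; have y_gt0 : 0 < y by rewrite subr_gt0.
pose k : C := Complex 0 y.
have P : tends (fun n => csum n g (z - (1 / 3)%:C%C * 1 - (1 / 3)%:C%C * k) 1 k) 0.
  have zd := df z (lt_trans ya az).
  have [D HD] := cder_eps zd.
  have [d d0 Hd] := HD 1 ltr01.
  have pp : 0 < 40 * pi ^+ 2 :> R by rewrite mulr_gt0 // exprn_gt0 // pi_gt0.
  pose d' := Num.min d (40 * pi ^+ 2)^-1.
  have d0' : 0 < d' by rewrite lt_min d0 invr_gt0.
  have gd (s t : R) : 0 <= s <= 1 -> 0 <= t <= 1 -> s != 1 / 3 \/ t != 1 / 3 ->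
     differentiable g (z + (s - 1 / 3)%:C%C * 1 + (t - 1 / 3)%:C%C * k).
    move=> s01 t01 st; apply: gdiff.
      rewrite !imD !im_realM /= mulr0 addr0; move: ya az; rewrite /y; nra.
    move=> j; apply/eqP => E.
    have : (s - 1 / 3)%:C%C * 1 + (t - 1 / 3)%:C%C * k = j%:~R.
      by apply: (addrI z); rewrite addrA.
    rewrite -(rmorph_int (real_complex R)) /k => /eqP; rewrite eq_complex /=.
    rewrite !mulr0 !mul0r !mulr1 subr0 !addr0 add0r => /andP[/eqP e1].
    rewrite ?add0r mulf_eq0 (gt_eqF y_gt0) orbF => /eqP t3.
    case: st; last by apply/negP; rewrite negbK; apply/eqP; lra.
    apply/negP; rewrite negbK; apply/eqP.
    have : j = 0.
      have h1 : ((-1)%:~R : R) < j%:~R by rewrite rmorphN1; lra.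
      have h2 : (j%:~R : R) < 1%:~R by rewrite /=; lra.
      by rewrite ltr_int in h1; rewrite ltr_int in h2; move: h1 h2; clear; lia.
    by move=> j0; rewrite j0 in e1; lra.
  have gb x : modc (x - z) < d' -> modc (g x) <= modc D + 1.
    rewrite lt_min => /andP[h1 h2]; set w := x - z in h1 h2.
    have hf := Hd w h1; rewrite [z + w]addrC {1}/w subrK in hf.
    have fw : modc (f x - f z) <= (modc D + 1) * modc w.
      have -> : f x - f z = (f x - f z - D * w) + D * w by ring.
      by have := modcD (f x - f z - D * w) (D * w); rewrite modcM; lra.
    rewrite /g /ker modcM modcV.
    have : modc w <= modc (1 - cexp (z - x)).
      by rewrite -[z - x]opprB -/w -(modcN w); apply: cexp_sub1_ge; rewrite modcN.
    have [w0|wn] := eqVneq (modc w) 0.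
      by move=> _; move: fw; rewrite w0 mulr0; have := modc_ge0 (f x - f z); have := modc_ge0 D => *;
        rewrite (_ : modc (f x - f z) = 0) ?mul0r; lra.
    have wp : 0 < modc w by rewrite modc_gt0 -modc_eq0.
    move=> hw; have wp' := lt_le_trans wp hw.
    rewrite ler_pdivrMr //; apply: (le_trans fw).
    by rewrite ler_wpM2l //; have := modc_ge0 D; lra.
  exact: (@goursat_pole R g z 1 k d' (modc D + 1) gd d0' gb).
set x0 := z - (1 / 3)%:C%C * 1 - (1 / 3)%:C%C * k in P.
have imx0 : Im x0 = Im z - y / 3 by rewrite /x0 !imB !im_realM /= mulr0; lra.
have imx1 : Im (x0 + k) = Im z + 2 * y / 3 by rewrite imD imx0 -[Im k]/y; lra.
have T1 : tends (fun n => ravg n g x0 1 - ravg n g (x0 + k) 1) 0.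
  apply: tends_near P; near=> n; rewrite /csum.
  have -> : ravg n g (x0 + 1) k = ravg n g x0 k.
    by rewrite -ravg_shift; congr (ravg n _ _ _); apply/funext => x; rewrite gper.
  by rewrite subrr mulr0 addr0 mul1r.
have T0 : tends (fun n => ravg n g a 1 - ravg n g x0 1) 0.
  apply: (ravg_move gper) => s t s01 t01; have E : Im (a + s%:C%C + t%:C%C * (x0 - a)) < Im z.
    rewrite !imD im_real im_realM imB imx0 /y; nra.
  apply: gdiff; last by apply: imne; rewrite lt_eqF.
  rewrite !imD im_real im_realM imB imx0; move: ya az; rewrite /y; nra.
have T2 : tends (fun n => ravg n g (x0 + k) 1 - ravg n g b 1) 0.
  apply: (ravg_move gper) => s t s01 t01; have E : Im z < Im (x0 + k + s%:C%C + t%:C%C * (b - (x0 + k))).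
    rewrite imD [Im (x0 + k + _)]imD im_real im_realM imB imx1.
    have e1 : 0 <= t * (Im b - Im z) by rewrite mulr_ge0; lra.
    have e2 : 0 <= (1 - t) * y by rewrite mulr_ge0; lra.
    have [t2|t2] := leP t (1 / 2).
      have : 0 < (1 - t) * y by rewrite mulr_gt0; lra.
      by lra.
    have : 0 < t * (Im b - Im z) by rewrite mulr_gt0; lra.
    by lra.
  apply: gdiff; last by apply: imne; rewrite gt_eqF.
  by apply: lt_trans (lt_trans ya az) E.
have T : tends (fun n => ravg n g a 1 - ravg n g b 1) 0.
  have := tendsD T0 (tendsD T1 T2); rewrite !addr0; apply: tends_near; near=> n; ring.
have K := tendsB (ravg_ker_below az) (ravg_ker_above zb).
have := tendsD T (tendsZ (f z) K); rewrite subr0 mulr1 add0r.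
apply: tends_near; near=> n.
have gE u : ravg n g u 1 = ravg n (fun x => f x * ker z x) u 1 - f z * ravg n (ker z) u 1.
  rewrite -ravgZ -ravgB; congr (ravg n _ _ _); apply/funext => x; rewrite /g; ring.
by rewrite !gE; ring.
Unshelve. all: by end_near. Qed.
End PeriodicCauchy.

(** * Cauchy's formula on a disc *)

Section Disc.
Variable R : realType.
Local Notation C := (Cx R).
Local Notation Re := complex.Re.
Local Notation Im := complex.Im.
Local Notation cexp := (@cexp R).

(** The average of [f] over [2 ^ n] equidistant points of the circle of radius
    [r] around 0. *)
Definition cavg n (f : C -> C) (r : R) : C := ravg n (fun x => f (r%:C%C * cexp x)) 0 1.

Lemma modc_circle (r s : R) : 0 <= r -> modc (r%:C%C * cexp (0 + s%:C%C * 1)) = r.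
Proof.
move=> r0; rewrite modcM modc_real (ger0_norm r0) modc_cexp add0r mulr1 im_real.
by rewrite mulr0 oppr0 expR0 mulr1.
Qed.

Lemma cavg_bound n f r (B : R) : 0 <= r ->
  (forall x, modc x = r -> modc (f x) <= B) -> modc (cavg n f r) <= B.
Proof.
move=> r0 H; apply: ravg_bound => s _; apply: H; exact: modc_circle.
Qed.

Lemma cavgB n f g r : cavg n (fun x => f x - g x) r = cavg n f r - cavg n g r.
Proof. exact: ravgB. Qed.
Lemma cavgZ n c f r : cavg n (fun x => c * f x) r = c * cavg n f r.
Proof. exact: ravgZ. Qed.
Lemma cavg_ext n f g r : 0 <= r -> (forall x, modc x = r -> f x = g x) ->
  cavg n f r = cavg n g r.
Proof.
move=> r0 H; apply: ravg_ext => s _; apply: H; exact: modc_circle.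
Qed.

Section OneFunction.
Variables (f : C -> C) (rho r : R).
Hypothesis r0 : 0 < r.
Hypothesis rrho : r < rho.
Hypothesis df : forall x : C, modc x < rho -> differentiable f x.

(** The exponential turns the circle into a period and the disc into a half
    plane, whose upper end corresponds to the centre. *)
Let F (x : C) : C := f (r%:C%C * cexp x).

Let Fper x : F (x + 1) = F x.
Proof. by rewrite /F cexpD cexp1 mulr1. Qed.

Let Fdiff : exists2 y0 : R, y0 < 0 & forall x : C, y0 < Im x -> differentiable F x.
Proof.
have q1 : 1 < rho / r by rewrite ltr_pdivlMr // mul1r.
have [y ey] := expR_total (lt_trans ltr01 q1).
have y1 : 0 < y by rewrite -expR_gt1 ey.
have p0 := pi_gt0 R; have pp : 0 < 2 * pi :> R by rewrite mulr_gt0.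
exists (- (y / (2 * pi))); first by rewrite oppr_lt0 divr_gt0.
move=> x hx; change (differentiable (f \o (fun x : C => r%:C%C * cexp x)) x).
apply: differentiable_comp.
  apply: differentiableM; [exact: differentiable_cst|exact: cexp_diff].
apply: df; rewrite modcM modc_real (gtr0_norm r0) modc_cexp mulrC -ltr_pdivlMr //.
rewrite -ey ltr_expR.
have : - y < Im x * (2 * pi) by rewrite -ltr_pdivrMr // mulNr.
lra.
Qed.

Let Ftop (e : R) (M : R) : 0 < e -> exists2 y : R, M < y &
  forall x, Im x = y -> modc (F x - f 0) < e.
Proof.
move=> e0; have h0 : modc (0 : C) < rho by rewrite modc0 (lt_trans r0).
have [d d0 Hd] := diff_cont (df h0) e0.
have [z hz] : exists z : R, expR z = d / r by apply: expR_total; rewrite divr_gt0.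
have p0 := pi_gt0 R; have pp : 0 < 2 * pi :> R by rewrite mulr_gt0.
exists (Num.max 0 (Num.max M (- z / (2 * pi))) + 1) => [|x hx].
  by rewrite ltr_pwDr // !le_max lexx orbT.
have := Hd (r%:C%C * cexp x); rewrite add0r; apply.
rewrite nrmC modcM modc_real (gtr0_norm r0) modc_cexp mulrC -ltr_pdivlMr // -hz ltr_expR.
have : - z < Im x * (2 * pi) by rewrite -ltr_pdivrMr // hx ltr_pwDr // !le_max lexx !orbT.
lra.
Qed.

(** The average can be moved up in the half plane, where [F] is close to [f 0]. *)
Lemma mean_value : tends (fun n => cavg n f r) (f 0).
Proof.
have [y0 y00 Fd] := Fdiff.
apply: tends_eps => e e0; have [y y1 Hy] := Ftop 0 e0.
pose b : C := Complex 0 y.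
exists (fun n => ravg n F 0 1 - ravg n F b 1 + f 0), (f 0); split.
- rewrite -[X in tends _ X]add0r; apply: tendsD (tends_cst _).
  apply: (ravg_move Fper) => s t s01 t01; apply: Fd.
  by rewrite subr0 imD im_realM imD im_real /b /=; nra.
- by rewrite subrr modc0 ltW.
near=> n; rewrite /cavg -/F.
have -> : ravg n F 0 1 - (ravg n F 0 1 - ravg n F b 1 + f 0) = ravg n (fun x => F x - f 0) b 1.
  by rewrite ravgB ravg_cst; ring.
apply: ravg_bound => s s01; apply/ltW/Hy.
by rewrite mulr1 imD im_real addr0.
Unshelve. all: by end_near. Qed.

(** Cauchy's formula on a strip, with the upper period so high that the kernel
    is negligible there. *)
Lemma cauchy_disc (s : C) : modc s < r ->
  tends (fun n => cavg n (fun x => f x * (1 - s / x)^-1) r) (f s).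
Proof.
move=> sr; have [s0|sn] := eqVneq s 0.
  rewrite s0; apply: tends_near mean_value; near=> n; apply: cavg_ext => [|x _]; first exact: ltW.
  by rewrite mul0r subr0 invr1 mulr1.
have [y0 y00 Fd] := Fdiff.
have rn : (r%:C%C : C) != 0 by rewrite -modc_eq0 modc_real gtr0_norm // gt_eqF.
have [z hz] : exists z, cexp z = s / r%:C%C by apply: cexp_surj; rewrite mulf_neq0 // invr_eq0.
have p0 := pi_gt0 R; have pp : 0 < 2 * pi :> R by rewrite mulr_gt0.
have zpos : 0 < Im z.
  have : modc (cexp z) < 1 by rewrite hz modcM modcV modc_real (gtr0_norm r0) ltr_pdivrMr // mul1r.
  by rewrite modc_cexp expR_lt1 oppr_lt0 pmulr_rgt0.
have Fz : F z = f s by rewrite /F hz mulrC divfK.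
apply: tends_eps => e e0; have e1 : 0 < Num.min e 1 by rewrite lt_min e0 ltr01.
pose B := modc (f 0) + 1.
have B0 : 0 < B by rewrite /B; have := modc_ge0 (f 0); lra.
(* At this distance from [z], the kernel is at most [e / B]. *)
have [q hq] : exists q : R, expR q = 1 + B / e.
  by apply: expR_total; rewrite addr_gt0 // divr_gt0.
have [y y1 Hy] := Ftop (Num.max (Im z) (Im z + q / (2 * pi))) e1.
pose b : C := Complex 0 y.
move: y1; rewrite gt_max => /andP[zb qy].
have im0 : Im (0 : C) = 0 by [].
exists (fun n => ravg n (fun x => F x * ker z x) 0 1 - ravg n (fun x => F x * ker z x) b 1), (f s); split.
- by rewrite -Fz; apply: (@cauchy_strip R F y0 z 0 b Fper Fd).
- by rewrite subrr modc0 ltW.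
near=> n.
have -> : cavg n (fun x => f x * (1 - s / x)^-1) r = ravg n (fun x => F x * ker z x) 0 1.
  congr (ravg n _ _ _); apply/funext => x; rewrite /F /ker cexpB hz.
  by congr (_ * (1 - _)^-1); rewrite invfM mulrA.
rewrite opprB addrCA subrr addr0.
apply: ravg_bound => t t01.
have hb : Im (b + t%:C%C * 1) = y by rewrite mulr1 imD im_real addr0.
set x := b + _ in hb *.
have Fx := Hy x hb; rewrite lt_min in Fx; move/andP: Fx => [_ Fx].
have FB : modc (F x) <= B.
  by have := modcD (F x - f 0) (f 0); rewrite subrK /B; lra.
rewrite modcM /ker modcV.
have : 1 + B / e <= modc (cexp (z - x)).
  rewrite -hq modc_cexp ler_expR imB hb.
  have : q < 2 * pi * (y - Im z).
    by rewrite mulrC -ltr_pdivrMr //; lra.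
  lra.
have := modcB 1 (1 - cexp (z - x)); rewrite modc1 opprB addrCA subrr addr0 => h1 h2.
have h3 : B / e <= modc (1 - cexp (z - x)) by lra.
have h4 : 0 < B / e by rewrite divr_gt0.
have h5 := lt_le_trans h4 h3.
rewrite ler_pdivrMr // (le_trans FB) // mulrC -ler_pdivrMr //.
Unshelve. all: by end_near. Qed.

Variable B : R.
Hypothesis fB : forall x, modc x = r -> modc (f x) <= B.

Let B0 : 0 <= B.
Proof.
have := fB (x := r%:C%C); rewrite modc_real (gtr0_norm r0) => /(_ erefl).
exact: le_trans (modc_ge0 _).
Qed.

(** Expand the kernel as [1 + u + u ^+ 2 / (1 - u)] for [u = s / x]. *)
Lemma taylor_avg (s : C) : modc s <= r / 2 -> forall e : R, 0 < e ->
  \forall n \near \oo, modc (f s - f 0 - s * cavg n (fun x => f x / x) r) <=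
    2 * B * (modc s / r) ^+ 2 + e.
Proof.
move=> sr e e0; have r0' := r0; have sr' : modc s < r by lra.
have T := tendsB (cauchy_disc sr') mean_value.
near=> n.
have : modc (cavg n (fun x => f x * (1 - s / x)^-1) r - cavg n f r - (f s - f 0)) < e by near: n; exact: T.
set a := cavg n (fun x => f x * _) r; set b := cavg n f r; set c := cavg n _ r => h.
have : modc (a - b - s * c) <= 2 * B * (modc s / r) ^+ 2.
  rewrite /a /b /c -cavgB -cavgZ -cavgB; apply: cavg_bound => [|x xr]; first exact: ltW.
  have xn : x != 0 by rewrite -modc_eq0 xr gt_eqF.
  set u := s / x.
  have mu : modc u = modc s / r by rewrite modcM modcV xr.
  have u2 : modc u <= 1 / 2 by rewrite mu ler_pdivrMr //; lra.
  have h3 : 1 / 2 <= modc (1 - u).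
    by have := modcD (1 - u) u; rewrite subrK modc1; lra.
  have un : 1 - u != 0 by rewrite -modc_eq0; apply/eqP; lra.
  have -> : f x * (1 - u)^-1 - f x - s * (f x / x) = f x * u ^+ 2 * (1 - u)^-1.
    by rewrite (_ : s * (f x / x) = f x * u); [field | rewrite /u; ring].
  rewrite modcM (modcM (f x)) modcX modcV mu.
  have i2 : (modc (1 - u))^-1 <= 2 by rewrite -[X in X <= _]mul1r ler_pdivrMr; lra.
  have i0 : 0 <= (modc (1 - u))^-1 by rewrite invr_ge0 modc_ge0.
  have q0 : 0 <= (modc s / r) ^+ 2 by exact: sqr_ge0.
  have fx := fB xr; have f0 := modc_ge0 (f x).
  rewrite -mulrA [X in _ <= X](_ : _ = B * ((modc s / r) ^+ 2 * 2)); last by ring.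
  apply: ler_pM => //; first by rewrite mulr_ge0.
  by rewrite ler_wpM2l.
have := modcB (a - b - s * c) (a - b - (f s - f 0)).
have -> : a - b - s * c - (a - b - (f s - f 0)) = f s - f 0 - s * c by ring.
lra.
Unshelve. all: by end_near. Qed.

(** Cauchy's formula for the derivative at the centre: [taylor_avg] and the
    definition of the derivative give two approximations of [f s - f 0], which
    are compared for one small [s]. *)
Lemma cder_avg (D : C) : has_cder f 0 D ->
  tends (fun n => cavg n (fun x => f x / x) r) D.
Proof.
move=> HD; have r0' := r0; apply: (@tends_eps R) => e e0.
have e4 : 0 < e / 4 by lra.
have [d d0 Hd] := HD _ e4.
pose m := Num.min (d / 2) (Num.min (r / 2) (e / (8 * (B + 1)) * r ^+ 2)).
have B1 : 0 < B + 1 by have := B0; lra.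
have m0 : 0 < m.
  rewrite !lt_min; apply/andP; split; first by lra.
  apply/andP; split; first by lra.
  by rewrite mulr_gt0 ?exprn_gt0 // divr_gt0 // mulr_gt0.
have : m <= m by [].
rewrite {2}/m !le_min => /andP[m1 /andP[m2 m3]].
pose s : C := m%:C%C.
have ms : modc s = m by rewrite modc_real gtr0_norm.
have sn : s != 0 by rewrite -modc_eq0 ms gt_eqF.
have h1 := Hd s; rewrite ms add0r in h1; have {}h1 := h1 (_ : m < d).
have ms2 : modc s <= r / 2 by rewrite ms.
have e5 : 0 < e / 4 * m by rewrite mulr_gt0.
have T := taylor_avg ms2 e5.
exists (fun=> D), D; split; [exact: tends_cst|by rewrite subrr modc0 ltW|].
near=> n.
have h2 : modc (f s - f 0 - s * cavg n (fun x => f x / x) r) <= 2 * B * (modc s / r) ^+ 2 + e / 4 * m.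
  by near: n.
set c := cavg _ _ _ in h2 *.
have {}h1 : modc (f s - f 0 - D * s) <= e / 4 * m by apply: h1; lra.
have h3 : modc (s * (c - D)) <= 2 * B * (m / r) ^+ 2 + e / 2 * m.
  have := modcB (f s - f 0 - D * s) (f s - f 0 - s * c).
  have -> : f s - f 0 - D * s - (f s - f 0 - s * c) = s * (c - D) by ring.
  rewrite ms in h2; lra.
rewrite modcM ms in h3.
rewrite -(ler_pM2l m0); apply: (le_trans h3).
have : 2 * B * (m / r) ^+ 2 <= e / 4 * m.
  have -> : 2 * B * (m / r) ^+ 2 = m * (2 * B * m / r ^+ 2) by field; rewrite gt_eqF.
  rewrite [X in _ <= X]mulrC ler_pM2l // ler_pdivrMr ?exprn_gt0 //.
  have b1 : 2 * B * m <= 2 * (B + 1) * m by rewrite ler_pM2r //; lra.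
  apply: (le_trans b1).
  apply: le_trans (_ : 2 * (B + 1) * (e / (8 * (B + 1)) * r ^+ 2) <= _).
    by rewrite ler_pM2l // mulr_gt0.
  by rewrite le_eqVlt; apply/orP; left; apply/eqP; field; rewrite gt_eqF.
lra.
Unshelve. all: by end_near. Qed.

(** The quadratic Taylor estimate, with a constant that only depends on a bound
    for [f] on the circle. *)
Lemma taylor_quad (D s : C) : has_cder f 0 D ->
  modc s <= r / 2 -> modc (f s - f 0 - D * s) <= 2 * B * (modc s / r) ^+ 2.
Proof.
move=> HD sr; apply/ler_addgt0Pr => e e0.
have e2 : 0 < e / 2 by lra.
have T := tendsZ s (cder_avg HD); have T' := taylor_avg sr e2.
near \oo => n.
have h1 : modc (s * cavg n (fun x => f x / x) r - s * D) < e / 2 by near: n; exact: T.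
have h2 : modc (f s - f 0 - s * cavg n (fun x => f x / x) r) <= 2 * B * (modc s / r) ^+ 2 + e / 2 by near: n.
set c := cavg _ _ _ in h1 h2.
have := modcD (f s - f 0 - s * c) (s * c - s * D).
have -> : f s - f 0 - s * c + (s * c - s * D) = f s - f 0 - D * s by ring.
lra.
Unshelve. all: by end_near. Qed.

Lemma cder_bound (D : C) : has_cder f 0 D ->
  modc D <= B / r.
Proof.
move=> HD; apply: tends_le (cder_avg HD); near=> n.
apply: cavg_bound => [|x xr]; first exact: ltW.
by rewrite modcM modcV xr ler_pM2r ?invr_gt0 //; exact: fB.
Unshelve. all: by end_near. Qed.
End OneFunction.
End Disc.

(** * Taylor estimates and limits of holomorphic functions *)

Section Several.
Variable R : realType.
Local Notation C := (Cx R).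

Lemma shift_diff (V : normedModType C) (c x : V) : differentiable (fun y => y + c) x.
Proof. exact: differentiableD. Qed.

Section OneFunction.
Variables (V : normedModType C) (F : V -> C) (a : V) (rho B : R).
Hypothesis rho0 : 0 < rho.
Hypothesis dF : forall x, nrm (x - a) < rho -> differentiable F x.
Hypothesis FB : forall x, nrm (x - a) < rho -> modc (F x) <= B.

Let line h (s : C) : C := F (a + s *: h).

Lemma line_diff (x h : V) (s : C) : differentiable F (x + s *: h) ->
  differentiable (fun s : C => F (x + s *: h)) s.
Proof.
move=> d; change (differentiable (F \o (fun s : C => x + s *: h)) s).
exact: differentiable_comp.
Qed.

Let line_cder h : has_cder (line h) 0 ('d F a h).
Proof.
move=> e e0; have da : differentiable F a by apply: dF; rewrite subrr nrm0.
have n1 : 0 < nrm h + 1 by have := nrm_ge0 h; lra.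
have [d d0 Hd] := diff_epsP da (divr_gt0 e0 n1).
exists (d / (nrm h + 1)); first by rewrite divr_gt0.
move=> s sd; have sh : nrm (s *: h) < d.
  rewrite nrmZ; move: sd; rewrite ltr_pdivlMr //; apply: le_lt_trans.
  by rewrite ler_wpM2l ?modc_ge0 //; lra.
have E : 'd F a (s *: h) = 'd F a h * s by rewrite linearZ; exact: mulrC.
have := Hd _ sh; rewrite /line add0r scale0r addr0 E nrmZ => /le_trans; apply.
have -> : e / (nrm h + 1) * (modc s * nrm h) = e * modc s * (nrm h / (nrm h + 1)).
  by field; rewrite gt_eqF.
rewrite -[X in _ <= X]mulr1; apply: ler_wpM2l.
  by rewrite mulr_ge0 ?modc_ge0 // ltW.
by rewrite ler_pdivrMr // mul1r; lra.
Qed.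

Let line_hyp h : h != 0 ->
  [/\ 0 < rho / 2 / nrm h, rho / 2 / nrm h < rho / nrm h,
      (forall s : C, modc s < rho / nrm h -> differentiable (line h) s) &
      forall s, modc s = rho / 2 / nrm h -> modc (line h s) <= B].
Proof.
move=> hn; have h0 : 0 < nrm h by rewrite nrm_gt0.
have r2 : 0 < rho / 2 by rewrite divr_gt0.
have key s : modc s < rho / nrm h -> nrm (a + s *: h - a) < rho.
  by move=> hs; rewrite addrAC subrr add0r nrmZ -ltr_pdivlMr.
have lt2 : rho / 2 / nrm h < rho / nrm h by rewrite ltr_pM2r ?invr_gt0 //; have := rho0; lra.
split=> //; first by rewrite divr_gt0.
- by move=> s hs; apply/line_diff/dF/key.
- by move=> s hs; apply/FB/key; rewrite hs.
Qed.

(** The estimate in one variable, on the complex line through [a] and [a + h]. *)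
Lemma hol_taylor (h : V) : nrm h <= rho / 4 ->
  modc (F (a + h) - F a - 'd F a h) <= 8 * B / rho ^+ 2 * nrm h ^+ 2.
Proof.
move=> hh; have [->|hn] := eqVneq h 0.
  by rewrite addr0 linear0 subr0 subrr modc0 nrm0 expr0n mulr0.
have h0 : 0 < nrm h by rewrite nrm_gt0.
have [r0 rr dl lB] := line_hyp hn.
have s1 : modc (1 : C) <= rho / 2 / nrm h / 2.
  have -> : rho / 2 / nrm h / 2 = rho / 4 / nrm h by field; rewrite gt_eqF.
  by rewrite modc1 ler_pdivlMr // mul1r.
have := taylor_quad r0 rr dl lB (line_cder h) s1.
rewrite /line scale1r scale0r addr0 mulr1 modc1; move/le_trans; apply.
rewrite le_eqVlt; apply/orP; left; apply/eqP; field.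
by rewrite !gt_eqF.
Qed.

Lemma hol_dbound (h : V) : modc ('d F a h) <= 2 * B / rho * nrm h.
Proof.
have [->|hn] := eqVneq h 0; first by rewrite linear0 modc0 nrm0 mulr0.
have h0 : 0 < nrm h by rewrite nrm_gt0.
have [r0 rr dl lB] := line_hyp hn.
apply: le_trans (cder_bound r0 rr dl lB (line_cder h)) _.
rewrite le_eqVlt; apply/orP; left; apply/eqP; field.
by rewrite !gt_eqF.
Qed.

Lemma hol_lip (h : V) : nrm h <= rho / 4 -> modc (F (a + h) - F a) <= 4 * B / rho * nrm h.
Proof.
move=> hh; have := hol_taylor hh; have := hol_dbound h.
have := modcD (F (a + h) - F a - 'd F a h) ('d F a h); rewrite subrK => h1 h2 h3.
apply: (le_trans h1); apply: le_trans (lerD h3 h2) _.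
have B0 : 0 <= B.
  by apply: le_trans (modc_ge0 (F a)) (FB _); rewrite subrr nrm0.
have n0 := nrm_ge0 h.
have : 8 * B / rho ^+ 2 * nrm h ^+ 2 <= 2 * B / rho * nrm h.
  have -> : 8 * B / rho ^+ 2 * nrm h ^+ 2 = (2 * B / rho * nrm h) * (nrm h / (rho / 4)).
    by field; rewrite gt_eqF.
  rewrite -[X in _ <= X]mulr1; apply: ler_wpM2l.
    by rewrite mulr_ge0 // divr_ge0 ?mulr_ge0 // ltW.
  by rewrite ler_pdivrMr ?mul1r // divr_gt0.
lra.
Qed.
End OneFunction.

(** Pointwise limits of uniformly bounded holomorphic functions are
    holomorphic: the quadratic Taylor estimates are uniform, and they force the
    differentials to converge. *)
Lemma hol_limit (V : normedModType C) (F_ : nat -> V -> C) (F : V -> C) (a : V) (rho B : R) :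
  0 < rho -> (forall n x, nrm (x - a) < rho -> differentiable (F_ n) x) ->
  (forall n x, nrm (x - a) < rho -> modc (F_ n x) <= B) ->
  (forall x, nrm (x - a) < rho -> tends (fun n => F_ n x) (F x)) ->
  differentiable F a.
Proof.
move=> rho0 dF FB FF.
pose K := 8 * B / rho ^+ 2.
have taylor n h : nrm h <= rho / 4 -> modc (F_ n (a + h) - F_ n a - 'd (F_ n) a h) <= K * nrm h ^+ 2.
  by move=> hh; apply: hol_taylor => //; [exact: dF|exact: FB].
have FFh h : nrm h <= rho / 4 -> tends (fun n => F_ n (a + h) - F_ n a) (F (a + h) - F a).
  move=> hh; apply: tendsB; apply: FF.
    by rewrite addrAC subrr add0r; lra.
  by rewrite subrr nrm0.
have cv h : exists l : C, tends (fun n => 'd (F_ n) a h) l.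
  apply: tends_complete => e e0.
  pose k := nrm h + 1; have k1 : 0 < k by rewrite /k; have := nrm_ge0 h; lra.
  have k2 : 0 <= nrm h ^+ 2 by exact: sqr_ge0.
  have K1 : 0 < `|K| * nrm h ^+ 2 + 1 by have := mulr_ge0 (normr_ge0 K) k2; lra.
  pose t := Num.min (rho / 4 / k) (e / 2 / (`|K| * nrm h ^+ 2 + 1)).
  have t0 : 0 < t by rewrite lt_min !divr_gt0.
  have : t <= t by [].
  rewrite {2}/t le_min => /andP[t1 t2].
  pose s : C := t%:C%C; have ms : modc s = t by rewrite modc_real gtr0_norm.
  have sn : s != 0 by rewrite -modc_eq0 ms gt_eqF.
  have sh : nrm (s *: h) <= rho / 4.
    rewrite nrmZ ms; move: t1; rewrite ler_pdivlMr // => /(le_trans _); apply.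
    by rewrite ler_pM2l // /k; lra.
  exists (s^-1 * (F (a + s *: h) - F a)).
  have e1 : 0 < e / 2 by rewrite divr_gt0.
  have T := tendsZ s^-1 (FFh _ sh); near=> n.
  have h1 : modc (s^-1 * (F_ n (a + s *: h) - F_ n a) - s^-1 * (F (a + s *: h) - F a)) < e / 2.
    by near: n; exact: T.
  have h2 : modc (s^-1 * (F_ n (a + s *: h) - F_ n a) - 'd (F_ n) a h) <= e / 2.
    have -> : s^-1 * (F_ n (a + s *: h) - F_ n a) - 'd (F_ n) a h =
        s^-1 * (F_ n (a + s *: h) - F_ n a - 'd (F_ n) a (s *: h)).
      have -> : 'd (F_ n) a (s *: h) = s * 'd (F_ n) a h by rewrite linearZ.
      by rewrite [in RHS]mulrBr mulKf.
    rewrite modcM modcV ms ler_pdivrMl //; apply: le_trans (taylor n _ sh) _.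
    rewrite nrmZ ms exprMn.
    move: t2; rewrite ler_pdivlMr // => t2.
    apply: le_trans (_ : `|K| * (t ^+ 2 * nrm h ^+ 2) <= _).
      by rewrite ler_wpM2r ?ler_norm // mulr_ge0 // sqr_ge0.
    have -> : `|K| * (t ^+ 2 * nrm h ^+ 2) = t * (t * (`|K| * nrm h ^+ 2)) by ring.
    by rewrite ler_pM2l //; lra.
  set u := s^-1 * _ in h1 h2; set v := s^-1 * _ in h1 *.
  have := modcB (u - v) (u - 'd (F_ n) a h).
  have -> : u - v - (u - 'd (F_ n) a h) = 'd (F_ n) a h - v by ring.
  lra.
have [D HD] := choice cv.
have Dlin : linear (D : V -> C).
  move=> c x y; apply: tends_uniq (HD _) _.
  have := tendsD (tendsZ c (HD x)) (HD y); apply: tends_near.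
  by near=> n; rewrite linearP.
pose DM := GRing.isLinear.Build _ _ _ _ _ Dlin.
pose L : {linear V -> C} := HB.pack D DM.
have Lb h : modc (L h) <= 2 * B / rho * nrm h.
  apply: tends_le (HD h); near=> n; apply: hol_dbound => //; [exact: dF|exact: FB].
have B0 : 0 <= B.
  by apply: le_trans (modc_ge0 (F_ 0%N a)) (FB _ _ _); rewrite subrr nrm0.
have Lc : continuous L.
  move=> x; apply/cvgrPdist_lt => e e0.
  have ee : (complex.Re e)%:C%C = e by rewrite RRe_real // gtr0_real.
  have e1 : 0 < complex.Re e by rewrite -ltcR ee.
  have c0 : 0 < 2 * B / rho + 1.
    by rewrite ltr_wpDl // divr_ge0 ?mulr_ge0 // ltW.
  apply/nearE_nrm; exists (complex.Re e / (2 * B / rho + 1)); first by rewrite divr_gt0.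
  move=> y; rewrite ltr_pdivlMr // => hy.
  rewrite -linearB -ee -[X in X < _]/((modc (L (x - y)))%:C%C) ltcR.
  apply: le_lt_trans (Lb _) _; rewrite -[x - y]opprB nrmN; apply: le_lt_trans hy.
  by rewrite mulrC ler_wpM2l ?nrm_ge0 //; lra.
apply: (diff_quad (K := K) (d := rho / 4) Lc); first by rewrite divr_gt0.
move=> h /ltW hh; apply: tends_le (tendsB (FFh h hh) (HD h)).
by near=> n; exact: taylor.
Unshelve. all: by end_near. Qed.
End Several.

(** * Division by a linear form *)

Section Division.
Variable R : realType.
Local Notation C := (Cx R).
Variables (V : normedModType C) (l : {linear V -> C}) (v : V).
Hypothesis lc : continuous l.
Hypothesis lv : l v = 1.

Lemma ravg_diff n (G : V -> C -> C) (x : V) (z h : C) :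
  (forall s : R, 0 <= s <= 1 -> differentiable (fun y => G y (z + s%:C%C * h)) x) ->
  differentiable (fun y => ravg n (G y) z h) x.
Proof.
elim: n z h => [|n IH] z h H /=.
  by have := H 0; rewrite mul0r addr0; apply; rewrite lexx ler01.
apply: differentiableM; last exact: differentiable_cst.
apply: differentiableD; apply: IH => s s01.
  have := H (s / 2); have -> : z + (s / 2)%:C%C * h = z + s%:C%C * (h / 2) by field.
  by apply; lra.
have := H (s / 2 + 1 / 2).
have -> : z + (s / 2 + 1 / 2)%:C%C * h = z + h / 2 + s%:C%C * (h / 2) by field.
by apply; lra.
Qed.

(** Division by a linear form: the quotient is the average of
    [phi (x + t v) / (l (x + t v) - l a)] over a small circle of parameters
    [t], by Cauchy's formula on the line through [x] with direction [v].  This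
    expression is holomorphic in [x], even on the hyperplane. *)
Lemma hol_divide (phi : V -> C) (a : V) :
  (\forall x \near a, differentiable phi x) ->
  (\forall x \near a, l x = l a -> phi x = 0) ->
  exists2 psi : V -> C, \forall x \near a, differentiable psi x &
    \forall x \near a, phi x = psi x * (l x - l a).
Proof.
move=> /nearE_nrm[d1 d10 H1] /nearE_nrm[d2 d20 H2].
have da : differentiable phi a by apply: H1; rewrite subrr nrm0.
have [d3 d30 H3] := diff_cont da ltr01.
have [k0 k00 Hk0] := linear_lipschitz lc.
pose k := complex.Re k0.
have kE : k%:C%C = k0 by rewrite RRe_real // gtr0_real.
have k_gt0 : 0 < k by rewrite -ltcR kE.
have Hk x : modc (l x) <= k * nrm x.
  by have := Hk0 x; rewrite [X in _ * X]nrmE -kE -(rmorphM (real_complex R)) -[X in X <= _]/((modc (l x))%:C%C) lecR.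
pose rho := Num.min d1 (Num.min d2 d3).
have rho0 : 0 < rho by rewrite !lt_min d10 d20.
have phid x : nrm (x - a) < rho -> differentiable phi x.
  by rewrite !lt_min => /andP[h _]; exact: H1.
have phi0 x : nrm (x - a) < rho -> l x = l a -> phi x = 0.
  by rewrite !lt_min => /andP[_ /andP[h _]]; exact: H2.
pose B := modc (phi a) + 1.
have phiB x : nrm (x - a) < rho -> modc (phi x) <= B.
  rewrite !lt_min => /andP[_ /andP[_ h]]; have := H3 _ h.
  rewrite [a + _]addrC subrK => h'.
  by have := modcD (phi x - phi a) (phi a); rewrite subrK /B; lra.
clearbody rho; clear d1 d10 H1 d2 d20 H2 d3 d30 H3 Hk0 kE da.
pose M := nrm v + 1; have M0 : 0 < M by rewrite /M; have := nrm_ge0 v; lra.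
pose r := rho / 4 / M; have r0 : 0 < r by rewrite !divr_gt0.
have rM : r * nrm v <= rho / 4.
  have -> : rho / 4 = r * M by rewrite /r; field; rewrite gt_eqF.
  by rewrite ler_pM2l // /M; lra.
pose rho' := Num.min (rho / 4) (r / 2 / k).
have rho'0 : 0 < rho' by rewrite lt_min !divr_gt0.
pose u x := l x - l a.
have uB x : nrm (x - a) < rho' -> modc (u x) < r / 2.
  rewrite lt_min => /andP[_]; rewrite ltr_pdivlMr // mulrC => h.
  by rewrite /u -linearB; apply: le_lt_trans (Hk _) h.
have inball x (t : C) : nrm (x - a) < rho' -> modc t < 2 * r -> nrm (x + t *: v - a) < rho.
  rewrite lt_min => /andP[hx _] ht; rewrite addrAC.
  apply: le_lt_trans (nrmD _ _) _; rewrite nrmZ.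
  have : modc t * nrm v <= 2 * r * nrm v by rewrite ler_wpM2r ?nrm_ge0 // ltW.
  lra.
pose p n x := cavg n (fun t => phi (x + t *: v) / (u x + t)) r.
have un x t : nrm (x - a) < rho' -> modc t = r -> r / 2 <= modc (u x + t).
  move=> hx ht; have := modcB (u x + t) (u x); rewrite addrAC subrr add0r ht.
  by have := uB x hx; lra.
have un0 x t : nrm (x - a) < rho' -> modc t = r -> u x + t != 0.
  by move=> hx ht; rewrite -modc_eq0; have := un x t hx ht => h; apply/eqP; lra.
have pd n x : nrm (x - a) < rho' -> differentiable (p n) x.
  move=> hx; apply: ravg_diff => s s01; set t := _ * cexp _.
  have mt : modc t = r by apply: modc_circle; exact: ltW.
  apply: differentiableM; last first.
    apply: differentiableV; last exact: un0.
    apply: differentiableD; last exact: differentiable_cst.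
    apply: differentiableB; last exact: differentiable_cst.
    exact: linear_differentiable.
  change (differentiable (phi \o (fun y => y + t *: v)) x).
  apply: differentiable_comp; first exact: differentiableD.
  by apply/phid/inball => //; rewrite mt; lra.
have pB n x : nrm (x - a) < rho' -> modc (p n x) <= B / (r / 2).
  move=> hx; apply: cavg_bound => [|t mt]; first exact: ltW.
  rewrite modcM modcV; apply: ler_pM; rewrite ?modc_ge0 ?invr_ge0 ?modc_ge0 //.
    by apply/phiB/inball => //; rewrite mt; lra.
  have h := un x t hx mt; have r20 : 0 < r / 2 by rewrite divr_gt0.
  by rewrite lef_pV2 ?posrE // (lt_le_trans r20 h).
have hd x : nrm (x - a) < rho' -> forall t : C, modc t < 2 * r ->
    differentiable (fun t : C => phi (x + t *: v)) t.
  by move=> hx t ht; apply: line_diff; apply/phid/inball.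
have r2 : r < 2 * r by lra.
(* On the line through [x], [phi] vanishes at the parameter [- u x]: Cauchy's
   formula there and the mean value at 0 combine to the quotient.  If [u x = 0],
   the limit is the derivative along the line. *)
have pcv x : exists w, nrm (x - a) < rho' -> tends (fun n => p n x) w /\ phi x = w * u x.
  have [hx|] := pselect (nrm (x - a) < rho'); last by exists 0.
  pose h (t : C) := phi (x + t *: v).
  have hdx : forall t : C, modc t < 2 * r -> differentiable h t by exact: hd.
  have h0 : h 0 = phi x by rewrite /h scale0r addr0.
  have [u0|u0] := eqVneq (u x) 0.
    have phx : phi x = 0.
      apply: phi0; last by apply/eqP; rewrite -subr_eq0 -/(u x) u0.
      by have := inball x 0 hx; rewrite modc0 scale0r addr0; apply; lra.
    have h00 : modc (0 : C) < 2 * r by rewrite modc0; lra.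
    have [D HD] := cder_eps (hdx 0 h00).
    exists D => _; split; last by rewrite u0 mulr0.
    apply: tends_near (cder_avg r0 r2 hdx (B := B) _ HD).
      by near=> n; apply: cavg_ext => [|t _]; [exact: ltW|rewrite u0 add0r].
    by move=> t mt; apply/phiB/inball => //; rewrite mt.
  have mu : modc (- u x) < r by rewrite modcN; have := uB x hx; lra.
  exists (phi x / u x) => _; split; last by rewrite divfK.
  have hu : h (- u x) = 0.
    apply: phi0; first by apply: inball => //; lra.
    rewrite linearD linearZ /= lv; change (l x + - u x * 1 = l a).
    by rewrite mulr1 /u; ring.
  have := tendsB (mean_value r0 r2 hdx) (cauchy_disc r0 r2 hdx mu).
  rewrite hu h0 subr0 => /(tendsZ (u x)^-1); rewrite mulrC.
  apply: tends_near; near=> n; rewrite -cavgB -cavgZ; apply: cavg_ext => [|t mt]; first exact: ltW.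
  have tn : t != 0 by rewrite -modc_eq0 mt gt_eqF.
  have utn := un0 x t hx mt.
  rewrite /h; have -> : 1 - - u x / t = (u x + t) / t by field.
  by field; rewrite tn utn u0.
have [psi Hpsi] := choice pcv.
exists psi; apply/nearE_nrm; last first.
  by exists rho' => // x hx; exact: (Hpsi x hx).2.
exists (rho' / 2) => [|x hx]; first by rewrite divr_gt0.
have near x' : nrm (x' - x) < rho' / 2 -> nrm (x' - a) < rho'.
  move=> hx'; have -> : x' - a = (x' - x) + (x - a) by rewrite addrA subrK.
  by apply: le_lt_trans (nrmD _ _) _; lra.
apply: (@hol_limit R V p psi x (rho' / 2) (B / (r / 2))).
- by rewrite divr_gt0.
- by move=> n y hy; apply/pd/near.
- by move=> n y hy; apply/pB/near.
by move=> y hy; exact: (Hpsi y (near y hy)).1.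
Unshelve. all: by end_near. Qed.
End Division.

(** * The theta function *)

Section Theta.
Variable R : realType.
Local Notation C := (Cx R).
Local Notation Im := complex.Im.
Local Notation cexp := (@cexp R).
Variable tau : C.
Hypothesis tau0 : 0 < Im tau.

Let q : C := cexp tau.
Let b : R := modc q.

Let b01 : 0 < b < 1.
Proof.
have p0 := pi_gt0 R; have t0 := tau0.
rewrite /b modc_cexp expR_gt0 expR_lt1 oppr_lt0 !mulr_gt0 //.
Qed.

Definition qpart n (w : C) : C := \prod_(i < n) (1 - cexp tau ^+ i * w).

Lemma qpartS n w : qpart n.+1 w = qpart n w * (1 - q ^+ n * w).
Proof. by rewrite /qpart big_ord_recr. Qed.

Lemma qpart_bound n w : modc (qpart n w) <= expR (modc w / (1 - b) * (1 - b ^+ n)).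
Proof.
elim: n => [|n IH].
  by rewrite /qpart big_ord0 modc1 expr0 subrr mulr0 expR0.
rewrite qpartS modcM.
have h : modc (1 - q ^+ n * w) <= expR (b ^+ n * modc w).
  apply: le_trans (expR_ge1Dx _); apply: le_trans (modcB _ _) _.
  by rewrite modc1 modcM modcX.
apply: le_trans (ler_pM (modc_ge0 _) (modc_ge0 _) IH h) _.
rewrite -expRD ler_expR exprS le_eqVlt; apply/orP; left; apply/eqP; field.
by have := b01; lra.
Qed.

Lemma qpart_bound' n w : modc (qpart n w) <= expR (modc w / (1 - b)).
Proof.
apply: le_trans (qpart_bound n w) _; rewrite ler_expR.
have h1 : 0 < 1 - b by have := b01; lra.
rewrite -[X in _ <= X]mulr1; apply: ler_wpM2l.
  by rewrite divr_ge0 ?modc_ge0 // ltW.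
by rewrite gerBl exprn_ge0 // ltW //; have := b01; lra.
Qed.

Lemma qpart_cvg w : exists p, tends (fun n => qpart n w) p.
Proof.
apply: (@tends_geometric _ (modc w * expR (modc w / (1 - b))) b); first by have := b01; lra.
move=> n; rewrite qpartS mulrBr mulr1 addrAC subrr add0r modcN modcM modcM modcX.
have bn : 0 <= b ^+ n by rewrite exprn_ge0 // modc_ge0.
have := qpart_bound' n w; have := modc_ge0 w; set e := expR _ => w0 h.
have -> : modc w * e * b ^+ n = e * (b ^+ n * modc w) by ring.
by apply: ler_wpM2r => //; rewrite mulr_ge0.
Qed.

(** The Euler product [prod_(i >= 0) (1 - q ^ i * w)] for [q = exp (2 pi i tau)]. *)
Definition qprod (w : C) : C := xget 0 [set p | tends (fun n => qpart n w) p].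

Lemma qprod_tends w : tends (fun n => qpart n w) (qprod w).
Proof. by have [p hp] := qpart_cvg w; exact: (xgetPex 0 (ex_intro _ p hp)). Qed.

Lemma qprod_step w : qprod w = (1 - w) * qprod (q * w).
Proof.
apply: tends_uniq (qprod_tends w) (tends_S _).
apply: tends_near (tendsZ (1 - w) (qprod_tends (q * w))); near=> n.
rewrite /qpart big_ord_recl expr0 mul1r; congr (_ * _); apply: eq_bigr => i _.
by rewrite mulrA -exprSr.
Unshelve. all: by end_near. Qed.

Lemma qprod_iter n w : qprod w = qpart n w * qprod (q ^+ n * w).
Proof.
elim: n => [|n IH]; first by rewrite /qpart big_ord0 expr0 !mul1r.
by rewrite IH qprod_step qpartS exprS !mulrA.
Qed.

(** The partial products stay away from 0, by
    [(1 - x) * (1 - y) >= 1 - (x + y)]. *)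
Lemma qprod_near0 w : modc w <= (1 - b) / 2 -> qprod w != 0.
Proof.
have [b0 b1] := andP b01; move=> wb.
have h1 : 0 < 1 - b by lra.
pose X n := modc w / (1 - b) * (1 - b ^+ n).
have w2 : modc w / (1 - b) <= 1 / 2 by rewrite ler_pdivrMr //; lra.
have w0 : 0 <= modc w / (1 - b) by rewrite divr_ge0 ?modc_ge0 // ltW.
have bn n : 0 <= b ^+ n <= 1 by rewrite exprn_ge0 ?exprn_ile1 ?modc_ge0 ?ltW.
have low n : 1 - X n <= modc (qpart n w).
  elim: n => [|n IH]; first by rewrite /X /qpart big_ord0 modc1 expr0 subrr mulr0 subr0.
  rewrite qpartS modcM.
  have h : 1 - b ^+ n * modc w <= modc (1 - q ^+ n * w).
    by have := modcD (1 - q ^+ n * w) (q ^+ n * w); rewrite subrK modc1 modcM modcX -/b; lra.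
  have XS : X n.+1 = X n + b ^+ n * modc w.
    by rewrite /X exprS; field; rewrite gt_eqF.
  have X0 : 0 <= X n <= 1 / 2 by rewrite /X; have := bn n; nra.
  have bw : 0 <= b ^+ n * modc w <= 1 / 2.
    have := modc_ge0 w; have := bn n => hb hw; apply/andP; split; first by nra.
    have hw' : b ^+ n * modc w <= modc w by nra.
    by lra.
  rewrite XS; apply: le_trans (ler_pM _ _ IH h); nra.
have : 1 / 2 <= modc (qprod w).
  rewrite leNgt; apply/negP => hlt.
  have e0 : 0 < 1 / 2 - modc (qprod w) by lra.
  near \oo => n.
  have : modc (qpart n w - qprod w) < 1 / 2 - modc (qprod w) by near: n; exact: qprod_tends.
  have := modcD (qpart n w - qprod w) (qprod w); rewrite subrK.
  have := low n; have : X n <= 1 / 2 by rewrite /X; have := bn n; nra.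
  lra.
by move=> h; rewrite -modc_eq0; apply/eqP; lra.
Unshelve. all: by end_near. Qed.

(** Once enough factors are split off, the remaining product is covered by
    [qprod_near0]. *)
Lemma qprod_eq0 w : qprod w = 0 -> exists n, q ^+ n * w = 1.
Proof.
have [b0 b1] := andP b01.
have h1 : 0 < (1 - b) / 2 / (modc w + 1).
  by rewrite !divr_gt0 //; have := modc_ge0 w; lra.
have bb : `|b| < 1 by rewrite gtr0_norm.
have /cvgrPdist_lt/(_ _ h1)[N _ /(_ N (leqnn N))] := cvg_expr bb.
rewrite sub0r normrN => hN P0.
have : qprod (q ^+ N * w) != 0.
  apply: qprod_near0; rewrite modcM modcX -/b.
  have w1 : 0 < modc w + 1 by have := modc_ge0 w; lra.
  have := le_lt_trans (ler_norm _) hN; rewrite ltr_pdivlMr // => h.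
  apply: le_trans (ltW h); rewrite ler_wpM2l //; last by lra.
  by rewrite exprn_ge0 // modc_ge0.
have := qprod_iter N w; rewrite P0 => /esym/eqP; rewrite mulf_eq0 => /orP[|-> //].
rewrite /qpart prodf_seq_eq0 => /hasP[i _ /=]; rewrite subr_eq0 => /eqP h _.
by exists i.
Qed.

Lemma qprod_diff (w : C) : differentiable qprod w.
Proof.
apply: (@hol_limit R C qpart qprod w 1 (expR ((modc w + 1) / (1 - b)))) => // [n x _|n x hx|x _].
- elim: n => [|n IH].
    have -> : qpart 0 = cst 1 by apply/funext => y; rewrite /qpart big_ord0.
    exact: differentiable_cst.
  have -> : qpart n.+1 = (fun y => qpart n y * (1 - q ^+ n * y)) by apply/funext => y; rewrite qpartS.
  by apply: differentiableM.
- apply: le_trans (qpart_bound' n x) _; rewrite ler_expR ler_pM2r; last first.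
    by rewrite invr_gt0; have := b01; lra.
  by have := modcD (x - w) w; rewrite subrK; rewrite nrmC in hx; lra.
exact: qprod_tends.
Qed.

Lemma qprod_comp_diff (f : C -> C) (z : C) :
  differentiable f z -> differentiable (fun z => qprod (f z)) z.
Proof.
move=> df; change (differentiable (qprod \o f) z).
by apply: differentiable_comp; [exact: df|exact: qprod_diff].
Qed.

(** Jacobi's theta function, up to a translation and a constant factor.  The
    triple product shows its zeros, which the series does not. *)
Definition theta (z : C) : C := qprod (cexp z) * qprod (q * cexp (- z)).

Lemma theta_diff z : differentiable theta z.
Proof.
apply: differentiableM.
  by apply: qprod_comp_diff; exact: cexp_diff.
apply: qprod_comp_diff; apply: differentiableM; first exact: differentiable_cst.
by apply: cexp_comp_diff; apply: differentiableN.
Qed.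

Lemma theta1 z : theta (z + 1) = theta z.
Proof. by rewrite /theta opprD !cexpD (cexpN 1) cexp1 invr1 !mulr1. Qed.

Lemma thetaE z : theta z = (1 - cexp z) * (qprod (q * cexp z) * qprod (q * cexp (- z))).
Proof. by rewrite /theta {1}qprod_step mulrA. Qed.

Lemma theta_tau z : theta (z + tau) = - cexp (- z) * theta z.
Proof.
rewrite [in RHS]thetaE /theta cexpD -/q [cexp z * q]mulrC.
have -> : q * cexp (- (z + tau)) = cexp (- z).
  by rewrite opprD cexpD mulrCA -cexpD addrN cexp0 mulr1.
rewrite (qprod_step (cexp (- z))) cexpN; have e0 := cexp_neq0 z.
set A := qprod _; set B := qprod _; field; exact: e0.
Qed.

Lemma theta_int (k : int) z : theta (z + k%:~R) = theta z.
Proof.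
have H (n : nat) y : theta (y + n%:R) = theta y.
  by elim: n => [|n IH]; rewrite ?addr0 // -natr1 addrA theta1.
case: k => n; first by rewrite -pmulrn H.
by rewrite NegzE mulrNz -pmulrn -[in RHS](subrK n.+1%:R z) H.
Qed.

Lemma theta_taus (k : int) : exists2 c : C, c != 0 &
  forall z, theta (z + tau *~ k) = c * cexp (- (z *~ k)) * theta z.
Proof.
have H (n : nat) : exists2 c : C, c != 0 &
    forall z, theta (z + tau *+ n) = c * cexp (- (z *+ n)) * theta z.
  elim: n => [|n [c c0 Hc]].
    by exists 1 => [|z]; rewrite ?oner_eq0 // !mulr0n oppr0 cexp0 addr0 !mul1r.
  exists (- c * cexp (- (tau *+ n))) => [|z].
    by rewrite mulf_neq0 ?oppr_eq0 ?cexp_neq0.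
  rewrite !mulrSr addrA theta_tau Hc !opprD !cexpD; ring.
case: k => n; first by have [c c0 Hc] := H n; exists c => // z; rewrite -!pmulrn.
have [c c0 Hc] := H n.+1.
exists (c^-1 * cexp (- (tau *+ n.+1 *+ n.+1))) => [|z].
  by rewrite mulf_neq0 ?invr_eq0 ?cexp_neq0.
rewrite NegzE !mulrNz opprK -!pmulrn.
have := Hc (z - tau *+ n.+1); rewrite subrK mulrnBl opprB => ->.
rewrite cexpB cexpN; have := cexp_neq0 (z *+ n.+1); have := cexp_neq0 (tau *+ n.+1 *+ n.+1).
set x := cexp _; set y := cexp _ => x0 y0; field.
by rewrite c0 x0 y0.
Qed.

Lemma theta_eq0 z : theta z = 0 <-> exists p k : int, z = p%:~R + tau *~ k.
Proof.
split; last first.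
  move=> [p [k ->]]; have [c _ Hc] := theta_taus k.
  by rewrite Hc -[p%:~R]add0r theta_int thetaE cexp0 subrr mul0r mulr0.
move/eqP; rewrite mulf_eq0 => /orP[] /eqP /qprod_eq0[n].
  rewrite /q -cexp_nat -cexpD => /cexp_eq1[k hk]; exists k, (- n%:Z).
  by rewrite mulrNz -pmulrn -hk [_ + z]addrC addrK.
rewrite mulrA -exprSr /q -cexp_nat -cexpD => /cexp_eq1[k hk]; exists (- k), n.+1.
by rewrite mulrNz -hk -pmulrn opprB subrK.
Qed.

(** The factor [1 - cexp z] has a nonzero derivative at 0, and the other factors
    do not vanish there. *)
Let theta_near0 : exists2 u : C -> C, \forall z \near (0 : C), differentiable u z &
   u 0 != 0 /\ \forall z \near (0 : C), theta z = z * u z.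
Proof.
have lid : continuous (idfun : C -> C) by move=> x; exact: cvg_id.
have d1 : \forall z \near (0 : C), differentiable (fun z => 1 - cexp z) z.
  by near=> z; apply: differentiableB; [exact: differentiable_cst|exact: cexp_diff].
have z1 : \forall z \near (0 : C), idfun z = idfun (0 : C) -> 1 - cexp z = 0.
  by near=> z => /= ->; rewrite cexp0 subrr.
have [chi dchi Hchi] := hol_divide (l := idfun) (v := 1) lid erefl d1 z1.
pose Q z := qprod (q * cexp z) * qprod (q * cexp (- z)).
have Qd (z : C) : differentiable Q z.
  apply: differentiableM.
    apply: qprod_comp_diff; apply: differentiableM; first exact: differentiable_cst.
    exact: cexp_diff.
  apply: qprod_comp_diff; apply: differentiableM; first exact: differentiable_cst.
  by apply: cexp_comp_diff; apply: differentiableN.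
have Q0 : Q 0 != 0.
  suff Q1 : qprod q != 0 by rewrite /Q oppr0 cexp0 mulr1 mulf_neq0.
  apply/eqP => /qprod_eq0[n].
  rewrite -exprSr => /(congr1 (@modc R)); rewrite modcX modc1 -/b => /eqP.
  by rewrite pexpr_eq1 // ?modc_ge0 // => /eqP; have := b01; lra.
have c0 : chi 0 != 0.
  apply/eqP => chi0; have dc0 := nbhs_singleton dchi.
  have [d d0 Hd] := diff_cont dc0 ltr01.
  move: Hchi => /nearE_nrm[d' d0' Hd'].
  have pp : 0 < 40 * pi ^+ 2 :> R by rewrite mulr_gt0 // exprn_gt0 // pi_gt0.
  pose M := Num.min (Num.min d d') (40 * pi ^+ 2)^-1.
  have M0 : 0 < M by rewrite !lt_min d0 d0' invr_gt0 pp.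
  pose m := M / 2; have m0 : 0 < m by rewrite divr_gt0.
  have : m < M by rewrite /m; lra.
  rewrite /M !lt_min => /andP[/andP[m1 m2] m3].
  pose z : C := m%:C%C; have mz : modc z = m by rewrite modc_real gtr0_norm.
  have h1 := Hd z; rewrite nrmC mz add0r chi0 subr0 in h1; have {}h1 := h1 m1.
  have h2 := Hd' z; rewrite subr0 nrmC mz in h2; have {}h2 := h2 m2.
  rewrite /= in h2.
  have h3 := @cexp_sub1_ge R z; rewrite mz in h3; have {}h3 := h3 m3.
  rewrite h2 modcM mz in h3.
  have h4 : modc (chi z) * m < m by rewrite -[X in _ < X]mul1r ltr_pM2r.
  suff : m < m by rewrite ltxx.
  lra.
exists (fun z => chi z * Q z).
  by apply: filterS dchi => z dz; apply: differentiableM.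
split; first by rewrite mulf_neq0.
apply: filterS Hchi => z hz; rewrite thetaE hz /= subr0 -/(Q z); ring.
Unshelve. all: by end_near. Qed.

Lemma near_shift0 (lam : C) (P : C -> Prop) :
  (\forall z \near (0 : C), P z) -> \forall z \near lam, P (z - lam).
Proof.
move=> /nearE_nrm[d d0 Hd]; apply/nearE_nrm; exists d => // z hz.
by apply: Hd; rewrite subr0.
Qed.

(** The quasi-periodicity carries the simple zero at 0 to all other zeros. *)
Lemma theta_simple (lam : C) : theta lam = 0 ->
  exists2 u : C -> C, \forall z \near lam, differentiable u z /\ u z != 0 &
    \forall z \near lam, theta z = (z - lam) * u z.
Proof.
move=> /theta_eq0[p [k hl]]; have [u du [u0 Hu]] := theta_near0.
have [c c0 Hc] := theta_taus k.
have E z : theta z = c * cexp (- ((z - lam) *~ k)) * theta (z - lam).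
  rewrite -Hc -[in RHS](theta_int p); congr theta.
  by rewrite hl opprD addrA subrK subrK.
have un := diff_neq0 (nbhs_singleton du) u0.
exists (fun z => c * cexp (- ((z - lam) *~ k)) * u (z - lam)); last first.
  by have := near_shift0 lam Hu; apply: filterS => z hz; rewrite E hz; ring.
refine (filterS _ (filterI (near_shift0 lam du) (near_shift0 lam un))) => z [hz1 hz2].
split; last by rewrite !mulf_neq0 // cexp_neq0.
apply: differentiableM; last first.
  change (differentiable (u \o (fun z => z - lam)) z).
  apply: (@differentiable_comp _ _ _ _ (fun z => z - lam) u); last exact: hz1.
  exact: (@shift_diff R C (- lam)).
apply: differentiableM; first exact: differentiable_cst.
apply: cexp_comp_diff.
have -> : (fun z : C => - ((z - lam) *~ k)) = (fun z : C => - (k%:~R * (z - lam))).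
  by apply/funext => y; rewrite mulrzl.
apply: differentiableN; apply: differentiableM; first exact: differentiable_cst.
exact: (@shift_diff R C (- lam)).
Qed.
End Theta.

(** * Integrals over periods and uniqueness of Fourier series *)

Section Mean.
Variable R : realType.
Local Notation C := (Cx R).
Local Notation Im := complex.Im.
Local Notation cexp := (@cexp R).

(** Compactness of the segment makes the local bounds uniform. *)
Lemma segment_bound (V : normedModType C) (F : V -> C) (x e : V) :
  (forall y, differentiable F y) ->
  exists (rho B : R), 0 < rho /\ forall (t : R) y, 0 <= t <= 1 ->
    nrm (y - (x + t%:C%C *: e)) < rho -> modc (F y) <= B.
Proof.
move=> dF.
pose P (N : nat) (t : R) := forall y, nrm (y - (x + t%:C%C *: e)) < half R N -> modc (F y) <= N%:R.
have e1 : 0 < nrm e + 1 by have := nrm_ge0 e; lra.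
have half_le N j : (j <= N)%N -> half R N <= half R j.
  by move=> jN; apply: ler_wiXn2l jN; rewrite ?invr_ge0 //; lra.
have [N _ HN] : \forall N \near \oo, `[(0 : R), 1] `<=` P N.
  apply: (compact_near_coveringP _).1 (@segment_compact R 0 1) _ _ _ _ _ => t0 _.
  have [d d0 Hd] := diff_cont (dF (x + t0%:C%C *: e)) ltr01.
  have d2 : 0 < d / 2 by rewrite divr_gt0.
  have [j hj] := half_small d2.
  pose B := modc (F (x + t0%:C%C *: e)) + 1.
  have B0 : 0 <= B by rewrite /B; have := modc_ge0 (F (x + t0%:C%C *: e)); lra.
  have d3 : 0 < d / 2 / (nrm e + 1) by rewrite divr_gt0.
  exists (ball t0 (d / 2 / (nrm e + 1)), [set N | (maxn j (Num.bound B) <= N)%N]) => /=.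
    by split; [exact: nbhsx_ballx|exists (maxn j (Num.bound B))].
  move=> [t N] [/= ht hN] y hy.
  have := Hd (y - (x + t0%:C%C *: e)); rewrite [_ + (y - _)]addrC subrK => H.
  have hy2 : nrm (y - (x + t0%:C%C *: e)) < d.
    have -> : y - (x + t0%:C%C *: e) = (y - (x + t%:C%C *: e)) + (t - t0)%:C%C *: e.
      by rewrite rmorphB scalerBl !opprD !addrA addrNK.
    apply: le_lt_trans (nrmD _ _) _; rewrite nrmZ modc_real.
    have h1 : half R N <= half R j by apply: half_le; apply: leq_trans hN; exact: leq_maxl.
    move: ht; rewrite /ball /= distrC ltr_pdivlMr // => ht.
    have : `|t - t0| * nrm e <= `|t - t0| * (nrm e + 1) by rewrite ler_wpM2l //; lra.
    lra.
  have := H hy2; have := modcD (F y - F (x + t0%:C%C *: e)) (F (x + t0%:C%C *: e)).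
  rewrite subrK => h1 h2.
  have h3 : B <= N%:R.
    apply: ltW; apply: lt_le_trans (archi_boundP B0) _; rewrite ler_nat.
    by apply: leq_trans hN; exact: leq_maxr.
  by apply: le_trans h3; rewrite /B; lra.
exists (half R N), N%:R; split; first exact: half_gt0.
move=> t y t01; apply: (HN N (leqnn N) t).
by rewrite /= in_itv.
Qed.

(** One halving of the step changes the average of a Lipschitz function by a
    multiple of the step, so that the averages converge geometrically. *)
Lemma ravg_step (f : C -> C) (z h : C) (K d : R) n :
  (forall (s : R) c, 0 <= s <= 1 -> modc c <= d ->
     modc (f (z + s%:C%C * h + c) - f (z + s%:C%C * h)) <= K * modc c) ->
  modc h * half R n <= d ->
  modc (ravg n.+1 f z h - ravg n f z h) <= K * modc h * half R n.
Proof.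
elim: n z h => [|n IH] z h H hd.
  rewrite /half expr0 mulr1 in hd *.
  have h2 : modc (h / 2) = modc h / 2 by rewrite modcM modc_half.
  rewrite [ravg 1 _ _ _]/= [ravg 0 _ _ _]/=.
  have -> : (f z + f (z + h / 2)) / 2 - f z = (f (z + h / 2) - f z) / 2 by field.
  have := H 0 (h / 2); rewrite mul0r addr0 h2 modcM modc_half lexx ler01.
  have mh := modc_ge0 h; move=> /(_ isT) Hh; have {}Hh := Hh (_ : modc h / 2 <= d).
  have : modc h / 2 <= d by lra.
  by move=> /Hh; have := modc_ge0 (f (z + h / 2) - f z); lra.
rewrite halfS in hd *.
have h2 : modc (h / 2) = modc h / 2 by rewrite modcM modc_half.
have i1 := IH z (h / 2); have i2 := IH (z + h / 2) (h / 2).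
rewrite [ravg n.+2 _ _ _]/= [ravg n.+1 _ _ _ in X in modc (_ - X)]/=.
set a := ravg n.+1 f z _ in i1 *; set b := ravg n f z _ in i1 *.
set c := ravg n.+1 f _ _ in i2 *; set e := ravg n f _ _ in i2 *.
have j1 : modc (a - b) <= K * (modc h / 2) * half R n.
  rewrite -h2; apply: i1 => [s w s01 wd|]; last by rewrite h2; lra.
  have -> : z + s%:C%C * (h / 2) = z + (s / 2)%:C%C * h by field.
  by apply: H => //; lra.
have j2 : modc (c - e) <= K * (modc h / 2) * half R n.
  rewrite -h2; apply: i2 => [s w s01 wd|]; last by rewrite h2; lra.
  have -> : z + h / 2 + s%:C%C * (h / 2) = z + (s / 2 + 1 / 2)%:C%C * h by field.
  by apply: H => //; lra.
have -> : (a + c) / 2 - (b + e) / 2 = ((a - b) + (c - e)) / 2 by field.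
by rewrite modcM modc_half; have := modcD (a - b) (c - e); lra.
Qed.

Section Direction.
Variables (V : normedModType C) (e : V).

Definition avg n (F : V -> C) (x : V) : C := ravg n (fun t => F (x + t *: e)) 0 1.

Lemma avg_cvg F x : (forall y, differentiable F y) -> exists l, tends (fun n => avg n F x) l.
Proof.
move=> dF; have [rho [B [rho0 HB]]] := segment_bound x e dF.
have e1 : 0 < nrm e + 1 by have := nrm_ge0 e; lra.
pose K := 4 * B / rho * nrm e.
pose d := rho / 4 / (nrm e + 1); have d0 : 0 < d by rewrite !divr_gt0.
have lip (s : R) c : 0 <= s <= 1 -> modc c <= d ->
    modc (F (x + (0 + s%:C%C * 1 + c) *: e) - F (x + (0 + s%:C%C * 1) *: e)) <= K * modc c.
  move=> s01 cd; rewrite add0r mulr1.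
  have := @hol_lip R V F (x + s%:C%C *: e) rho B rho0.
  have h1 y : nrm (y - (x + s%:C%C *: e)) < rho -> differentiable F y by [].
  move=> /(_ h1 (fun y => HB s y s01) (c *: e)); rewrite nrmZ scalerDl addrA.
  have : modc c * nrm e <= rho / 4.
    move: cd; rewrite /d ler_pdivlMr // => cd; apply: le_trans cd.
    by rewrite ler_wpM2l ?modc_ge0 //; lra.
  move=> h2 /(_ h2); rewrite /K; lra.
have [N hN] := half_small d0.
have N1 : half R N <= d by exact: ltW.
have [l hl] : exists l, tends (fun n => avg (n + N)%N F x) l.
  apply: (@tends_geometric _ (K * half R N) (2^-1)); first by lra.
  move=> n; rewrite addSn.
  have := @ravg_step (fun t => F (x + t *: e)) 0 1 K d (n + N)%N lip.
  rewrite modc1 mul1r mulr1 /half exprD [2^-1 ^+ n * _]mulrC mulrA; apply.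
  apply: le_trans N1; rewrite -[X in _ <= X]mulr1; apply: ler_wpM2l; first exact: ltW (half_gt0 R N).
  by apply: exprn_ile1; rewrite ?invr_ge0 //; lra.
by exists l; exact: tends_unshift hl.
Qed.

(** The integral of [F] over the segment from [x] to [x + e]. *)
Definition mean (F : V -> C) (x : V) : C := xget 0 [set l | tends (fun n => avg n F x) l].

Lemma mean_tends F x : (forall y, differentiable F y) -> tends (fun n => avg n F x) (mean F x).
Proof. by move=> dF; have [l hl] := avg_cvg x dF; exact: (xgetPex 0 (ex_intro _ l hl)). Qed.

Lemma mean_eq F x l : (forall y, differentiable F y) -> tends (fun n => avg n F x) l -> mean F x = l.
Proof. by move=> dF; apply: tends_uniq; exact: mean_tends. Qed.

Lemma mean_diff F : (forall y, differentiable F y) -> forall y, differentiable (mean F) y.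
Proof.
move=> dF y; have [rho [B [rho0 HB]]] := segment_bound y e dF.
apply: (@hol_limit R V (fun n => avg n F) (mean F) y rho B) => // [n x _|n x hx|x _].
- apply: (@ravg_diff R V n (fun x t => F (x + t *: e))) => s s01.
  change (differentiable (F \o (fun x => x + (0 + s%:C%C * 1) *: e)) x).
  by apply: differentiable_comp => //; exact: differentiableD.
- apply: ravg_bound => s s01; rewrite add0r mulr1; apply: (HB s) => //.
  by rewrite opprD addrACA subrr addr0.
- exact: mean_tends.
Qed.

Lemma meanD F G x : (forall y, differentiable F y) -> (forall y, differentiable G y) ->
  mean (fun x => F x + G x) x = mean F x + mean G x.
Proof.
move=> dF dG; apply: mean_eq => [y|]; first exact: differentiableD.
apply: tends_near (tendsD (mean_tends x dF) (mean_tends x dG)).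
by near=> n; rewrite /avg ravgD.
Unshelve. all: by end_near. Qed.

Lemma meanM F (c : V -> C) x : (forall y, differentiable F y) -> (forall y, differentiable c y) ->
  (forall (t : C) y, c (y + t *: e) = c y) ->
  mean (fun x => c x * F x) x = c x * mean F x.
Proof.
move=> dF dc hc; apply: mean_eq => [y|]; first exact: differentiableM.
apply: tends_near (tendsZ (c x) (mean_tends x dF)).
near=> n; rewrite /avg -ravgZ; congr (ravg n _ _ _); apply/funext => t.
by rewrite hc.
Unshelve. all: by end_near. Qed.

Lemma mean_shift F (v x : V) : mean (fun x => F (x + v)) x = mean F (x + v).
Proof.
rewrite /mean; congr (xget _ _); apply/seteqP; split => l /=; apply: tends_near;
  near=> n; rewrite /avg; congr (ravg n _ _ _); apply/funext => t; by rewrite addrAC.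
Unshelve. all: by end_near. Qed.

(** Cauchy's theorem: the mean over a period does not change under complex
    translations in the direction of the period. *)
Lemma mean_inv F : (forall y, differentiable F y) -> (forall y, F (y + e) = F y) ->
  forall x (c : C), mean F (x + c *: e) = mean F x.
Proof.
move=> dF per x c; apply: mean_eq => //.
pose f (t : C) := F (x + t *: e).
have fper t : f (t + 1) = f t by rewrite /f scalerDl scale1r addrA per.
have df (t : C) : differentiable f t by exact: line_diff.
have := @ravg_move R f 0 c fper (fun s t _ _ => df _).
move=> T; have := tendsB (mean_tends x dF) T; rewrite subr0; apply: tends_near.
near=> n; rewrite /avg -/f opprB addrCA subrr addr0 -[c in LHS]add0r -ravg_shift.
congr (ravg n _ _ _); apply/funext => t.
by rewrite /f scalerDl addrA addrAC.
Unshelve. all: by end_near. Qed.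
End Direction.

Section FourierUniqueness.
Variable f : C -> C.
Hypothesis per : forall x, f (x + 1) = f x.
Hypothesis df : forall x : C, differentiable f x.
Hypothesis coef0 : forall k : int,
  tends (fun n => ravg n (fun t => f t * cexp (- (t *~ k))) 0 1) 0.

Let coef0_at (k : int) (a : C) : tends (fun n => ravg n (fun t => f t * cexp (- (t *~ k))) a 1) 0.
Proof.
pose g t := f t * cexp (- (t *~ k)).
have gper x : g (x + 1) = g x.
  by rewrite /g per mulrzDl opprD cexpD (cexpN (1 *~ k)) cexp_Z invr1 mulr1.
have gd (x : C) : differentiable g x.
  apply: differentiableM => //.
  apply: cexp_comp_diff.
  have -> : (fun t : C => - (t *~ k)) = (fun t : C => - (k%:~R * t)) by apply/funext => t; rewrite mulrzl.
  by apply: differentiableN; apply: differentiableM.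
have := tendsB (coef0 k) (@ravg_move R g 0 a gper (fun s t _ _ => gd _)).
rewrite subr0; apply: tends_near; near=> n.
by rewrite -/g opprB addrCA subrr addr0.
Unshelve. all: by end_near. Qed.

(** A geometric series can be integrated term by term, since its remainder is
    uniformly small on the contour. *)
Let geom (g : C -> C) (a : C) (w : R) : 0 <= w < 1 ->
  (forall s : R, modc (g (a + s%:C%C * 1)) <= w) ->
  (forall k : nat, tends (fun n => ravg n (fun t => f t * g t ^+ k) a 1) 0) ->
  tends (fun n => ravg n (fun t => f t * (1 - g t)^-1) a 1) 0.
Proof.
move=> /andP[w0 w1] gw T.
have [rho [B [rho0 HB]]] := segment_bound a 1 df.
have fB (s : R) : 0 <= s <= 1 -> modc (f (a + s%:C%C * 1)) <= B.
  by move=> s01; apply: (HB s) => //; rewrite [s%:C%C *: _]/(s%:C%C * 1) subrr nrm0.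
have B0 : 0 <= B by apply: le_trans (fB 0 _); rewrite ?modc_ge0 // lexx ler01.
have w2 : 0 < 1 - w by lra.
have wn : `|w| < 1 by rewrite ger0_norm.
apply: tends_eps => e e0.
have e1 : 0 < e * (1 - w) / (B + 1) by rewrite divr_gt0 ?mulr_gt0 //; lra.
have /cvgrPdist_lt/(_ _ e1)[K _ /(_ K (leqnn K))] := cvg_expr wn.
rewrite sub0r normrN => hK.
have wK : w ^+ K < e * (1 - w) / (B + 1) by apply: le_lt_trans hK; exact: ler_norm.
exists (fun n => \sum_(k <- index_iota 0 K) ravg n (fun t => f t * g t ^+ k) a 1),
  (\sum_(k <- index_iota 0 K) 0); split.
- exact: (@tends_sum R nat (index_iota 0 K) _ (fun=> 0)).
- by rewrite big1 // subr0 modc0 ltW.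
near=> n; rewrite -ravg_sum -ravgB; apply: ravg_bound => s s01.
have gs := gw s; set x := a + _ in gs *.
have m1 : 1 - w <= modc (1 - g x).
  by have := modcD (1 - g x) (g x); rewrite subrK modc1; lra.
have g1 : 1 - g x != 0 by rewrite -modc_eq0; apply/eqP; lra.
have -> : f x * (1 - g x)^-1 - \sum_(k <- index_iota 0 K) f x * g x ^+ k
    = f x * (g x ^+ K / (1 - g x)).
  rewrite -mulr_sumr -mulrBr big_mkord; congr (_ * _).
  have := subrX1 (g x) K; set S := \sum_(i < K) _ => hS.
  have -> : g x ^+ K = 1 - (1 - g x) * S by rewrite -[g x - 1]opprB mulNr in hS; rewrite -[_ * S]opprK -hS; ring.
  by field.
rewrite modcM modcM modcV modcX.
have h1 : modc (g x) ^+ K <= w ^+ K by rewrite lerXn2r // nnegrE modc_ge0.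
have h2 : (modc (1 - g x))^-1 <= (1 - w)^-1 by rewrite lef_pV2 // posrE //; lra.
have i0 : 0 <= (modc (1 - g x))^-1 by rewrite invr_ge0 modc_ge0.
have k0 : 0 <= modc (g x) ^+ K by rewrite exprn_ge0 // modc_ge0.
apply: le_trans (_ : B * (w ^+ K / (1 - w)) <= _).
  by apply: ler_pM; rewrite ?modc_ge0 ?mulr_ge0 // ?fB //; apply: ler_pM.
rewrite mulrA ler_pdivrMr //.
move: wK; rewrite ltr_pdivlMr; last by lra.
have : 0 <= w ^+ K by rewrite exprn_ge0.
by move=> q0 q1; apply: le_trans (ltW q1); rewrite mulrDr mulr1 mulrC lerDl.
Unshelve. all: by end_near. Qed.

(** Fourier uniqueness: expand the kernel of Cauchy's formula in geometric
    series, below and above the point [z]. *)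
Lemma fourier_unique (z : C) : f z = 0.
Proof.
have p0 := pi_gt0 R.
pose w : R := expR (- (2 * pi)).
have w01 : 0 <= w < 1 by rewrite expR_ge0 expR_lt1 oppr_lt0 mulr_gt0.
pose a := z - Complex 0 1; pose b := z + Complex 0 1.
have ima : Im a = Im z - 1 by rewrite imB.
have imb : Im b = Im z + 1 by rewrite imD.
have y1 : Im z - 2 < Im a by rewrite ima; lra.
have y2 : Im a < Im z by rewrite ima; lra.
have y3 : Im z < Im b by rewrite imb; lra.
have T := @cauchy_strip R f (Im z - 2) z a b per (fun x _ => df x) y1 y2 y3.
have Ta : tends (fun n => ravg n (fun x => f x * ker z x) a 1) 0.
  apply: (@geom (fun x => cexp (z - x)) a w w01) => [s|k].
    rewrite modc_cexp imB imD mulr1 im_real ima /w ler_expR; lra.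
  have := tendsZ (cexp (z *+ k)) (coef0_at k a); rewrite mulr0; apply: tends_near.
  near=> n; rewrite -ravgZ; congr (ravg n _ _ _); apply/funext => x.
  by rewrite -cexp_nat mulrnBl cexpB -pmulrn cexpN; ring.
have Tb : tends (fun n => ravg n (fun x => f x * ker z x) b 1) 0.
  have T1 : tends (fun n => ravg n (fun x => f x * (1 - cexp (x - z))^-1) b 1) 0.
    apply: (@geom (fun x => cexp (x - z)) b w w01) => [s|k].
      rewrite modc_cexp imB imD mulr1 im_real imb /w ler_expR; lra.
    have := tendsZ (cexp (- (z *+ k))) (coef0_at (- k%:Z) b); rewrite mulr0; apply: tends_near.
    near=> n; rewrite -ravgZ; congr (ravg n _ _ _); apply/funext => x.
    by rewrite mulrNz opprK -pmulrn -cexp_nat mulrnBl cexpD; ring.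
  have T0 := coef0_at 0 b.
  have := tendsB T0 T1; rewrite subr0; apply: tends_near; near=> n.
  rewrite -ravgB; apply: ravg_ext => s s01; set x := b + _.
  rewrite mulr0z oppr0 cexp0 mulr1 /ker.
  have v1 : modc (cexp (x - z)) < 1.
    rewrite modc_cexp expR_lt1 /x imB imD mulr1 im_real imb; nra.
  rewrite -[z - x]opprB cexpN; have v0 := cexp_neq0 (x - z).
  set v := cexp _ in v0 v1 *.
  have v2 : 1 - v != 0.
    by apply: contraTneq v1 => /eqP; rewrite subr_eq0 => /eqP <-; rewrite modc1 ltxx.
  have v3 : v - 1 != 0 by rewrite -opprB oppr_eq0.
  by field; rewrite v0 v2 v3.
by have := tendsB Ta Tb; rewrite subrr => /(tends_uniq T).
Unshelve. all: by end_near. Qed.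
End FourierUniqueness.
End Mean.

(** * Fourier coefficients in several variables *)

Section Fourier.
Variable R : realType.
Local Notation C := (Cx R).
Local Notation cexp := (@cexp R).
Variable n : nat.
Local Notation vec := ('rV[C]_n).
Implicit Types (F G : vec -> C) (x v : vec) (k l : 'I_n -> int).

Definition ev (i : 'I_n) : vec := delta_mx 0 i.

Definition entire F := forall x, differentiable F x.

Definition torus_fun F := entire F /\ forall i x, F (x + ev i) = F x.

Definition dot k x : C := \sum_i x 0 i *~ k i.

Lemma dotD k x y : dot k (x + y) = dot k x + dot k y.
Proof. by rewrite /dot -big_split; apply: eq_bigr => i _; rewrite mxE mulrzDl. Qed.

Lemma dotZ k c x : dot k (c *: x) = c * dot k x.
Proof. by rewrite /dot mulr_sumr; apply: eq_bigr => i _; rewrite mxE mulrzAr. Qed.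

Lemma dot_ev k i : dot k (ev i) = (k i)%:~R.
Proof.
rewrite /dot (bigD1 i) //= big1 => [|j ji]; first by rewrite mxE !eqxx addr0.
by rewrite mxE eqxx (negPf ji) /= mul0rz.
Qed.

Lemma dot_diff k x : differentiable (dot k) x.
Proof.
have -> : dot k = \sum_(i < n) (fun x => (k i)%:~R * x 0 i).
  by apply/funext => y; rewrite /dot fct_sumE; apply: eq_bigr => i _; rewrite mulrzl.
apply: differentiable_sum => i; apply: differentiableM; first exact: differentiable_cst.
exact: differentiable_coord.
Qed.

Definition chr k x : C := cexp (- dot k x).

Lemma chr_diff k : entire (chr k).
Proof. by move=> x; apply: cexp_comp_diff; apply: differentiableN; exact: dot_diff. Qed.

Lemma chr_per k i x : chr k (x + ev i) = chr k x.
Proof. by rewrite /chr dotD dot_ev opprD cexpD (cexpN _%:~R) cexp_Z invr1 mulr1. Qed.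

Lemma torusM F G : torus_fun F -> torus_fun G -> torus_fun (fun x => F x * G x).
Proof.
move=> [dF pF] [dG pG]; split => [x|i x]; last by rewrite pF pG.
exact: differentiableM.
Qed.

Lemma torus_chr k : torus_fun (chr k).
Proof. by split; [exact: chr_diff|exact: chr_per]. Qed.

Lemma torus_cexp k : torus_fun (fun x => cexp (dot k x)).
Proof.
have := torus_chr (fun i => - k i); congr torus_fun; apply/funext => x.
by rewrite /chr; congr cexp; rewrite /dot -sumrN; apply: eq_bigr => i _; rewrite mulrNz opprK.
Qed.

Lemma torus_shift F v : torus_fun F -> torus_fun (fun x => F (x + v)).
Proof.
move=> [dF pF]; split => [x|i x]; last by rewrite addrAC pF.
change (differentiable (F \o (fun y => y + v)) x).
by apply: differentiable_comp; [exact: shift_diff|exact: dF].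
Qed.

Lemma torusD F G : torus_fun F -> torus_fun G -> torus_fun (fun x => F x + G x).
Proof.
move=> [dF pF] [dG pG]; split => [x|i x]; last by rewrite pF pG.
exact: differentiableD.
Qed.

Lemma torusZ c F : torus_fun F -> torus_fun (fun x => c * F x).
Proof. by apply: torusM; split => // x; exact: differentiable_cst. Qed.

(** Iterated integration; over all coordinate directions, this is the integral
    over a translate of the real torus. *)
Definition meanl (s : seq 'I_n) F := foldr (fun i G => mean (ev i) G) F s.

Lemma meanl_shift s F v : meanl s (fun x => F (x + v)) = fun x => meanl s F (x + v).
Proof.
elim: s => [|i s IH]; first by [].
by rewrite /= IH; apply/funext => x; rewrite mean_shift.
Qed.

Lemma meanl_torus s F : torus_fun F -> torus_fun (meanl s F).
Proof.
move=> [dF pF]; split.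
  by elim: s => //= i s IH; exact: mean_diff.
move=> i x; have := meanl_shift s F (ev i).
have -> : (fun x => F (x + ev i)) = F by apply/funext => y; exact: pF.
by move=> {2}->.
Qed.

Lemma meanl_inv s F i : torus_fun F -> i \in s -> forall (c : C) x,
  meanl s F (x + c *: ev i) = meanl s F x.
Proof.
move=> tF; elim: s => [|j s IH]; first by [].
rewrite inE => /orP[/eqP <-|iss] c x /=.
  by have [dG pG] := meanl_torus s tF; exact: mean_inv.
rewrite -mean_shift; congr (mean (ev j) _ x); apply/funext => y; exact: IH.
Qed.

(** The integral over a translate of the real torus does not depend on the
    translate, even if the translation is not real. *)
Lemma meanl_const F x v : torus_fun F -> meanl (enum 'I_n) F (x + v) = meanl (enum 'I_n) F x.
Proof.
move=> tF; rewrite (row_sum_delta v).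
elim/big_ind : _ x => [x|a b Ha Hb x|i _ x]; first by rewrite addr0.
  by rewrite addrA Hb Ha.
by apply: meanl_inv => //; rewrite mem_enum.
Qed.

Lemma meanl_M s F (psi : vec -> C) : entire F -> entire psi ->
  (forall i, i \in s -> forall (t : C) y, psi (y + t *: ev i) = psi y) ->
  meanl s (fun x => psi x * F x) = fun x => psi x * meanl s F x.
Proof.
move=> dF dpsi; elim: s => //= i s IH H.
rewrite IH; last by move=> j js; apply: H; rewrite inE js orbT.
apply/funext => x; rewrite meanM //; last by apply: H; rewrite inE eqxx.
by elim: s {IH H} => //= j s IH; exact: mean_diff.
Qed.

Lemma meanlD s F G : entire F -> entire G ->
  meanl s (fun x => F x + G x) = fun x => meanl s F x + meanl s G x.
Proof.
move=> dF dG; have D H : entire H -> forall s, entire (meanl s H).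
  by move=> dH; elim=> //= j s' IH; exact: mean_diff.
by elim: s => //= i s ->; apply/funext => x; rewrite meanD //; exact: D.
Qed.

(** The Fourier coefficient of index [k]. *)
Definition coef k F : C := meanl (enum 'I_n) (fun x => F x * chr k x) 0.

Lemma coefD k F G : torus_fun F -> torus_fun G ->
  coef k (fun x => F x + G x) = coef k F + coef k G.
Proof.
move=> tF tG; rewrite /coef.
have -> : (fun x => (F x + G x) * chr k x) = (fun x => F x * chr k x + G x * chr k x).
  by apply/funext => x; rewrite mulrDl.
by rewrite (meanlD _ (torusM tF (torus_chr k)).1 (torusM tG (torus_chr k)).1).
Qed.

Lemma coefZ k c F : torus_fun F -> coef k (fun x => c * F x) = c * coef k F.
Proof.
move=> tF; rewrite /coef.
have -> : (fun x => c * F x * chr k x) = (fun x => c * (F x * chr k x)).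
  by apply/funext => x; rewrite mulrA.
have dc : entire (fun=> c) by move=> x; exact: differentiable_cst.
by rewrite (@meanl_M _ _ (fun=> c) (torusM tF (torus_chr k)).1 dc).
Qed.

Lemma coef_sum k (I : Type) (s : seq I) (F : I -> vec -> C) :
  (forall i, torus_fun (F i)) ->
  coef k (fun x => \sum_(i <- s) F i x) = \sum_(i <- s) coef k (F i) /\
  torus_fun (fun x => \sum_(i <- s) F i x).
Proof.
move=> tF; elim: s => [|i s [IH tS]].
  have -> : (fun x => \sum_(i <- [::]) F i x) = (fun x => 0 * (0 : C)).
    by apply/funext => x; rewrite big_nil mulr0.
  have t0 : torus_fun (fun=> 0) by split => // x; exact: differentiable_cst.
  split; last by apply: torusZ.
  by rewrite (coefZ _ _ t0) mul0r big_nil.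
have -> : (fun x => \sum_(j <- i :: s) F j x) = (fun x => F i x + \sum_(j <- s) F j x).
  by apply/funext => x; rewrite big_cons.
split; last exact: torusD.
by rewrite coefD // IH big_cons.
Qed.

(** Complex translations act on the Fourier coefficients by characters: this
    turns the quasi-periodicity of theta functions into a recursion. *)
Lemma coef_shift k F v : torus_fun F -> coef k (fun x => F (x + v)) = cexp (dot k v) * coef k F.
Proof.
move=> tF; rewrite /coef; pose G x := F x * chr k x.
have tG : torus_fun G by apply: torusM => //; exact: torus_chr.
have -> : (fun x => F (x + v) * chr k x) = (fun x => cexp (dot k v) * G (x + v)).
  apply/funext => x; rewrite /G mulrCA; congr (_ * _).
  by rewrite /chr dotD -cexpD; congr cexp; ring.
have dc : entire (fun=> cexp (dot k v)) by move=> x; exact: differentiable_cst.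
rewrite (@meanl_M _ _ (fun=> cexp (dot k v)) (torus_shift v tG).1 dc); last by [].
by rewrite meanl_shift meanl_const.
Qed.

Lemma coef_mulchr k l F : coef k (fun x => cexp (dot l x) * F x) = coef (fun i => k i - l i) F.
Proof.
rewrite /coef; congr (meanl _ _ 0); apply/funext => x.
have -> : chr (fun i => k i - l i) x = cexp (dot l x) * chr k x; last by ring.
rewrite /chr -cexpD; congr cexp; rewrite /dot -!sumrN -big_split; apply: eq_bigr => i _ /=.
by rewrite mulrzBr opprB.
Qed.

(** The uniqueness theorem in one variable removes the outermost integral. *)
Lemma meanl_unique s F : uniq s -> torus_fun F ->
  (forall k x, meanl s (fun x => F x * cexp (- \sum_(i <- s) x 0 i *~ k i)) x = 0) ->
  forall x, F x = 0.
Proof.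
elim: s F => [|i s IH] F /=.
  by move=> _ _ H x; have := H (fun=> 0) x; rewrite big_nil oppr0 cexp0 mulr1.
move=> /andP[nis us] tF H; apply: (IH F us tF) => k x.
pose E k x : C := cexp (- \sum_(i <- s) x 0 i *~ k i).
have tE k' : torus_fun (E k').
  have -> : E k' = chr (fun j => if j \in s then k' j else 0); last exact: torus_chr.
  apply/funext => y; rewrite /E /chr /dot (big_uniq _ us) big_mkcond.
  by congr (cexp (- _)); apply: eq_bigr => j _; case: ifP; rewrite ?mulr0z.
pose G := meanl s (fun x => F x * E k x).
have tG : torus_fun G by apply/meanl_torus/torusM.
suff : forall t : C, G (x + t *: ev i) = 0 by move=> /(_ 0); rewrite scale0r addr0.
apply: fourier_unique => [t|t|m]; first by rewrite scalerDl scale1r addrA tG.2.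
  by apply: line_diff; exact: tG.1.
pose k' j := if j == i then m else k j.
have := H k' x.
have cEq : cexp (- (x 0 i *~ m)) * cexp (x 0 i *~ m) = 1 by rewrite -cexpD addNr cexp0.
pose ci (y : vec) : C := cexp (- (y 0 i *~ m)).
have dci : entire ci.
  have -> : ci = chr (fun j => if j == i then m else 0); last exact: chr_diff.
  apply/funext => y; rewrite /ci /chr /dot (bigD1 i) //= eqxx big1 ?addr0 //.
  by move=> j /negPf ->; rewrite mulr0z.
have -> : (fun y => F y * cexp (- \sum_(i0 <- i :: s) y 0 i0 *~ k' i0)) =
    (fun y => ci y * (F y * E k y)).
  apply/funext => y; rewrite big_cons {1}/k' eqxx opprD cexpD mulrCA; congr (_ * (_ * cexp (- _))).
  rewrite big_seq_cond [in RHS]big_seq_cond; apply: eq_bigr => j /andP[js _].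
  by rewrite /k'; case: eqP => // ji; rewrite -ji js in nis.
rewrite meanl_M; [|exact: (torusM tF (tE k)).1|exact: dci|]; last first.
  move=> j js t y; rewrite /ci !mxE eqxx /=.
  have -> : (i == j) = false by apply/eqP => ij; rewrite ij js in nis.
  by rewrite mulr0 addr0.
rewrite -/G => M0.
have dH : entire (fun y => ci y * G y) by move=> y; apply: differentiableM; [exact: dci|exact: tG.1].
have := tendsZ (cexp (x 0 i *~ m)) (mean_tends (ev i) x dH); rewrite M0 mulr0.
apply: tends_near; near=> N.
rewrite /avg -ravgZ; congr (ravg N _ _ _); apply/funext => t.
rewrite mulrA mulrC; congr (_ * _); rewrite /ci -cexpD; congr cexp.
by rewrite !mxE !eqxx mulr1 mulrzDl; ring.
Unshelve. all: by end_near. Qed.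

Lemma coef_unique F : torus_fun F -> (forall k, coef k F = 0) -> forall x, F x = 0.
Proof.
move=> tF H; apply: (@meanl_unique (enum 'I_n)) => //; first exact: enum_uniq.
move=> k x; have := H k; rewrite /coef.
have -> : (fun x => F x * cexp (- \sum_(i <- enum 'I_n) x 0 i *~ k i)) = (fun x => F x * chr k x).
  by apply/funext => y; rewrite /chr /dot big_enum.
have tG : torus_fun (fun x => F x * chr k x) by apply: torusM => //; exact: torus_chr.
by rewrite -[x]add0r meanl_const.
Qed.
End Fourier.

(** * Theta functions in several variables *)

Section ThetaFunctions.
Variable R : realType.
Local Notation C := (Cx R).
Local Notation cexp := (@cexp R).
Variables (n : nat) (tau : C) (M : 'I_n -> 'I_n -> int) (cf : 'I_n -> C).
Local Notation vec := ('rV[C]_n).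
Implicit Types (F G : vec -> C) (k l : 'I_n -> int).

(** Entire functions with the multipliers of a line bundle on the torus whose
    alternating form is given by the matrix [M]. *)
Definition theta_fun F := torus_fun F /\
  forall i x, F (x + tau *: ev R i) = cf i * cexp (- dot (M i) x) * F x.

Hypothesis cf0 : forall i, cf i != 0.
Hypothesis Msym : forall i j, M i j = M j i.

Definition row_mul l j : int := \sum_i l i * M i j.

Lemma theta_funZ a F : theta_fun F -> theta_fun (fun x => a * F x).
Proof. by move=> [tF qF]; split=> [|i x]; [exact: torusZ|rewrite qF; ring]. Qed.

Lemma theta_funB F G : theta_fun F -> theta_fun G -> theta_fun (fun x => F x + -1 * G x).
Proof.
move=> tF tG; split=> [|i x]; last by rewrite tF.2 tG.2; ring.
by apply: torusD; [exact: tF.1|exact: (torusZ _ tG.1)].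
Qed.

Lemma theta_fun_sum (I : Type) (s : seq I) (F : I -> vec -> C) (a : I -> C) :
  (forall i, theta_fun (F i)) -> theta_fun (fun x => \sum_(i <- s) a i * F i x).
Proof.
move=> tF; split.
  by have [_] := coef_sum (fun=> 0) s (fun i => torusZ (a i) (tF i).1).
move=> i x; rewrite mulr_sumr; apply: eq_bigr => j _.
by rewrite (tF j).2; ring.
Qed.

(** Comparing the coefficients on both sides of the quasi-periodicity in the
    direction [i] moves the index by the [i]-th row of [M]. *)
Lemma coef_act1 F k i : theta_fun F ->
  coef (fun j => k j + M i j) F = 0 <-> coef k F = 0.
Proof.
move=> [tF qF].
have E : (cf i) * coef (fun j => k j + M i j) F = cexp (dot k (tau *: ev R i)) * coef k F.
  rewrite -coef_shift //.
  have -> : (fun x => F (x + tau *: ev R i)) =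
      (fun x => cf i * (cexp (dot (fun j => - M i j) x) * F x)).
    apply/funext => x; rewrite qF -mulrA; congr (_ * (cexp _ * _)).
    by rewrite /dot -sumrN; apply: eq_bigr => j _; rewrite mulrNz.
  rewrite coefZ; last first.
    by apply: torusM; [exact: torus_cexp|exact: tF].
  rewrite coef_mulchr; congr (_ * coef _ _); apply/funext => j; by rewrite opprK.
split => h; move: E; rewrite h mulr0 => /eqP.
  by rewrite eq_sym mulf_eq0 (negPf (cexp_neq0 _)) => /eqP.
by rewrite mulf_eq0 (negPf (cf0 i)) => /eqP.
Qed.

Lemma coef_act F k l : theta_fun F ->
  coef (fun j => k j + row_mul l j) F = 0 <-> coef k F = 0.
Proof.
move=> tF.
have nat_step (p : nat) i k' : coef (fun j => k' j + p%:Z * M i j) F = 0 <-> coef k' F = 0.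
  elim: p => [|p IH].
    by have -> : (fun j => k' j + 0%:Z * M i j) = k' by apply/funext => j; rewrite mul0r addr0.
  apply: iff_trans IH; have := coef_act1 (fun j => k' j + p%:Z * M i j) i tF.
  have -> : (fun j => k' j + p%:Z * M i j + M i j) = (fun j => k' j + p.+1%:Z * M i j); last by [].
  by apply/funext => j; rewrite -addn1 PoszD mulrDl mul1r addrA.
have int_step (z : int) i k' : coef (fun j => k' j + z * M i j) F = 0 <-> coef k' F = 0.
  case: z => p; first exact: nat_step.
  have := nat_step p.+1 i (fun j => k' j + Negz p * M i j).
  have -> : (fun j => k' j + Negz p * M i j + p.+1%:Z * M i j) = k'.
    by apply/funext => j; rewrite NegzE mulNr addrNK.
  by move=> h; apply: iff_sym.
rewrite /row_mul; elim: (index_enum _) => [|i s IH].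
  have -> : (fun j => k j + \sum_(i <- [::]) l i * M i j) = k; last by [].
  by apply/funext => j; rewrite big_nil addr0.
apply: iff_trans IH.
have -> : (fun j => k j + \sum_(i <- i :: s) l i * M i j) =
    (fun j => k j + (\sum_(i <- s) l i * M i j) + l i * M i j); last exact: int_step.
by apply/funext => j; rewrite big_cons [l i * M i j + _]addrC addrA.
Qed.

Section Cyclic.
Variables (d : nat) (i0 i1 : 'I_n) (c l0 : 'I_n -> int).
Hypothesis d0 : (0 < d)%N.
Local Notation delta := (fun j : 'I_n => (j == i1)%:Z).
(* [c / d] and [l0 / d] are columns of the inverse of [M]. *)
Hypothesis Mc : forall i, \sum_j M i j * c j = d%:Z * (i == i0)%:Z.
Hypothesis c1 : c i1 = 1.
Hypothesis Ml0 : forall i, \sum_j M i j * l0 j = d%:Z * (i == i1)%:Z.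
(* The cokernel of [M] is cyclic, generated by the class of a basis vector. *)
Hypothesis gen : forall k, exists l (s : int), forall j, k j = row_mul l j + s * delta j.

(** The indices that represent the cokernel of [M]. *)
Definition mode (s : int) : 'I_n -> int := fun j => s * delta j.

Lemma coef_mode_mod F (s : int) : theta_fun F ->
  coef (mode s) F = 0 <-> coef (mode (s %% d)%Z) F = 0.
Proof.
move=> tF; have := coef_act (mode (s %% d)%Z) (fun i => (s %/ d)%Z * l0 i) tF.
have <- // : mode s = (fun j => mode (s %% d)%Z j + row_mul (fun i => (s %/ d)%Z * l0 i) j).
apply/funext => j; rewrite /mode /row_mul {1}(divz_eq s d).
have -> : \sum_i (s %/ d)%Z * l0 i * M i j = (s %/ d)%Z * (d%:Z * (j == i1)%:Z).
  by rewrite -Ml0 mulr_sumr; apply: eq_bigr => i _; rewrite (Msym i j); ring.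
by ring.
Qed.

(** Hence the dimension is at most [d]: by the recursion, all coefficients are
    governed by those of [d] representatives. *)
Lemma coef_mode_eq0 F : theta_fun F -> (forall t : 'I_d, coef (mode (t : nat)%:Z) F = 0) ->
  forall x, F x = 0.
Proof.
move=> tF H; apply: coef_unique => [|k]; first exact: tF.1.
have [l [s hk]] := gen k.
have -> : k = (fun j => mode s j + row_mul l j) by apply/funext => j; rewrite hk addrC.
apply/(coef_act _ _ tF)/(coef_mode_mod _ tF).
have dz : d%:Z != 0 by rewrite eqz_nat -lt0n.
have r0 := modz_ge0 s dz; have r1 := ltz_pmod s (_ : 0 < d%:Z).
case: (modz s d) r0 r1 => // r _ r1.
have rd : (r < d)%N by apply: r1; rewrite ltz_nat.
exact: (H (Ordinal rd)).
Qed.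

Let inv_d : (d%:R : C) != 0.
Proof. by rewrite pnatr_eq0 -lt0n. Qed.

Let scale (w : 'I_n -> int) : vec := \row_j ((w j)%:~R / d%:R).

Let dot_scale k (w : 'I_n -> int) : dot k (scale w) = (\sum_j k j * w j)%:~R / d%:R.
Proof.
rewrite /dot rmorph_sum mulr_suml; apply: eq_bigr => j _.
by rewrite mxE -mulrzl rmorphM; ring.
Qed.

(** The matrix [M] maps [c / d] to an integral vector, so this translation does
    not change the multipliers. *)
Lemma theta_translate F (t : nat) : theta_fun F -> theta_fun (fun x => F (x + scale c *+ t)).
Proof.
move=> [tF qF]; split; first exact: torus_shift.
move=> i x; rewrite addrAC qF dotD opprD cexpD.
have -> : cexp (- dot (M i) (scale c *+ t)) = 1; last by rewrite mulr1.
rewrite -scaler_nat dotZ dot_scale Mc cexpN.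
have -> : t%:R * ((d%:Z * (i == i0)%:Z)%:~R / d%:R) = (t%:Z * (i == i0)%:Z)%:~R :> C.
  by rewrite !rmorphM /= -!pmulrn; field.
by rewrite cexp_Z invr1.
Qed.

(** Averaging over the translations by multiples of [c / d] isolates one
    residue class of Fourier modes. *)
Lemma theta_project F (s : 'I_d) : theta_fun F -> exists2 G, theta_fun G &
  forall t : 'I_d, coef (mode (t : nat)%:Z) G = (t == s)%:R * coef (mode (t : nat)%:Z) F.
Proof.
move=> tF.
pose w : C := cexp (- ((s : nat)%:R / d%:R)).
exists (fun x => \sum_(r <- index_enum 'I_d) (d%:R^-1 * w ^+ r) * F (x + scale c *+ r)).
  by apply: theta_fun_sum => r; exact: theta_translate.
move=> t; have [-> _] := coef_sum (mode (t : nat)%:Z) (index_enum 'I_d)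
  (fun r => torusZ (d%:R^-1 * w ^+ r) (theta_translate r tF).1).
pose z : C := cexp (((t : nat)%:R - (s : nat)%:R) / d%:R).
have E (r : 'I_d) : coef (mode (t : nat)%:Z) (fun x => d%:R^-1 * w ^+ r * F (x + scale c *+ r)) =
    z ^+ r * (d%:R^-1 * coef (mode (t : nat)%:Z) F).
  rewrite coefZ; last exact: torus_shift tF.1.
  rewrite coef_shift; last exact: tF.1.
  have -> : z = w * cexp ((t : nat)%:R / d%:R).
    by rewrite /z /w -cexpD; congr cexp; field.
  rewrite -[scale c *+ _]scaler_nat dotZ dot_scale.
  have -> : \sum_j mode (t : nat)%:Z j * c j = (t : nat)%:Z.
    rewrite (bigD1 i1) //= big1 => [|j ji]; first by rewrite /mode eqxx mulr1 c1 mulr1 addr0.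
    by rewrite /mode (negPf ji) mulr0 mul0r.
  by rewrite mulr_natl cexp_nat -pmulrn exprMn; ring.
rewrite (eq_bigr _ (fun r _ => E r)) -mulr_suml.
have [ts|ts] := eqVneq t s.
  have z1 : z = 1 by rewrite /z ts subrr mul0r cexp0.
  have -> : \sum_(r <- index_enum 'I_d) z ^+ r = d%:R.
    rewrite z1 (eq_bigr (fun=> 1)) => [|r _]; last by rewrite expr1n.
    by rewrite sumr_const card_ord.
  by rewrite mul1r mulrA divff ?mul1r.
rewrite mul0r; apply/eqP; rewrite mulf_eq0; apply/orP; left.
have z1 : z != 1.
  apply/eqP => /cexp_eq1[k hk].
  have : (t : nat)%:Z - (s : nat)%:Z = k * d%:Z.
    apply: (@intr_inj C); rewrite rmorphB rmorphM /= -!pmulrn -hk; field; exact: inv_d.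
  have := ltn_ord t; have := ltn_ord s; move: ts; rewrite -val_eqE /= => ts ss tt hh.
  have [k0|k0] := eqVneq k 0; first by move: hh; rewrite k0 mul0r => hh; lia.
  by have [k1|k1] := leP k 0; nia.
have zd : z ^+ d = 1.
  rewrite /z -cexp_nat -[X in cexp X]mulr_natr divfK //.
  by have := @cexp_Z R ((t : nat)%:Z - (s : nat)%:Z); rewrite rmorphB /= -!pmulrn.
have := subrX1 z d; rewrite zd subrr => /esym/eqP; rewrite mulf_eq0 subr_eq0 (negPf z1).
by [].
Qed.

(** The dual translation, by [tau * l0 / d], shifts the Fourier modes. *)
Lemma theta_raise F : theta_fun F -> exists2 G, theta_fun G &
  forall s : int, coef (mode (s + 1)) G = 0 <-> coef (mode s) F = 0.
Proof.
move=> [tF qF]; pose u := tau *: scale l0.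
have dx (x : vec) : x 0 i1 = dot (mode 1) x.
  rewrite /dot (bigD1 i1) //= big1 => [|j ji]; first by rewrite /mode eqxx mulr1 addr0.
  by rewrite /mode (negPf ji) mulr0 mulr0z.
exists (fun x => cexp (dot (mode 1) x) * F (x + u)).
  split.
    by apply: torusM; [exact: torus_cexp|exact: torus_shift].
  move=> i x; rewrite addrAC qF !dotD !dotZ dot_ev dot_scale Ml0 opprD !cexpD.
  have -> : cexp (- (tau * ((d%:Z * (i == i1)%:Z)%:~R / d%:R))) = (cexp (tau * (mode 1 i)%:~R))^-1.
    rewrite -cexpN; congr (cexp (- (_ * _))).
    by rewrite /mode mul1r rmorphM /= -!pmulrn; field.
  have := cexp_neq0 (tau * (mode 1 i)%:~R); set a := cexp (tau * _) => a0.
  by field.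
move=> s; rewrite coef_mulchr.
have -> : (fun i => mode (s + 1) i - mode 1 i) = mode s by apply/funext => j; rewrite /mode; ring.
rewrite coef_shift //; split => [/eqP|->]; last by rewrite mulr0.
by rewrite mulf_eq0 (negPf (cexp_neq0 _)) => /eqP.
Qed.

(** Some mode of [F0] is nonzero, and [theta_raise] carries it to all others. *)
Lemma theta_mode_surj F0 x0 : theta_fun F0 -> F0 x0 != 0 ->
  forall r : 'I_d, exists2 G, theta_fun G & coef (mode (r : nat)%:Z) G != 0.
Proof.
move=> t0 F00 r.
have [s hs] : exists s : 'I_d, coef (mode (s : nat)%:Z) F0 != 0.
  apply: contrapT => H; move/negP: F00; apply; apply/eqP.
  apply: coef_mode_eq0 => // t; apply/eqP; apply: contrapT => /negP h.
  by apply: H; exists t.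
have raise (p : nat) : exists2 G, theta_fun G & coef (mode (s%:Z + p%:Z)) G != 0.
  elim: p => [|p [G tG hG]]; first by exists F0 => //; rewrite addr0.
  have [G' tG' hG'] := theta_raise tG; exists G' => //.
  have -> : s%:Z + p.+1%:Z = s%:Z + p%:Z + 1 by lia.
  by apply/eqP => /hG'/eqP; rewrite (negPf hG).
have [G tG hG] := raise (r + d - s)%N; exists G => //.
apply/eqP => h; move/negP: hG; apply; apply/eqP/(coef_mode_mod _ tG).
have := ltn_ord s; have := ltn_ord r => rd sd.
have -> : s%:Z + (r + d - s)%N%:Z = (r : nat)%:Z + d%:Z by lia.
by rewrite modzDr modz_small //; apply/andP; split; lia.
Qed.

(** Hence a single nonzero theta function suffices for the dimension to be at
    least [d]. *)
Lemma theta_basis F0 x0 : theta_fun F0 -> F0 x0 != 0 ->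
  exists b : 'I_d -> vec -> C, (forall s, theta_fun (b s)) /\
    forall s t : 'I_d, coef (mode (t : nat)%:Z) (b s) = (t == s)%:R.
Proof.
move=> t0 F00.
have H (s : 'I_d) : exists G, theta_fun G /\ forall t : 'I_d, coef (mode (t : nat)%:Z) G = (t == s)%:R.
  have [G tG hG] := theta_mode_surj t0 F00 s.
  have [G' tG' hG'] := theta_project s tG.
  set a := coef _ G in hG.
  exists (fun x => a^-1 * G' x); split=> [|t]; first exact: theta_funZ.
  rewrite coefZ; last exact: tG'.1.
  rewrite hG'; case: eqP => [->|_]; last by rewrite mul0r mulr0.
  by rewrite mul1r -/a mulVf.
by have [b hb] := choice H; exists b; split=> s; have [] := hb s.
Qed.
End Cyclic.
End ThetaFunctions.

(** * Sections as quotients of entire functions *)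

Lemma near_all (V : topologicalType) (T : eqType) (s : seq T) (Q : T -> V -> Prop) (a : V) :
  (forall b, b \in s -> \forall x \near a, Q b x) ->
  \forall x \near a, forall b, b \in s -> Q b x.
Proof.
elim: s => [|b r IH] hQ; first by near=> x => b; rewrite in_nil.
have h1 := hQ b (mem_head _ _).
have h2 : \forall x \near a, forall b', b' \in r -> Q b' x.
  by apply: IH => b' br; apply: hQ; rewrite inE br orbT.
refine (filterS _ (filterI h1 h2)) => x [k1 k2] b'; rewrite inE => /orP[/eqP ->//|]; exact: k2.
Unshelve. all: by end_near. Qed.

(** Two local equations of the same hypersurface differ by a holomorphic factor,
    since both generate its ideal. *)
Lemma local_ratio (R : realType) n (Z : set 'rV[Cx R]_n) a (h1 h2 : 'rV[Cx R]_n -> Cx R) :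
  local_equation Z a h1 -> local_equation Z a h2 ->
  exists2 p, holomorphic_near p a & \forall x \near a, h2 x = p x * h1 x.
Proof.
move=> [_ _ ideal] [d2 z2 _]; apply: ideal => //.
by move: z2; apply: filterS => x hx hx'; apply/hx.
Qed.

Section Terms.
Variables (R : realType) (L : zmodClosed (Cx R)) (n : nat).
Local Notation C := (Cx R).
Local Notation vec := ('rV[C]_n).
Variables (T : choiceType) (s : seq T) (c : T -> nat) (H : T -> set (ellpow L n)).
Variables (t : T -> vec -> C) (D : divisor L n) (v : vec).
Hypothesis c0 : forall a, a \in s -> (0 < c a)%N.
Hypothesis hD : D = \sum_(a <- s) << (c a)%:Z *g H a >>.
Hypothesis hH : forall a (x : vec), local_equation (@covering R L n @^-1` H a) x (t a).
Hypothesis ht0 : forall a (x : vec), exists2 d : R, 0 < d & forall z, 0 < modc z < d -> t a (x + z *: v) != 0.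

Lemma coeff_terms X : coeff X D = (\sum_(a <- s) c a * (H a == X))%:Z.
Proof.
rewrite hD raddf_sum /= (big_morph Posz PoszD (erefl _)); apply: eq_bigr => a _.
by rewrite coeffU PoszM natz.
Qed.

Lemma dom_terms a : a \in s -> H a \in dom D.
Proof.
move=> sa; rewrite mem_dom coeff_terms eqz_nat -lt0n.
by rewrite (big_rem a sa) /= eqxx muln1 addn_gt0 c0.
Qed.

Lemma terms_dom X : X \in dom D -> exists2 a, a \in s & H a = X.
Proof.
rewrite mem_dom coeff_terms eqz_nat; apply: contraNP => hX.
rewrite big_seq big1 // => a sa; case: eqP => [E|]; last by rewrite muln0.
by case: hX; exists a.
Qed.

(** The exponent of a component is the sum of the multiplicities of its terms, so
    there is no need to know which terms have the same component. *)
Lemma prod_terms (h : set (ellpow L n) -> C) :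
  \prod_(X <- dom D) h X ^ coeff X D = \prod_(a <- s) h (H a) ^+ c a.
Proof.
pose S := undup (map H s).
have uS : uniq S by exact: undup_uniq.
have -> : \prod_(X <- dom D) h X ^ coeff X D = \prod_(X <- S) h X ^ coeff X D.
  rewrite [RHS](bigID [in dom D]) /= [X in _ * X]big1 ?mulr1 => [|X].
    rewrite -[in RHS]big_filter; apply: perm_big; apply: uniq_perm.
    - exact: uniq_dom.
    - exact: filter_uniq.
    move=> X; rewrite mem_filter; apply/idP/andP => [hX|[]//]; split=> //.
    by rewrite mem_undup; have [a sa <-] := terms_dom hX; exact: map_f.
  by move=> /coeff_outdom ->.
have E X : h X ^ coeff X D = \prod_(a <- s) h X ^+ (c a * (H a == X)).
  by rewrite coeff_terms -exprnP prodrXr.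
rewrite (eq_bigr _ (fun X _ => E X)) exchange_big /= big_seq [RHS]big_seq.
apply: eq_bigr => a sa.
have aS : H a \in S by rewrite mem_undup map_f.
rewrite (bigD1_seq (H a)) //= eqxx muln1 big1 ?mulr1 // => X.
by rewrite eq_sym => /negPf ->; rewrite muln0.
Qed.

(** A global equation of the divisor on the universal covering. *)
Definition bigtheta (x : vec) : C := \prod_(a <- s) t a x ^+ c a.

Lemma prod_diff (I : eqType) (r : seq I) (g : I -> vec -> C) (k : I -> nat) (x : vec) :
  (forall i, i \in r -> differentiable (g i) x) ->
  differentiable (fun y => \prod_(i <- r) g i y ^+ k i) x.
Proof.
have powd (f : vec -> C) p : differentiable f x -> differentiable (fun y => f y ^+ p) x.
  move=> df; elim: p => [|p IH].
    have -> : (fun y => f y ^+ 0) = cst 1 by apply/funext => y; rewrite expr0.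
    exact: differentiable_cst.
  have -> : (fun y => f y ^+ p.+1) = (fun y => f y * f y ^+ p) by apply/funext => y; rewrite exprS.
  exact: differentiableM.
elim: r => [|i r IH] hg.
  have -> : (fun y => \prod_(i <- [::]) g i y ^+ k i) = cst 1 by apply/funext => y; rewrite big_nil.
  exact: differentiable_cst.
have -> : (fun y => \prod_(j <- i :: r) g j y ^+ k j) = (fun y => g i y ^+ k i * \prod_(j <- r) g j y ^+ k j).
  by apply/funext => y; rewrite big_cons.
apply: differentiableM; first by apply: powd; apply: hg; rewrite mem_head.
by apply: IH => j jr; apply: hg; rewrite inE jr orbT.
Qed.


Lemma prod_ratio a (h1 h2 : T -> vec -> C) :
  (forall b, b \in s -> exists2 p, holomorphic_near p a & \forall x \near a, h1 b x = p x * h2 b x) ->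
  exists2 P, holomorphic_near P a &
    \forall x \near a, \prod_(b <- s) h1 b x ^+ c b = P x * \prod_(b <- s) h2 b x ^+ c b.
Proof.
move=> H12; have [p hp] : exists p : T -> vec -> C, forall b, b \in s ->
    holomorphic_near (p b) a /\ \forall x \near a, h1 b x = p b x * h2 b x.
  suff : forall b, exists q : vec -> C, b \in s ->
      holomorphic_near q a /\ \forall x \near a, h1 b x = q x * h2 b x.
    by move=> /choice[p hp]; exists p.
  move=> b; have [bs|] := pselect (b \in s); last by exists (fun=> 0).
  by have [q dq hq] := H12 b bs; exists q.
exists (fun x => \prod_(b <- s) p b x ^+ c b).
  have h := near_all (fun b bs => (hp b bs).1).
  by apply: filterS h => x k; apply: prod_diff => b bs; exact: k.
have h := near_all (fun b bs => (hp b bs).2).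
apply: filterS h => x k; rewrite -big_split big_seq [RHS]big_seq.
by apply: eq_bigr => b bs; rewrite (k b bs) exprMn.
Qed.

Lemma support_terms x : Defs.support D (covering L x) <-> bigtheta x = 0.
Proof.
have hz a y : H a (covering L y) <-> t a y = 0.
  by have [_ /nbhs_singleton] := hH a y.
split=> [[X /terms_dom[a sa <-]] /hz h|/eqP].
  by rewrite /bigtheta (big_rem a sa) /= h expr0n gtn_eqF ?c0 // mul0r.
rewrite /bigtheta prodf_seq_eq0 => /hasP[a sa /=].
rewrite expf_eq0 c0 //= => /eqP /hz h.
by exists (H a) => //; exact: dom_terms.
Qed.

(** The direction [v] is transversal to all components at once. *)
Lemma bigtheta_dense (P : vec -> Prop) (x : vec) : (\forall y \near x, P y) ->
  forall e : R, 0 < e -> exists2 y : vec, nrm (y - x) < e & P y /\ bigtheta y != 0.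
Proof.
move=> /nearE_nrm[d d0 Hd] e e0.
have [d' d'0 Hd'] : exists2 d' : R, 0 < d' & forall z, 0 < modc z < d' -> bigtheta (x + z *: v) != 0.
  rewrite /bigtheta; elim: s => [|a r [d1 d10 H1]].
    by exists 1 => // z _; rewrite big_nil oner_eq0.
  have [d2 d20 H2] := ht0 a x; exists (Num.min d1 d2); first by rewrite lt_min d10.
  move=> z; rewrite lt_min => /andP[z0 /andP[z1 z2]].
  by rewrite big_cons mulf_neq0 ?expf_neq0 ?H1 ?H2 ?z0.
have v1 : 0 < nrm v + 1 by have := nrm_ge0 v; lra.
pose m := Num.min (Num.min d e / (nrm v + 1)) d' / 2.
have m0 : 0 < m by rewrite divr_gt0 // lt_min d'0 divr_gt0 // lt_min d0.
have m1 : m < Num.min (Num.min d e / (nrm v + 1)) d'.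
  by rewrite ltr_pdivrMr // ltr_pMr ?ltr1n // lt_min d'0 divr_gt0 // lt_min d0.
move: m1; rewrite lt_min ltr_pdivlMr // lt_min => /andP[/andP[m1 m2] m3].
have mz : modc (m%:C%C : C) = m by rewrite modc_real gtr0_norm.
have mv : m * nrm v <= m * (nrm v + 1) by rewrite ler_pM2l //; lra.
have nE : nrm (x + (m%:C%C : C) *: v - x) = m * nrm v by rewrite addrAC subrr add0r nrmZ mz.
exists (x + (m%:C%C : C) *: v); first by rewrite nE; lra.
by split; [apply: Hd; rewrite nE; lra|apply: Hd'; rewrite mz m0].
Qed.

Lemma bigtheta_unique (F G : vec -> C) (x : vec) : differentiable F x -> differentiable G x ->
  (\forall y \near x, bigtheta y != 0 -> F y = G y) -> F x = G x.
Proof.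
move=> dF dG FG; apply/eqP; rewrite -subr_eq0 -modc_eq0 eq_le modc_ge0 andbT.
apply/ler_addgt0Pr => e e0; rewrite add0r.
have e2 : 0 < e / 2 by lra.
have [d1 d10 H1] := diff_cont dF e2; have [d2 d20 H2] := diff_cont dG e2.
have [|y hy [yFG y0]] := bigtheta_dense FG (_ : 0 < Num.min d1 d2); first by rewrite lt_min d10.
move: hy; rewrite lt_min => /andP[h1 h2].
have := H1 _ h1; have := H2 _ h2; rewrite [x + (y - x)]addrC subrK (yFG y0) => k2 k1.
have := modcB (G y - G x) (G y - F x).
have -> : G y - G x - (G y - F x) = F x - G x by ring.
lra.
Qed.

(** Multiplication by [bigtheta] turns sections into entire functions: the local
    equations in the definition of sections can be replaced by the global ones,
    and the local extensions glue because the complement of the divisor is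
    dense. *)
Lemma H0_terms (f : ellpow L n -> C) : H0 D f <->
  (forall x, Defs.support D x -> f x = 0) /\
  exists2 F : vec -> C, (forall x, differentiable F x) &
    forall x, bigtheta x != 0 -> f (covering L x) * bigtheta x = F x.
Proof.
have suppN x : bigtheta x != 0 <-> ~ Defs.support D (covering L x).
  by rewrite (support_terms x); split=> /eqP.
split=> [[f0 hf]|[f0 [F dF hF]]]; split=> //.
- have loc (a : vec) : exists G : vec -> C, (\forall x \near a, differentiable G x) /\
      \forall x \near a, bigtheta x != 0 -> f (covering L x) * bigtheta x = G x.
    have [h [hh [u du hu]]] := hf a.
    have [|P dP hP] := @prod_ratio a t (fun b => h (H b)).
      by move=> b bs; apply: local_ratio (hh _ (dom_terms bs)) (hH b a).
    exists (fun x => u x * P x); split.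
      refine (filterS _ (filterI du dP)) => x [k1 k2]; exact: differentiableM.
    refine (filterS _ (filterI hu hP)) => x [k1 k2] x0.
    rewrite -(k1 (proj1 (suppN x) x0)) -mulrA; congr (_ * _).
    by rewrite prod_terms mulrC -k2.
  have [G hG] := choice loc.
  pose F x := G x x.
  have FG a : \forall x \near a, F x = G a x.
    have [dG eG] := hG a.
    have eG' := nbhs_interior eG.
    refine (filterS _ (filterI dG eG')) => x [k1 k2].
    apply: (@bigtheta_unique (G x) (G a) x) => //; first exact: nbhs_singleton (hG x).1.
    refine (filterS _ (filterI (hG x).2 k2)) => y [j1 j2] y0.
    by rewrite -(j1 y0) -(j2 y0).
  exists F => [a|x x0].
    apply: (@diff_ext _ _ (G a)); last exact: nbhs_singleton (hG a).1.
    by move: (FG a); apply: filterS => x ->.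
  by have := nbhs_singleton (hG x).2; apply.
move=> a.
have [sel hsel] : exists sel : set (ellpow L n) -> option T, forall X, X \in dom D ->
    exists2 b, sel X = Some b & b \in s /\ H b = X.
  suff : forall X, exists o : option T, X \in dom D -> exists2 b, o = Some b & b \in s /\ H b = X.
    by move=> /choice[sel hs]; exists sel.
  move=> X; have [/terms_dom[b bs <-]|] := pselect (X \in dom D); last by exists None.
  by exists (Some b) => _; exists b.
pose h X := if sel X is Some b then t b else fun=> 1.
have hloc X : X \in dom D -> local_equation (@covering R L n @^-1` X) a (h X).
  by move=> /hsel[b sb [bs E]]; rewrite /h sb -E; exact: hH.
exists h; split=> //.
have [|P dP hP] := @prod_ratio a (fun b => h (H b)) t.
  by move=> b bs; apply: local_ratio (hH b a) (hloc _ (dom_terms bs)).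
exists (fun x => F x * P x).
  apply: filterS dP => x k; exact: differentiableM.
apply: filterS hP => x k xs.
rewrite -(hF x (proj2 (suppN x) xs)) -mulrA; congr (_ * _).
by rewrite prod_terms mulrC -k.
Qed.
End Terms.

(** * The dimension of the space of sections *)

Section Lattice.
Variables (R : realType) (L : zmodClosed (Cx R)).
Local Notation C := (Cx R).
Local Notation Im := complex.Im.

(** The sign of the second generator can be chosen so that the quotient lies in
    the upper half plane. *)
Lemma lattice_normal : is_lattice L -> exists w tau : C,
  [/\ w != 0, 0 < Im tau & forall z, z \in L <-> exists p q : int, z = w * (p%:~R + tau *~ q)].
Proof.
move=> [w1 [w2 [ind hL]]].
have w10 : w1 != 0.
  apply/eqP => w0; have h : (1 : R)%:C%C * w1 + (0 : R)%:C%C * w2 = 0.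
    by rewrite w0 mulr0 rmorph0 mul0r addr0.
  by have [/eqP] := ind 1 0 h; rewrite oner_eq0.
have Im0 : Im (w2 / w1) != 0.
  apply/eqP => I0.
  have E : w2 = (complex.Re (w2 / w1))%:C%C * w1.
    have -> : (complex.Re (w2 / w1))%:C%C = w2 / w1.
      by rewrite [RHS]complexE I0 mulr0 addr0.
    by rewrite divfK.
  have h : (- complex.Re (w2 / w1))%:C%C * w1 + (1 : R)%:C%C * w2 = 0.
    by rewrite rmorphN mulNr -E rmorph1 mul1r addNr.
  by have [_ /eqP] := ind (- complex.Re (w2 / w1)) 1 h; rewrite oner_eq0.
have mk (p q : int) t : w1 *~ p + (w1 * t) *~ q = w1 * (p%:~R + t *~ q).
  by rewrite mulrDr mulrzr mulrzAr.
have [t0|t0] := ltP 0 (Im (w2 / w1)).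
  exists w1, (w2 / w1); split=> // z; rewrite hL; split=> -[p [q ->]]; exists p, q.
    by rewrite -mk [w1 * _]mulrC divfK.
  by rewrite -mk [w1 * _]mulrC divfK.
exists w1, (- (w2 / w1)); split=> // [|z].
  by rewrite raddfN /= oppr_gt0 lt_neqAle Im0.
have E (p q : int) : w1 *~ p + w2 *~ q = w1 * (p%:~R + - (w2 / w1) *~ (- q)).
  by rewrite -mk mulrN [w1 * _]mulrC divfK // mulrNz mulNrz opprK.
rewrite hL; split=> -[p [q ->]]; exists p, (- q); first exact: E.
by rewrite E opprK.
Qed.

Lemma covering_eq n (x y : 'rV[C]_n) :
  covering L x = covering L y <-> forall i, x 0 i - y 0 i \in L.
Proof.
split=> [/rowP h i|h].
  by have := h i; rewrite !mxE Quotient.idealrBE => /eqP.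
by apply/rowP => i; rewrite !mxE; apply/eqP; rewrite -Quotient.idealrBE.
Qed.

Definition ell_lift n (y : ellpow L n) : 'rV[C]_n := map_mx repr y.

Lemma ell_liftK n (y : ellpow L n) : covering L (ell_lift y) = y.
Proof. by apply/rowP => i; rewrite !mxE reprK. Qed.
End Lattice.

Section Sections.
Variables (R : realType) (L : zmodClosed (Cx R)) (n : nat).
Local Notation C := (Cx R).
Local Notation Im := complex.Im.
Local Notation cexp := (@cexp R).
Local Notation vec := ('rV[C]_n).
Variables (w tau : C).
Hypothesis w0 : w != 0.
Hypothesis tau0 : 0 < Im tau.
Hypothesis hL : forall z, z \in L <-> exists p q : int, z = w * (p%:~R + tau *~ q).

Variables (T : choiceType) (s : seq T) (c : T -> nat) (H : T -> set (ellpow L n)).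
Variables (D : divisor L n) (v : vec) (lam : T -> 'I_n -> int) (beta : T -> C).
Hypothesis c0 : forall a, a \in s -> (0 < c a)%N.
Hypothesis hD : D = \sum_(a <- s) << (c a)%:Z *g H a >>.
Hypothesis hH : forall a x, H a (covering L x) <-> dot (lam a) x - beta a \in L.
Hypothesis lam_prim : forall a, exists u : vec, dot (lam a) u = 1.
Hypothesis lam_v : forall a, dot (lam a) v != 0.

Let t (a : T) (x : vec) : C := theta tau ((dot (lam a) x - beta a) / w).

Let arg_diff a (x : vec) : differentiable (fun x : vec => (dot (lam a) x - beta a) / w) x.
Proof.
apply: differentiableM; last exact: differentiable_cst.
by apply: differentiableB; [exact: dot_diff|exact: differentiable_cst].
Qed.

Let t_diff a (x : vec) : differentiable (t a) x.
Proof.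
change (differentiable (theta tau \o (fun x : vec => (dot (lam a) x - beta a) / w)) x).
by apply: differentiable_comp; [exact: arg_diff|exact: theta_diff].
Qed.

Let t_zero a x : H a (covering L x) <-> t a x = 0.
Proof.
apply: (iff_trans (hH a x)); apply: (iff_trans (hL _)).
apply: iff_trans (iff_sym (theta_eq0 tau0 _)).
split=> -[p [q h]]; exists p, q; first by rewrite h mulrC mulKf.
by rewrite -h mulrC divfK.
Qed.

Lemma theta_isolated (z0 : C) : exists2 d : R, 0 < d &
  forall z, 0 < modc (z - z0) < d -> theta tau z != 0.
Proof.
have [z00|z00] := eqVneq (theta tau z0) 0.
  have [u du Hu] := theta_simple tau0 z00.
  have /nearE_nrm[d d0 Hd] : \forall z \near z0, (differentiable u z /\ u z != 0) /\ theta tau z = (z - z0) * u z.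
    exact: filterI.
  exists d => // z /andP[h1 h2]; have [[_ uz] ->] := Hd z h2.
  by rewrite mulf_neq0 // -modc_eq0 gt_eqF.
have /nearE_nrm[d d0 Hd] := diff_neq0 (theta_diff tau0 z0) z00.
by exists d => // z /andP[_ h]; exact: Hd.
Qed.

Let t_isolated a (x : vec) : exists2 d : R, 0 < d &
  forall z, 0 < modc z < d -> t a (x + z *: v) != 0.
Proof.
set k := dot (lam a) v / w.
have kn : k != 0 by rewrite mulf_neq0 ?invr_eq0 ?lam_v.
have k0 : 0 < modc k by rewrite modc_gt0.
have [d d0 Hd] := theta_isolated ((dot (lam a) x - beta a) / w).
exists (d / modc k); first by rewrite divr_gt0.
move=> z /andP[z0 z1]; apply: Hd.
have -> : (dot (lam a) (x + z *: v) - beta a) / w - (dot (lam a) x - beta a) / w = z * k.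
  by rewrite dotD dotZ /k; ring.
by rewrite modcM mulr_gt0 //= -ltr_pdivlMr.
Qed.

(** [t a] generates the ideal of its hypersurface: its zeros are simple and the
    hypersurface is locally a level set of a linear form. *)
Let t_local a (x : vec) : local_equation (@covering R L n @^-1` H a) x (t a).
Proof.
split.
- by near=> y; exact: t_diff.
- by near=> y; exact: t_zero.
move=> phi dphi phi0.
have [tx|tx] := eqVneq (t a x) 0; last first.
  have tnear := diff_neq0 (t_diff a x) tx.
  exists (fun y => phi y * (t a y)^-1); last by apply: filterS tnear => y ty; rewrite divfK.
  refine (filterS _ (filterI dphi tnear)) => y [h1 h2].
  apply: differentiableM; first exact: h1.
  by apply: differentiableV; [exact: t_diff|exact: h2].
have dlin : linear (dot (lam a) : vec -> C).
  by move=> k y z; rewrite dotD dotZ.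
pose LM := GRing.isLinear.Build _ _ _ _ _ dlin.
pose ell : {linear vec -> C} := HB.pack (dot (lam a) : vec -> C) LM.
have ellc : continuous ell by move=> y; apply: differentiable_continuous; exact: dot_diff.
have [e1 he1] := lam_prim a.
have phi1 : \forall y \near x, ell y = ell x -> phi y = 0.
  apply: filterS phi0 => y h E; apply: h; apply/t_zero.
  by rewrite /t -[dot _ y]/(ell y) E -[ell x]/(dot (lam a) x).
have [psi dpsi Hpsi] := hol_divide (l := ell) (v := e1) ellc he1 dphi phi1.
have [u du Hu] := theta_simple tau0 tx.
pose g (y : vec) := (dot (lam a) y - beta a) / w.
have gc : g @ x --> g x by apply: differentiable_continuous; exact: arg_diff.
have du' : \forall y \near x, differentiable u (g y) /\ u (g y) != 0 by exact: gc _ du.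
have Hu' : \forall y \near x, theta tau (g y) = (g y - g x) * u (g y) by exact: gc _ Hu.
exists (fun y => psi y * (w * (u (g y))^-1)).
  refine (filterS _ (filterI dpsi du')) => y [h1 [h2 h3]].
  apply: differentiableM; first exact: h1.
  apply: differentiableM; first exact: differentiable_cst.
  apply: differentiableV; last exact: h3.
  change (differentiable (u \o g) y); apply: differentiable_comp; [exact: arg_diff|exact: h2].
refine (filterS _ (filterI Hpsi (filterI du' Hu'))) => y [h1 [[_ h2] h3]].
rewrite h1 /t -/(g y) h3 -[ell y]/(dot (lam a) y) -[ell x]/(dot (lam a) x).
have -> : g y - g x = (dot (lam a) y - dot (lam a) x) / w by rewrite /g; ring.
by field; rewrite h2 w0.
Unshelve. all: by end_near. Qed.

Local Notation Th := (bigtheta s c t).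

(** The first Chern class of the divisor, as a symmetric matrix: a component
    contributes the square of its linear form. *)
Definition form_mx i j : int := \sum_(a <- s) (c a)%:Z * (lam a i * lam a j).

Let Tht (y : vec) : C := Th (w *: y).

Let tE a (y : vec) : t a (w *: y) = theta tau (dot (lam a) y - beta a / w).
Proof. by rewrite /t dotZ mulrBl mulrAC divff // mul1r. Qed.

(** The argument of a factor moves by a lattice element, so the multiplier of a
    factor is the exponential of a multiple of its linear form. *)
Lemma bigtheta_theta_fun : exists2 cf : 'I_n -> C, forall i, cf i != 0 &
  theta_fun tau form_mx cf Tht.
Proof.
pose mult (p : T * 'I_n) (k : C) := k != 0 /\ forall z,
  theta tau (z + tau *~ lam p.1 p.2) = k * cexp (- (z *~ lam p.1 p.2)) * theta tau z.
have [|k hk] := @choice _ _ mult.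
  by move=> [a i]; have [k k0 hk] := theta_taus tau0 (lam a i); exists k.
pose kap a i := k (a, i) * cexp (beta a / w *~ lam a i).
exists (fun i => \prod_(a <- s) kap a i ^+ c a) => [i|].
  rewrite prodf_seq_neq0; apply/allP => a _ /=.
  by rewrite expf_neq0 // mulf_neq0 ?cexp_neq0 // (hk (a, i)).1.
split.
  split=> [y|i y].
    change (differentiable (Th \o ( *:%R w)) y).
    apply: differentiable_comp; first exact: ex_diff.
    by apply: prod_diff => a _; exact: t_diff.
  rewrite /Tht /bigtheta; apply: eq_bigr => a _.
  by rewrite !tE dotD dot_ev addrAC theta_int.
move=> i y; rewrite /Tht /bigtheta.
have E a : t a (w *: (y + tau *: ev R i)) = kap a i * cexp (- (dot (lam a) y *~ lam a i)) * t a (w *: y).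
  rewrite !tE dotD dotZ dot_ev mulrzr addrAC (hk (a, i)).2 /kap /=.
  by rewrite mulrzBl opprB cexpD; ring.
have -> : cexp (- dot (form_mx i) y) = \prod_(a <- s) cexp (- (dot (lam a) y *~ lam a i)) ^+ c a.
  have E1 : dot (form_mx i) y = \sum_(a <- s) (dot (lam a) y *~ lam a i) *+ c a.
    rewrite /dot /form_mx.
    transitivity (\sum_j \sum_(a <- s) (c a)%:R * ((lam a i)%:~R * (lam a j)%:~R) * y 0 j).
      apply: eq_bigr => j _; rewrite -mulrzl rmorph_sum mulr_suml; apply: eq_bigr => a _.
      by rewrite !rmorphM /= -pmulrn.
    rewrite exchange_big /=; apply: eq_bigr => a _.
    rewrite -[RHS]mulr_natl -[X in _ = _ * X]mulrzl !mulr_sumr; apply: eq_bigr => j _.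
    by rewrite -[y 0 j *~ _]mulrzl; ring.
  rewrite E1; elim: s => [|a r IH]; first by rewrite !big_nil oppr0 cexp0.
  by rewrite !big_cons opprD cexpD IH -mulNrn cexp_nat.
rewrite -!big_split /=; apply: eq_bigr => a _.
by rewrite E !exprMn.
Qed.

Local Opaque bigtheta theta.

Section Dimension.
Variables (d : nat) (i0 i1 : 'I_n) (cc l0 : 'I_n -> int).
Hypothesis d0 : (0 < d)%N.
Hypothesis Mc : forall i, \sum_j form_mx i j * cc j = d%:Z * (i == i0)%:Z.
Hypothesis c1 : cc i1 = 1.
Hypothesis Ml0 : forall i, \sum_j form_mx i j * l0 j = d%:Z * (i == i1)%:Z.
Hypothesis gen : forall k, exists l (r : int), forall j, k j = row_mul form_mx l j + r * (j == i1)%:Z.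

Let form_sym i j : form_mx i j = form_mx j i.
Proof. by apply: eq_bigr => a _; rewrite [lam a i * _]mulrC. Qed.

(** The section of the line bundle with the given theta function. *)
Let sec (F : vec -> C) (y : ellpow L n) : C :=
  F (w^-1 *: ell_lift y) / Tht (w^-1 *: ell_lift y).

Let unscale (x : vec) : w *: (w^-1 *: x) = x.
Proof. by rewrite scalerA divff // scale1r. Qed.

Lemma invariant_lattice (g : vec -> C) (i : 'I_n) :
  (forall y, g (y + ev R i) = g y) -> (forall y, g (y + tau *: ev R i) = g y) ->
  forall (p q : int) y, g (y + (p%:~R + tau *~ q) *: ev R i) = g y.
Proof.
move=> g1 g2.
have int_step (u : vec) : (forall y, g (y + u) = g y) -> forall (p : int) y, g (y + u *~ p) = g y.
  move=> gu; have nat_step (p : nat) y : g (y + u *+ p) = g y.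
    by elim: p => [|p IH]; rewrite ?mulr0n ?addr0 // mulrSr addrA gu.
  case=> p y; first by rewrite -pmulrn.
  by rewrite NegzE mulrNz -pmulrn -[in RHS](subrK (u *+ p.+1) y) nat_step.
move=> p q y.
have -> : (p%:~R + tau *~ q) *: ev R i = ev R i *~ p + (tau *: ev R i) *~ q.
  have -> : tau *~ q = q%:~R * tau by rewrite mulrzl.
  by rewrite scalerDl scaler_int -scalerA scaler_int.
by rewrite addrA (int_step _ g2) (int_step _ g1).
Qed.

(** The multipliers cancel in the quotient, so it descends to the torus. *)
Lemma sec_covering cf F x : (forall i, cf i != 0) -> theta_fun tau form_mx cf F ->
  theta_fun tau form_mx cf Tht ->
  sec F (covering L x) = F (w^-1 *: x) / Tht (w^-1 *: x).
Proof.
move=> cf0 [[_ pF] qF] [[_ pT] qT]; rewrite /sec.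
pose g (y : vec) := F y / Tht y; rewrite -!/(g _).
have g1 i y : g (y + ev R i) = g y by rewrite /g pF pT.
have g2 i y : g (y + tau *: ev R i) = g y.
  rewrite /g qF qT; set k := cf i * _.
  have kn : k != 0 by rewrite mulf_neq0 ?cexp_neq0.
  by rewrite -mulf_div divff ?mul1r.
have hx : forall i, exists pq : int * int, ell_lift (covering L x) 0 i - x 0 i = w * (pq.1%:~R + tau *~ pq.2).
  move=> i; have /covering_eq /(_ i) /hL [p [q h]] := ell_liftK (covering L x).
  by exists (p, q).
have [pq hpq] := choice hx.
have -> : ell_lift (covering L x) = x + (ell_lift (covering L x) - x) by rewrite addrC subrK.
rewrite scalerDr.
have -> : w^-1 *: (ell_lift (covering L x) - x) = \sum_i ((pq i).1%:~R + tau *~ (pq i).2) *: ev R i.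
  rewrite [LHS]row_sum_delta; apply: eq_bigr => i _; congr (_ *: _).
  have e : (ell_lift (covering L x) - x) 0 i = ell_lift (covering L x) 0 i - x 0 i.
    by rewrite mxE [X in _ + X]mxE.
  by rewrite mxE e hpq mulKf.
elim/big_ind : _ (w^-1 *: x) => [y|a b Ha Hb y|i _ y]; first by rewrite addr0.
  by rewrite addrA Hb Ha.
exact: invariant_lattice.
Qed.

Let Th_zero (x : vec) : Tht (w^-1 *: x) = Th x.
Proof. by rewrite /Tht unscale. Qed.

Let Th_ext (F G : vec -> C) : (forall x, differentiable F x) -> (forall x, differentiable G x) ->
  (forall x, Th x != 0 -> F x = G x) -> forall x, F x = G x.
Proof.
move=> dF dG FG x; apply: (bigtheta_unique t_isolated (dF x) (dG x)).
by near=> y; exact: FG.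
Unshelve. all: by end_near. Qed.

Let scale_diff (k : C) (F : vec -> C) : (forall x, differentiable F x) ->
  forall x, differentiable (fun x => F (k *: x)) x.
Proof.
move=> dF x; change (differentiable (F \o ( *:%R k)) x).
by apply: differentiable_comp; [exact: ex_diff|exact: dF].
Qed.

Lemma sec_H0 cf F : (forall i, cf i != 0) -> theta_fun tau form_mx cf Tht ->
  theta_fun tau form_mx cf F -> H0 D (sec F).
Proof.
move=> cf0 tT tF; apply/(H0_terms c0 hD t_local t_isolated); split.
  move=> y; rewrite -[y in Defs.support D y]ell_liftK => /(support_terms c0 hD t_local).
  by rewrite /sec Th_zero => ->; rewrite invr0 mulr0.
exists (fun x => F (w^-1 *: x)) => [|x x0]; first by apply: scale_diff; exact: tF.1.1.
by rewrite (sec_covering _ cf0 tF tT) Th_zero divfK.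
Qed.

(** The product of a periodic function and [bigtheta] inherits the multipliers of
    the latter, first off the divisor and then everywhere. *)
Lemma H0_sec cf f : (forall i, cf i != 0) -> theta_fun tau form_mx cf Tht -> H0 D f ->
  exists2 F, theta_fun tau form_mx cf F & f = sec F.
Proof.
move=> cf0 tT /(H0_terms c0 hD t_local t_isolated)[f0 [F dF hF]].
have covE (x u : vec) : (forall i, u 0 i \in L) -> covering L (x + u) = covering L x.
  by move=> hu; apply/covering_eq => i; rewrite mxE addrAC subrr add0r.
have inL (i : 'I_n) (p q : int) : forall j, ((w * (p%:~R + tau *~ q)) *: ev R i) 0 j \in L.
  move=> j; rewrite !mxE eqxx /=; case: eqP => _; last by rewrite mulr0 rpred0.
  by rewrite mulr1; apply/hL; exists p, q.
have ThS (x : vec) (i : 'I_n) : Th (x + w *: ev R i) = Th x.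
  have e : w^-1 *: (x + w *: ev R i) = w^-1 *: x + ev R i.
    by rewrite scalerDr scalerA (mulVf w0) scale1r.
  have q := tT.1.2 i (w^-1 *: x).
  have q1 := Th_zero x.
  have q2 := Th_zero (x + w *: ev R i).
  rewrite e in q2.
  rewrite q in q2.
  by rewrite -q2.
have ThT (x : vec) (i : 'I_n) : Th (x + (w * tau) *: ev R i) = cf i * cexp (- dot (form_mx i) (w^-1 *: x)) * Th x.
  have e : w^-1 *: (x + (w * tau) *: ev R i) = w^-1 *: x + tau *: ev R i.
    by rewrite scalerDr scalerA (mulKf w0).
  exact: etrans (esym (Th_zero _)) (etrans (congr1 Tht e) (etrans (tT.2 i _)
    (congr1 (fun z => _ * z) (Th_zero x)))).
have shiftd (u : vec) x : differentiable (fun x => F (x + u)) x.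
  change (differentiable (F \o (fun x => x + u)) x).
  by apply: differentiable_comp; [exact: shift_diff|exact: dF].
have FS i : forall x, F (x + w *: ev R i) = F x.
  apply: Th_ext => [x|x|x x0]; [exact: shiftd|exact: dF|].
  have x1 : Th (x + w *: ev R i) != 0 by rewrite ThS.
  rewrite -(hF _ x1) -(hF _ x0) ThS covE // => j.
  by have := inL i 1 0 j; rewrite mulr0z addr0 mulr1.
pose mu i (x : vec) := cf i * cexp (- dot (form_mx i) (w^-1 *: x)).
have dmu i x : differentiable (mu i) x.
  apply: differentiableM; first exact: differentiable_cst.
  apply: cexp_comp_diff; apply: differentiableN.
  by apply: (@scale_diff w^-1 (dot (form_mx i))) => y; exact: dot_diff.
have FT i : forall x, F (x + (w * tau) *: ev R i) = mu i x * F x.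
  apply: Th_ext => [x|x|x x0]; first exact: shiftd.
    by apply: differentiableM; [exact: dmu|exact: dF].
  have x1 : Th (x + (w * tau) *: ev R i) != 0.
    by rewrite ThT mulf_neq0 // mulf_neq0 ?cexp_neq0.
  rewrite -(hF _ x1) -(hF _ x0) ThT covE => [|j]; first by rewrite /mu; ring.
  by have := inL i 0 1 j; rewrite mulr1z add0r.
exists (fun y => F (w *: y)).
  split; first split.
  - exact: scale_diff.
  - by move=> i y; rewrite scalerDr FS.
  move=> i y; rewrite scalerDr scalerA FT /mu.
  by rewrite scalerA (mulVf w0) scale1r.
apply/funext => y; rewrite /sec unscale -[y in LHS]ell_liftK Th_zero.
have [T0|T0] := eqVneq (Th (ell_lift y)) 0.
  by rewrite T0 invr0 mulr0 f0 //; apply/(support_terms c0 hD t_local).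
by rewrite -(hF _ T0) mulfK.
Qed.

(** The sections are the quotients of the theta functions by [bigtheta], which is
    one of them and not zero. *)
Lemma H0_dimension : has_dimension (H0 D) d.
Proof.
have [cf cf0 tT] := bigtheta_theta_fun.
have [x0 Tx0] : exists x0, Tht x0 != 0.
  have tr : \forall y \near (0 : vec), True by near=> y.
  have [y _ [_ Ty]] := bigtheta_dense s c t_isolated tr (@ltr01 R).
  by exists (w^-1 *: y); rewrite Th_zero.
have [b [tb hb]] := theta_basis cf0 form_sym d0 Mc c1 Ml0 gen tT Tx0.
have secD (k : 'I_d -> C) y : (\sum_(i < d) k i *: (fun y => sec (b i) y)) y =
    sec (fun x : vec => \sum_(i <- index_enum 'I_d) k i * b i x) y.
  rewrite fct_sumE /sec mulr_suml; apply: eq_bigr => i _.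
  by rewrite -mulrA.
have coef_comb (k : 'I_d -> C) (r : 'I_d) :
    coef (mode i1 (r : nat)%:Z) (fun x : vec => \sum_(i <- index_enum 'I_d) k i * b i x) = k r.
  have [-> _] := coef_sum (mode i1 (r : nat)%:Z) (index_enum 'I_d) (fun i => torusZ (k i) (tb i).1).
  rewrite (bigD1 r) //= big1 => [|i ir].
    by rewrite (coefZ _ _ (tb r).1) hb eqxx mulr1 addr0.
  by rewrite (coefZ _ _ (tb i).1) hb eq_sym (negPf ir) mulr0.
have tcomb (k : 'I_d -> C) := theta_fun_sum (index_enum 'I_d) k tb.
exists (fun i => sec (b i)); split=> [k k0 r|].
  rewrite -(coef_comb k r).
  have E : forall x : vec, Th x != 0 -> \sum_(i <- index_enum 'I_d) k i * b i (w^-1 *: x) = 0.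
    move=> x Tx; have := congr1 (fun g => g (covering L x)) k0; rewrite secD.
    rewrite (sec_covering _ cf0 (tcomb k) tT) Th_zero => /eqP.
    by rewrite mulf_eq0 invr_eq0 (negPf Tx) orbF => /eqP.
  have Z := Th_ext (scale_diff w^-1 (tcomb k).1.1) (fun x => differentiable_cst 0 x) E.
  have -> : (fun x : vec => \sum_(i <- index_enum 'I_d) k i * b i x) = (fun x : vec => 0 * Tht x).
    apply/funext => x; rewrite mul0r; have := Z (w *: x).
    by rewrite scalerA (mulVf w0) scale1r.
  by rewrite (coefZ _ _ tT.1) mul0r.
apply/seteqP; split=> [f /(H0_sec cf0 tT)[F tF ->]|f [k ->]]; last first.
  suff -> : \sum_(i < d) k i *: (fun y => sec (b i) y) =
      sec (fun x : vec => \sum_(i <- index_enum 'I_d) k i * b i x).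
    by apply: sec_H0 cf0 tT _; exact: tcomb.
  by apply/funext => y; exact: secD.
pose k (r : 'I_d) : C := coef (mode i1 (r : nat)%:Z) F; exists k.
suff E (x1 : vec) : F x1 = \sum_(i <- index_enum 'I_d) k i * b i x1.
  by apply/funext => y; rewrite secD /sec E.
have tG := theta_funB tF (tcomb k).
suff : F x1 + -1 * \sum_(i <- index_enum 'I_d) k i * b i x1 = 0.
  by rewrite mulN1r => /eqP; rewrite subr_eq0 => /eqP.
apply: (coef_mode_eq0 cf0 form_sym d0 Ml0 gen tG) => r.
rewrite (coefD _ tF.1 (torusZ (-1) (tcomb k).1)) (coefZ _ _ (tcomb k).1).
by rewrite coef_comb /k mulN1r subrr.
Unshelve. all: by end_near. Qed.
End Dimension.
End Sections.

(** * Continuants and tridiagonal matrices *)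

Section Continuants.

(** The continuants of [s] and of its tail. *)
Fixpoint contpair (s : seq int) : int * int :=
  if s is a :: s' then (a * (contpair s').1 - (contpair s').2, (contpair s').1) else (1, 0).

Definition cont s := (contpair s).1.

Lemma contpair2_cons a s : (contpair (a :: s)).2 = cont s. Proof. by []. Qed.

Lemma cont_gt s : all (fun a : int => 2 <= a) s -> 0 <= (contpair s).2 < cont s.
Proof.
rewrite /cont; elim: s => [//|a s IH] /= /andP[a2 /IH].
by set x := (contpair s).1; set y := (contpair s).2 => h; apply/andP; split; nia.
Qed.

Lemma cont_coprime s : coprimez (cont s) (contpair s).2.
Proof.
rewrite /cont; elim: s => [//|a s IH] /=; move: IH; rewrite /coprimez.
by rewrite [gcdz (_ - _) _]gcdzC gcdzMDl gcdzN.
Qed.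

Lemma cfrac_cont s : all (fun a : int => 2 <= a) s -> s != [::] ->
  cfrac s = (cont s)%:~R / (contpair s).2%:~R.
Proof.
elim: s => [//|a [|b s] IH] hs _.
  by rewrite /cont /= mulr1 subr0 divr1.
have hs' : all (fun a : int => 2 <= a) (b :: s) by case/andP: hs.
have -> : cfrac [:: a, b & s] = a%:Q - 1 / cfrac (b :: s) by [].
have -> : cont [:: a, b & s] = a * cont (b :: s) - (contpair (b :: s)).2 by [].
rewrite [(contpair [:: a, b & s]).2]contpair2_cons (IH hs' isT).
have /andP[x0 x1] := cont_gt hs'.
have y0 : (cont (b :: s))%:~R != 0 :> rat by rewrite intr_eq0; lia.
by rewrite [in RHS]rmorphB [in RHS]rmorphM div1r invf_div [RHS]mulrBl mulfK.
Qed.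

(** Both fractions are in lowest terms, because consecutive continuants are
    coprime. *)
Lemma cfrac_numerator (n k : nat) s : all (fun a : int => 2 <= a) s -> s != [::] ->
  (0 < k < n)%N -> coprime n k -> n%:Q / k%:Q = cfrac s -> n%:Z = cont s.
Proof.
move=> hs s0 /andP[k0 kn] cnk; rewrite cfrac_cont //.
have /andP[y0 xy] := cont_gt hs; have := cont_coprime s.
set X := cont s in xy *; set Y := (contpair s).2 in y0 xy * => cXY E.
have Y0 : Y != 0.
  apply/eqP => Y0; move/eqP: E; rewrite Y0 invr0 mulr0 mulf_eq0 invr_eq0 !intr_eq0; lia.
have k1 : k%:Z%:~R != 0 :> rat by rewrite intr_eq0; lia.
have Y1 : Y%:~R != 0 :> rat by rewrite intr_eq0.
have E2 : n%:Z * Y = X * k%:Z.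
  apply: (@intr_inj rat); rewrite !rmorphM /=.
  by move/eqP: E; rewrite eqr_div // => /eqP.
have d1 : (n%:Z %| X)%Z.
  rewrite -(@Gauss_dvdzl _ _ k%:Z); last by rewrite /coprimez /gcdz /= ; exact: cnk.
  by rewrite -E2 dvdz_mulr.
have d2 : (X %| n%:Z)%Z.
  by rewrite -(@Gauss_dvdzl _ _ Y) // E2 dvdz_mulr.
have : `|X|%N = n by apply/eqP; move: d1 d2; rewrite !dvdzE /= eqn_dvd => -> ->.
lia.
Qed.
End Continuants.

Section Tridiagonal.
Variables (m : nat) (ns : 'I_m.+1 -> int).

Definition tri (i j : 'I_m.+1) : int :=
  if i == j then ns i
  else if (i.+1 == j :> nat) || (j.+1 == i :> nat) then -1 else 0.

Lemma tri_sym i j : tri i j = tri j i.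
Proof. by rewrite /tri eq_sym orbC; case: eqP => // ->. Qed.

Lemma sum_at n (k : nat) (phi : nat -> int) :
  \sum_(j < n) ((j : nat) == k)%:Z * phi j = if (k < n)%N then phi k else 0.
Proof.
case: ifP => kn.
  rewrite (bigD1 (Ordinal kn)) //= eqxx mul1r big1 ?addr0 // => j.
  by rewrite -val_eqE /= => /negPf ->; rewrite mul0r.
by rewrite big1 // => j _; case: eqP => [E|]; rewrite ?mul0r //; rewrite -E ltn_ord in kn.
Qed.

Lemma tri_row (i : 'I_m.+1) (phi : nat -> int) :
  \sum_j tri i j * phi j =
    ns i * phi i - (if (i < m)%N then phi i.+1 else 0) - (if (0 < i)%N then phi i.-1 else 0).
Proof.
have E (j : 'I_m.+1) : tri i j * phi j = ns i * (((j : nat) == i)%:Z * phi j)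
    - ((j : nat) == i.+1)%:Z * phi j - (0 < i)%N%:Z * (((j : nat) == i.-1)%:Z * phi j).
  have e1 : ((j : nat) == i) = (i == j :> nat) by rewrite eq_sym.
  have e2 : ((j : nat) == i.+1) = (i.+1 == j :> nat) by rewrite eq_sym.
  have e3 : (0 < i)%N%:Z * ((j : nat) == i.-1)%:Z = (j.+1 == i :> nat)%:Z.
    by case: (i : nat) => [|k] /=; rewrite ?mul0r ?mul1r ?eqSS.
  rewrite [X in _ - X]mulrA e1 e2 e3 /tri -val_eqE /=.
  case: eqP => [->|h1]; first by rewrite !gtn_eqF //=; ring.
  by case: eqP => [<-|h2]; [rewrite gtn_eqF //=; ring|case: eqP => h3 /=; ring].
rewrite (eq_bigr _ (fun j _ => E j)) !sumrB -!mulr_sumr !sum_at ltn_ord ltnS.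
have -> : (i.-1 < m.+1)%N by have := ltn_ord i; lia.
by case: (0 < i)%N; rewrite ?mul1r ?mul0r.
Qed.

Definition nsq := [seq ns i | i <- enum 'I_m.+1].

Lemma size_nsq : size nsq = m.+1. Proof. by rewrite size_map size_enum_ord. Qed.

Lemma drop_nsq (i : 'I_m.+1) : drop i nsq = ns i :: drop i.+1 nsq.
Proof.
rewrite (drop_nth 0) ?size_nsq ?ltn_ord //; congr (_ :: _).
by rewrite (nth_map i) ?size_enum_ord ?ltn_ord // nth_ord_enum.
Qed.

(** The tail continuants form the first column of the adjugate matrix. *)
Lemma tri_cont (i : 'I_m.+1) :
  \sum_j tri i j * cont (drop (j : nat).+1 nsq) = cont nsq * (i == ord0)%:Z.
Proof.
rewrite (tri_row i (fun k => cont (drop k.+1 nsq))).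
have -> : ns i * cont (drop i.+1 nsq) - (if (i < m)%N then cont (drop i.+2 nsq) else 0) = cont (drop i nsq).
  rewrite drop_nsq /cont /=; congr (_ - _).
  case: ltnP => im.
    have hi : (i.+1 < m.+1)%N by [].
    by have := drop_nsq (Ordinal hi) => /= ->.
  by rewrite drop_oversize // size_nsq.
rewrite -val_eqE /=; case: (i : nat) => [|k] /=; first by rewrite drop0 mulr1 subr0.
by rewrite subrr mulr0.
Qed.

(** The class of the last basis vector generates the cokernel: the equations of
    all rows but the last can be solved recursively. *)
Fixpoint solve (a : int) (k : 'I_m.+1 -> int) (j : nat) : int * int :=
  if j is j'.+1 then
    (ns (inord j') * (solve a k j').1 - (solve a k j').2 - k (inord j'), (solve a k j').1)
  else (a, 0).

Lemma tri_solve a k (i : 'I_m.+1) : i != ord_max ->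
  \sum_j tri i j * (solve a k j).1 = k i.
Proof.
rewrite -val_eqE /= => im; rewrite (tri_row i (fun j => (solve a k j).1)).
have -> : (i < m)%N by have := ltn_ord i; lia.
rewrite /= inord_val.
have -> : (if (0 < i)%N then (solve a k i.-1).1 else 0) = (solve a k i).2 by case: (i : nat).
by ring.
Qed.

Lemma tri_gen (k : 'I_m.+1 -> int) : exists l (r : int), forall j,
  k j = row_mul tri l j + r * (j == ord_max)%:Z.
Proof.
exists (fun j => (solve 0 k j).1).
exists (k ord_max - row_mul tri (fun j => (solve 0 k j).1) ord_max) => j.
have [->|jm] := eqVneq j ord_max; first by rewrite mulr1 addrC subrK.
rewrite mulr0 addr0 -{1}(tri_solve 0 k jm); apply: eq_bigr => i _.
by rewrite mulrC tri_sym.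
Qed.

(** The last column of the adjugate matrix: [solve] gives a solution of all
    equations but the last, whose value is found by pairing with the first
    column. *)
Lemma tri_last : exists l, forall i, \sum_j tri i j * l j = cont nsq * (i == ord_max)%:Z.
Proof.
pose l (j : 'I_m.+1) := (solve 1 (fun=> 0) j).1; exists l => i.
have [->|im] := eqVneq i ord_max; last by rewrite mulr0 (tri_solve 1 (fun=> 0) im).
rewrite mulr1.
have E : \sum_(i < m.+1) cont (drop (i : nat).+1 nsq) * (\sum_j tri i j * l j) = cont nsq.
  under eq_bigr do rewrite mulr_sumr.
  rewrite exchange_big /=.
  transitivity (\sum_j l j * (cont nsq * (j == ord0)%:Z)).
    apply: eq_bigr => j _; rewrite -tri_cont mulr_sumr; apply: eq_bigr => i' _.
    by rewrite (tri_sym i' j); ring.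
  rewrite (bigD1 ord0) //= big1 => [|j j0]; first by rewrite /l /= mul1r mulr1 addr0.
  by rewrite (negPf j0) !mulr0.
rewrite -[RHS]E [RHS](bigD1 ord_max) //= [X in _ = _ + X]big1 => [|j jm]; last first.
  have -> : \sum_j0 tri j j0 * l j0 = 0 by exact: (tri_solve 1 (fun=> 0) jm).
  by rewrite mulr0.
by rewrite addr0 drop_oversize ?size_nsq // mul1r.
Qed.

(** Replacing the last column by the combination of the columns given by the
    tail continuants leaves a triangular minor. *)
Lemma tridiag_det_cont : tridiag_det ns = cont nsq.
Proof.
rewrite /tridiag_det; set A := \matrix_(i, j) _.
have AE i j : A i j = tri i j by rewrite mxE.
pose U := \matrix_(i < m.+1, j < m.+1)
  if j == ord_max then cont (drop (i : nat).+1 nsq) else (i == j)%:Z.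
have dU : \det U = 1.
  rewrite -det_tr det_trig.
    rewrite big1 // => i _; rewrite !mxE; case: eqP => [->|_]; last by rewrite eqxx.
    by rewrite drop_oversize ?size_nsq.
  apply/is_trig_mxP => i j ij; rewrite !mxE; case: eqP => [im|_].
    by move: ij; rewrite im /=; have := ltn_ord j; lia.
  by rewrite -val_eqE /= gtn_eqF.
rewrite -[\det A]mulr1 -dU -det_mulmx (expand_det_col _ ord_max).
have AU i j : (A *m U) i j = if j == ord_max then cont nsq * (i == ord0)%:Z else tri i j.
  rewrite mxE; case: (eqVneq j ord_max) => [->|jm].
    by rewrite -tri_cont; apply: eq_bigr => k _; rewrite AE mxE eqxx.
  rewrite (bigD1 j) //= big1 => [|k kj]; first by rewrite AE mxE (negPf jm) eqxx mulr1 addr0.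
  by rewrite AE mxE (negPf jm) (negPf kj) mulr0.
rewrite (bigD1 ord0) //= big1 => [|i i0]; last by rewrite AU eqxx (negPf i0) mulr0 mul0r.
rewrite AU !eqxx mulr1 addr0 -[RHS]mulr1; congr (_ * _).
rewrite /cofactor -det_tr det_trig.
  rewrite (eq_bigr (fun=> -1)) => [|i _].
    by rewrite prodr_const card_ord add0n -exprD addnn -signr_odd odd_double.
  rewrite mxE mxE mxE AU.
  have -> : (fintype.lift ord_max i == ord_max) = false by apply/negbTE; rewrite eq_sym neq_lift.
  rewrite /tri -val_eqE lift0 lift_max /=.
  have -> : bump m i = i by rewrite /bump leqNgt (ltn_ord i).
  by rewrite /bump leq0n add1n gtn_eqF //= eqxx orbT.
apply/is_trig_mxP => i j ij; rewrite mxE mxE mxE AU.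
have -> : (fintype.lift ord_max i == ord_max) = false by apply/negbTE; rewrite eq_sym neq_lift.
rewrite /tri -val_eqE lift0 lift_max /=.
have -> : bump m i = i by rewrite /bump leqNgt (ltn_ord i).
rewrite /bump leq0n add1n; case: ifP => [/eqP e|_]; first by exfalso; move: ij e => /=; clear; lia.
by case: ifP => // /orP[] /eqP e; exfalso; move: ij e => /=; clear; lia.
Qed.
End Tridiagonal.

(** * Standard divisors *)

Section Standard.
Variables (R : realType) (L : zmodClosed (Cx R)) (m : nat).
Local Notation C := (Cx R).
Local Notation E := (ellcurve L).
Variables (d : 'I_m.+1 -> divisor_curve L) (z : 'I_m -> E).
Hypothesis eff : forall i, effective (d i).

Let T : choiceType := (('I_m.+1 * E) + 'I_m)%type.

(** One index for each point of each of the divisors on the curve, and one for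
    each of the graphs. *)
Definition std_terms : seq T :=
  [seq inl (i, p) | i <- enum 'I_m.+1, p <- dom (d i)] ++ [seq inr j | j <- enum 'I_m].

Definition std_mult (a : T) : nat :=
  match a with inl ip => `|coeff ip.2 (d ip.1)|%N | inr _ => 1 end.

Definition std_comp (a : T) : set (ellpow L m.+1) :=
  match a with
  | inl ip => [set x : ellpow L m.+1 | x 0 ip.1 = ip.2]
  | inr j => Delta j (z j)
  end.

(** With [std_base], the equation of a component: an integral linear form whose
    value is prescribed modulo the lattice. *)
Definition std_form (a : T) (k : 'I_m.+1) : int :=
  match a with
  | inl ip => (k == ip.1)%:Z
  | inr j => ((k : nat) == j.+1)%:Z - ((k : nat) == j)%:Z
  end.

Definition std_base (a : T) : C :=
  match a with inl ip => repr ip.2 | inr j => repr (z j) end.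

Lemma std_mult_gt0 a : a \in std_terms -> (0 < std_mult a)%N.
Proof.
rewrite mem_cat => /orP[/allpairsPdep[i [p [_ hp ->]]]|/mapP[j _ ->]] //=.
by rewrite absz_gt0 -mem_dom.
Qed.

Lemma std_big (V : zmodType) (F : T -> V) :
  \sum_(a <- std_terms) F a =
  \sum_i \sum_(p <- dom (d i)) F (inl (i, p)) + \sum_j F (inr j).
Proof.
rewrite /std_terms big_cat /= big_allpairs_dep [X in _ + X = _]big_map.
by rewrite !big_enum.
Qed.

Lemma std_divisor : Ddz d z = \sum_(a <- std_terms) << (std_mult a)%:Z *g std_comp a >>.
Proof.
rewrite std_big /Ddz /pr_pullback; congr (_ + _).
apply: eq_bigr => i _; apply: eq_bigr => p _ /=.
by rewrite gez0_abs //; exact: eff.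
Qed.

Lemma dot_inl (ip : 'I_m.+1 * E) (x : 'rV[C]_m.+1) : dot (std_form (inl ip)) x = x 0 ip.1.
Proof.
rewrite /dot (bigD1 ip.1) //= big1 => [|j ji]; first by rewrite eqxx addr0.
by rewrite (negPf ji) mulr0z.
Qed.

Lemma dot_inr (j : 'I_m) (x : 'rV[C]_m.+1) :
  dot (std_form (inr j)) x = x 0 (fintype.lift ord0 j) - x 0 (widen_ord (leqnSn m) j).
Proof.
rewrite /dot /=; under eq_bigr do rewrite mulrzBr.
rewrite sumrB; congr (_ - _).
  rewrite (bigD1 (fintype.lift ord0 j)) //= big1 => [|k].
    by rewrite eqxx addr0.
  by rewrite -val_eqE /= => /negPf; rewrite /bump leq0n add1n => ->; rewrite mulr0z.
rewrite (bigD1 (widen_ord (leqnSn m) j)) //= big1 => [|k].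
  by rewrite eqxx addr0.
by rewrite -val_eqE /= => /negPf ->; rewrite mulr0z.
Qed.

Lemma std_comp_covering a (x : 'rV[C]_m.+1) :
  std_comp a (covering L x) <-> dot (std_form a) x - std_base a \in L.
Proof.
case: a => [ip|j].
  rewrite dot_inl /= mxE Quotient.idealrBE reprK.
  by split=> [->|/eqP].
rewrite dot_inr /= /Delta /= !mxE.
have -> : x 0 (fintype.lift ord0 j) - x 0 (widen_ord (leqnSn m) j) - repr (z j) =
    x 0 (fintype.lift ord0 j) - (x 0 (widen_ord (leqnSn m) j) + repr (z j)) by rewrite opprD addrA.
rewrite Quotient.idealrBE raddfD /= reprK.
by split=> [->|/eqP].
Qed.

Lemma std_primitive a : exists u : 'rV[C]_m.+1, dot (std_form a) u = 1.
Proof.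
case: a => [ip|j].
  by exists (ev R ip.1); rewrite dot_inl mxE !eqxx.
exists (ev R (fintype.lift ord0 j)); rewrite dot_inr !mxE !eqxx /=.
have -> : (widen_ord (leqnSn m) j == fintype.lift ord0 j) = false.
  by rewrite -val_eqE /= /bump leq0n add1n ltn_eqF.
by rewrite subr0.
Qed.

(** In the direction (1, ..., m + 1), no coordinate and no difference of
    consecutive coordinates is constant. *)
Lemma std_transversal a :
  dot (std_form a) (\row_(k < m.+1) (k.+1)%:R : 'rV[C]_m.+1) != 0.
Proof.
case: a => [ip|j]; first by rewrite dot_inl mxE pnatr_eq0.
rewrite dot_inr !mxE /= /bump leq0n add1n -[j.+2%:R]natr1 addrC addKr.
exact: oner_neq0.
Qed.

Lemma deg_sum (D : divisor_curve L) : deg D = \sum_(p <- dom D) coeff p D.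
Proof.
rewrite -[D in LHS]freeg_sumE raddf_sum; apply: eq_bigr => p _; exact: degU.
Qed.

(** A point of the [i]-th divisor adds 1 to the [i]-th diagonal entry, and the
    graph number [j] contributes [(x_(j+1) - x_j) ^+ 2]. *)
Lemma std_form_mx i j :
  form_mx std_terms std_mult std_form i j = tri (fun i => deg (d i) + 2 - ends i) i j.
Proof.
rewrite /form_mx std_big /=.
have -> : \sum_k \sum_(p <- dom (d k)) `|coeff p (d k)|%N%:Z * ((i == k)%:Z * (j == k)%:Z)
    = (i == j)%:Z * deg (d i).
  rewrite (bigD1 i) //= [X in _ + X]big1 => [|k ki]; last first.
    by apply: big1 => p _; rewrite eq_sym (negPf ki) mul0r mulr0.
  rewrite addr0 eqxx deg_sum mulr_sumr; apply: eq_bigr => p _.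
  by rewrite gez0_abs; [rewrite mul1r mulrC eq_sym|exact: eff].
have sum1 (k l : nat) : \sum_(r < m) (k == r)%:Z * (l == r)%:Z = ((k == l) && (k < m)%N)%:Z.
  under eq_bigr do rewrite (eq_sym k).
  rewrite (sum_at m k (fun r => (l == r)%:Z)) eq_sym.
  by case: ltnP; rewrite ?andbT ?andbF.
have sum2 (k l : nat) : \sum_(r < m) (k == r.+1)%:Z * (l == r.+1)%:Z
    = [&& k == l, (0 < k)%N & (k <= m)%N]%:Z.
  case: k => [|k]; first by rewrite andbF big1 // => r _; rewrite mul0r.
  case: l => [|l]; first by rewrite big1 // => r _; rewrite mulr0.
  by under eq_bigr do rewrite !eqSS; rewrite sum1 eqSS.
have sum3 (k l : nat) : \sum_(r < m) (k == r.+1)%:Z * (l == r)%:Z = ((k == l.+1) && (l < m)%N)%:Z.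
  case: k => [|k]; first by rewrite big1 // => r _; rewrite mul0r.
  under eq_bigr do rewrite eqSS.
  by rewrite sum1 eqSS; case: eqP => // ->.
have -> : \sum_(r < m) 1%:Z * (((i == r.+1 :> nat)%:Z - (i == r :> nat)%:Z) *
      ((j == r.+1 :> nat)%:Z - (j == r :> nat)%:Z)) =
    [&& i == j :> nat, (0 < i)%N & (i <= m)%N]%:Z - ((i == j.+1 :> nat) && (j < m)%N)%:Z
     - ((j == i.+1 :> nat) && (i < m)%N)%:Z + ((i == j :> nat) && (i < m)%N)%:Z.
  rewrite -sum2 -!sum3 -sum1 -!sumrB -big_split; apply: eq_bigr => r _ /=.
  by rewrite mul1r; ring.
have := ltn_ord i; have := ltn_ord j; rewrite !ltnS => jm im.
rewrite /tri /ends -!val_eqE /=; case: eqP => [ij|ij].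
  have -> : (i == j.+1 :> nat) = false by lia.
  have -> : (j == i.+1 :> nat) = false by lia.
  rewrite im /= andbT mul1r.
  have -> : (0 < i)%N = ~~ (i == 0 :> nat) by rewrite lt0n.
  have -> : (i < m)%N = ~~ (i == m :> nat) by rewrite ltn_neqAle im andbT.
  by case: eqP; case: eqP => _ _ /=; lia.
rewrite /= mul0r add0r add0r addr0 [i.+1 == j :> nat]eq_sym [j.+1 == i :> nat]eq_sym.
have [e1|e1] := eqVneq (j : nat) i.+1.
  have -> : (i == j.+1 :> nat) = false by lia.
  have -> : (i < m)%N by lia.
  by [].
have [e2|e2] := eqVneq (i : nat) j.+1; last by [].
have -> : (j < m)%N by lia.
by [].
Qed.

(** [tri_cont] and [tri_last] provide the columns of the inverse matrix by which
    the theta functions are translated. *)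
Lemma standard_dimension : is_lattice L ->
  (forall i, 2 <= deg (d i) + 2 - ends i) ->
  exists2 h : nat, has_dimension (H0 (Ddz d z)) h &
    h%:Z = tridiag_det (fun i => deg (d i) + 2 - ends i).
Proof.
move=> /lattice_normal[w [tau [w0 tau0 hL]]]; pose ns (i : 'I_m.+1) : int := deg (d i) + 2 - ends i.
rewrite -/ns => ns2.
have all2 : all (fun a : int => 2 <= a) (nsq ns).
  by apply/allP => a /mapP[i _ ->]; exact: ns2.
have /andP[c0 c1] := cont_gt all2.
have cpos : (0 < `|cont (nsq ns)|)%N by rewrite absz_gt0; apply/eqP; lia.
have cE : `|cont (nsq ns)|%N%:Z = cont (nsq ns) by apply: gez0_abs; lia.
exists `|cont (nsq ns)|%N; last by rewrite tridiag_det_cont.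
have [l0 hl0] := tri_last ns.
have FE i j : form_mx std_terms std_mult std_form i j = tri ns i j by exact: std_form_mx.
apply: (H0_dimension w0 tau0 hL std_mult_gt0 std_divisor std_comp_covering std_primitive
  std_transversal cpos (i0 := ord0) (i1 := ord_max)
  (cc := fun j : 'I_m.+1 => cont (drop (j : nat).+1 (nsq ns))) (l0 := l0)).
- move=> i; rewrite cE -(tri_cont ns i); apply: eq_bigr => j _; by rewrite FE.
- by rewrite drop_oversize // size_nsq.
- move=> i; rewrite cE -hl0; apply: eq_bigr => j _; by rewrite FE.
move=> k; have [l [r hk]] := tri_gen ns k; exists l, r => j.
rewrite hk; congr (_ + _); apply: eq_bigr => i _; by rewrite FE.
Qed.
End Standard.

Local Close Scope classical_set_scope.

Theorem corollary3p7 (R : realType) (L : zmodClosed (Cx R)) (hL : is_lattice L)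
    (m : nat) :
  (forall (D : divisor L m.+1) (ns : 'I_m.+1 -> int),
     is_standard_of_type D ns -> (forall i, 2 <= ns i) ->
     exists2 h : nat, has_dimension (H0 D) h & h%:Z = tridiag_det ns) /\
  (forall (n k : nat) (ns : 'I_m.+1 -> int),
     (0 < k < n)%N -> coprime n k -> (forall i, 2 <= ns i) ->
     n%:Q / k%:Q = cfrac [seq ns i | i <- enum 'I_m.+1] ->
     has_dimension (H0 (Dfrac L ns)) n).
Proof.
have standard (D : divisor L m.+1) (ns : 'I_m.+1 -> int) :
     is_standard_of_type D ns -> (forall i, 2 <= ns i) ->
     exists2 h : nat, has_dimension (H0 D) h & h%:Z = tridiag_det ns.
  move=> [d [z [eff -> hns]]] ns2.
  have nsE : ns = fun i => deg (d i) + 2 - ends i by apply/funext.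
  by rewrite nsE in ns2 *; exact: standard_dimension.
split=> // n k ns kn cnk ns2 nk.
have std : is_standard_of_type (Dfrac L ns) ns.
  exists (fun i => << (ns i - 2 + ends i) *g (0 : ellcurve L) >>), (fun=> 0); split=> //.
    move=> i p; rewrite coeffU; apply: mulr_ge0 => //.
    by have := ns2 i; rewrite /ends; lia.
  by move=> i; rewrite degU; ring.
have [h dimh hE] := standard _ _ std ns2.
suff -> : n = h by [].
apply/eqP; rewrite -eqz_nat hE tridiag_det_cont; apply/eqP.
apply: cfrac_numerator kn cnk nk; last by rewrite -size_eq0 size_map size_enum_ord.
by apply/allP => a /mapP[i _ ->]; exact: ns2.
Qed.
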